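(* Let $X$ be a globally hyperbolic, strongly causal, and locally causally closed regular Lorentzian pre-length space. If $X$ is locally concave and future one-connected, then the following holds: (i) Every pair of timelike related points $x\ll y$ is connected by a unique timelike geodesic. (ii) Geodesics vary continuously with their endpoints. Moreover, if $X$ is a Lorentzian length space, then (iii) $X$ is globally concave, i.e. the whole space $X$ is a comparison neighborhood.
   Context: A Lorentzian pre-length space is a tuple $(X,d,\ll,\leq,\tau)$ where $(X,d)$ is a metric space (all topological notions refer to $d$), $\leq$ is a reflexive transitive relation (causal relation), $\ll$ is a transitive relation contained in $\leq$ (timelike relation), and $\tau\colon X\times X\to[0,\infty]$ (time separation) is lower semicontinuous with $\tau(x,z)\geq\tau(x,y)+\tau(y,z)$ for $x\leq y\leq z$, and $\tau(x,y)>0$ iff $x\ll y$. Put $I^+(x)=\{y: x\ll y\}$, $I^-(x)=\{y: y\ll x\}$, $J^\pm(x)$ likewise with $\leq$, $I(x,y)=I^+(x)\cap I^-(y)$, $J(x,y)=J^+(x)\cap J^-(y)$; $x<y$ means $x\le y$, $x\neq y$. Curves. A non-constant, locally Lipschitz curve $\gamma$ on an interval is future-directed causal (timelike) if $\gamma(t_1)\leq\gamma(t_2)$ (resp. $\gamma(t_1)\ll\gamma(t_2)$) whenever $t_1<t_2$; past-directed curves are defined by reversing the relations. The length $L(\gamma)$ of a future-directed causal curve is $\inf\sum_{i}\tau(\gamma(t_{i-1}),\gamma(t_i))$ over all partitions of its domain. A maximizer is a future-directed causal curve $\gamma$ from $x$ to $y$ with $L(\gamma)=\tau(x,y)$ (similarly,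 with time reversed, for past-directed curves). A geodesic is a causal curve that is locally a maximizer: every parameter has a neighborhood in the domain on which the restriction is a maximizer. Timelike maximizers and timelike geodesics are taken with constant-speed parametrization ($\tau$-length from the initial point proportional to the parameter), and uniqueness of such curves is understood up to reparametrization. $X$ is regular if every maximizer between timelike related points is timelike. $X$ is strongly causal if the sets $I(x,y)$ form a subbasis of the topology of $(X,d)$. $X$ is globally hyperbolic if all causal diamonds $J(x,y)$ are compact and for every compact $K\subseteq X$ there is a constant $C(K)$ bounding the $d$-arclength of all causal curves contained in $K$. $X$ is locally causally closed if every point has a neighborhood $U$ such that $p_n\leq q_n$, $p_n,q_n\in U$, $p_n\to p\in\overline U$, $q_n\to q\in\overline U$ imply $p\leq q$. $X$ is causally path-connected if any $x\ll y$ are joined by a future-directed timelike curve and any $x<y$ by a future-directed causal curve. $X$ is localizable if every $x\in X$ has an open neighborhood $\Omega$ such that: there is $C>0$ bounding the $d$-arclength of all causal curves in $\Omega$; there is a continuous $\omega\colon\Omega\times\Omega\to[0,\infty)$ making $\Omega$ (with restricted $d,\ll,\leq$ and with $\omega$ as time separation) a Lorentzian pre-length space with $I^\pm(y)\cap\Omega\neq\varnothing$ for all $y\in\Omega$; and for all $p<q$ in $\Omega$ there is a future-directed causal curve from $p$ to $q$ in $\Omega$ which is of maximal length among such curves in $\Omega$ and whose length equals $\omega(p,q)\leq\tau(p,q)$. A Lorentzian length space is a locally causally closed, causally path-connected, localizable Lorentzian pre-length space with $\tau(x,y)=\sup\{L(\gamma): \gamma$ future-directed causal from $x$ to $y\}$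 (sup of the empty set being $0$). A comparison neighborhood is a set $U\subseteq X$ (a neighborhood of the point considered) such that: (1) $\tau|_{U\times U}$ is continuous; (2) for all $x,y\in U$ with $x\ll y$ there is a future-directed causal curve from $x$ to $y$ within $U$ of length $\tau(x,y)$; (3) for any two timelike maximizers $\alpha,\beta\colon[0,1]\to U$ with the same time orientation such that [$\alpha(0)\ll\beta(0)$ or $\alpha(0)=\beta(0)$] and [$\alpha(1)\ll\beta(1)$ or $\alpha(1)=\beta(1)$], one has $\tau(\alpha(t),\beta(t))\geq t\,\tau(\alpha(1),\beta(1))+(1-t)\,\tau(\alpha(0),\beta(0))$ for all $t\in[0,1]$. $X$ is locally concave if every point of $X$ has a comparison neighborhood. A timelike homotopy between future-directed timelike curves $\gamma_0,\gamma_1\colon[0,1]\to X$ is a continuous map $H\colon[0,1]^2\to X$ with $H(0,\cdot)=\gamma_0$, $H(1,\cdot)=\gamma_1$ and every $H(s,\cdot)$ future-directed timelike. $X$ is future one-connected if any $x\ll y$ are joined by a future-directed timelike curve and any two future-directed timelike curves with common endpoints are timelike homotopic with fixed endpoints. When each $x\ll y$ is joined by a unique timelike geodesic $\gamma_{xy}\colon[0,1]\to X$, ''geodesics vary continuously with their endpoints'' means that $(x,y,t)\mapsto\gamma_{xy}(t)$ is continuous on $\{(x,y): x\ll y\}\times[0,1]$. *)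

(* Defs.v *)
(* MathComp-Analysis: [X : metricType R] is the metric space (X, d) with
   d = [mdist], over an arbitrary model [R : realType] of the real numbers. *)
From mathcomp Require Import all_boot all_order all_algebra.
From mathcomp Require Import all_classical all_reals all_analysis.

Set Implicit Arguments.
Unset Strict Implicit.
Unset Printing Implicit Defensive.

Import Order.TTheory GRing.Theory Num.Theory.
Import numFieldNormedType.Exports.

Local Open Scope classical_set_scope.
Local Open Scope ring_scope.

Record causal_data (R : realType) (X : metricType R) := CausalData {
  chron : X -> X -> Prop;     (* x << y *)
  caus : X -> X -> Prop;      (* x <= y *)
  tau : X -> X -> \bar R
}.

Definition time_dual (R : realType) (X : metricType R) (L : causal_data X) :
  causal_data X :=
  CausalData (fun x y => chron L y x) (fun x y => caus L y x)
             (fun x y => tau L y x).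

(* The subset [A], with the restrictions of d and of the data [L], is a
   Lorentzian pre-length space. *)
Record lorentzian_pre_length_on (R : realType) (X : metricType R)
    (A : set X) (L : causal_data X) : Prop := {
  caus_refl : forall x, A x -> caus L x x;
  caus_trans : forall x y z, A x -> A y -> A z ->
    caus L x y -> caus L y z -> caus L x z;
  chron_trans : forall x y z, A x -> A y -> A z ->
    chron L x y -> chron L y z -> chron L x z;
  chron_caus : forall x y, A x -> A y -> chron L x y -> caus L x y;
  tau_ge0 : forall x y, A x -> A y -> (0 <= tau L x y)%E;
  tau_lsc : lower_semicontinuous
    (fun p : subspace (A `*` A) => tau L p.1 p.2);
  tau_triangle : forall x y z, A x -> A y -> A z ->
    caus L x y -> caus L y z -> (tau L x y + tau L y z <= tau L x z)%E;
  tau_gt0 : forall x y, A x -> A y -> (0 < tau L x y)%E <-> chron L x y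
}.

Definition lorentzian_pre_length_space (R : realType) (X : metricType R)
  (L : causal_data X) : Prop := lorentzian_pre_length_on [set: X] L.

Section Curves.
Context {R : realType} {X : metricType R}.
Implicit Types (L : causal_data X) (D : set R) (g : R -> X) (a b : R).

(* A curve is a total function [g : R -> X] together with a domain [D];
   the values of [g] outside [D] are irrelevant. *)

Definition locally_lipschitz D g : Prop := forall t, D t ->
  exists e k : R, 0 < e /\ forall s u, D s -> D u ->
    ball t e s -> ball t e u -> mdist (g s) (g u) <= k * `|s - u|.

Definition directed_curve (r : X -> X -> Prop) D g : Prop :=
  [/\ is_interval D,
      exists s t, [/\ D s, D t & g s <> g t],
      locally_lipschitz D g &
      forall s t, D s -> D t -> s < t -> r (g s) (g t)].

Definition future_causal L D g : Prop := directed_curve (caus L) D g.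
Definition future_timelike L D g : Prop := directed_curve (chron L) D g.
Definition past_causal L D g : Prop := future_causal (time_dual L) D g.

Definition causal L D g : Prop := future_causal L D g \/ past_causal L D g.

Definition arclength D g : \bar R :=
  ereal_sup [set (\sum_(0 <= i < (size s).-1)
                    mdist (g (nth 0 s i)) (g (nth 0 s i.+1)))%:E
            | s in [set s : seq R | sorted <%R s /\ forall t, t \in s -> D t]].

(* The length of the restriction of [g] to [a, b]. *)
Definition tau_length L a b g : \bar R :=
  ereal_inf [set (let p := g \o nth b (a :: s) in
                  \sum_(0 <= i < size s) tau L (p i) (p i.+1))%E
            | s in itv_partition a b].

Definition maximizer L a b g : Prop :=
  future_causal L `[a, b] g /\ tau_length L a b g = tau L (g a) (g b).

(* Past-directed geodesics are those of [time_dual L]. *)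
Definition geodesic L D g : Prop :=
  future_causal L D g /\
  forall t, D t -> exists c d,
    [/\ `[c, d] `<=` D, within D (nbhs t) `[c, d]%classic & maximizer L c d g].

Definition timelike_maximizer L a b g : Prop :=
  future_timelike L `[a, b] g /\ maximizer L a b g.

Definition timelike_geodesic L a b g : Prop :=
  future_timelike L `[a, b] g /\ geodesic L `[a, b] g.

(* [h] on [c, d] is obtained from [g] on [a, b] by an orientation-preserving
   change of parameter.  The change of parameter is only required to be
   monotone: when [h] is timelike, or of constant positive speed, it is
   automatically strictly increasing if no point satisfies x << x. *)
Definition reparametrization c d h a b g : Prop :=
  exists phi : R -> R,
    [/\ {within `[c, d], continuous phi},
        {in `[c, d] &, {homo phi : s t / s <= t}},
        phi c = a, phi d = b &
        {in `[c, d], forall t, h t = g (phi t)}].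

(* The constant-speed parametrization of a locally Lipschitz timelike curve is
   continuous but need not be locally Lipschitz for d; hence it is a
   reparametrization of such a curve rather than such a curve itself. *)
Definition constant_speed L g : Prop :=
  exists c : R, forall t, 0 <= t <= 1 -> tau_length L 0 t g = (c * t)%:E.

Definition cs_timelike_maximizer L g : Prop :=
  constant_speed L g /\
  exists a b h, timelike_maximizer L a b h /\ reparametrization 0 1 g a b h.

Definition cs_timelike_geodesic L g : Prop :=
  constant_speed L g /\
  exists a b h, timelike_geodesic L a b h /\ reparametrization 0 1 g a b h.

End Curves.

Section Spaces.
Context {R : realType} {X : metricType R}.
Implicit Types (L : causal_data X) (U : set X).

Definition chron_diamond L (x y : X) : set X :=
  [set z | chron L x z /\ chron L z y].

Definition causal_diamond L (x y : X) : set X :=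
  [set z | caus L x z /\ caus L z y].

(* A causal curve may be constant on a subinterval, in which case
   chron L (g s) (g t) fails there whatever the image of g is.  Being timelike
   is therefore meant up to reparametrization; for a nowhere constant g it
   gives chron L (g s) (g t) for all s < t. *)
Definition regular L : Prop := forall a b g,
  maximizer L a b g -> chron L (g a) (g b) ->
  exists c d h, future_timelike L `[c, d] h /\ reparametrization a b g c d h.

Definition strongly_causal L : Prop :=
  basis (finI_from [set: X * X] (fun p => chron_diamond L p.1 p.2)).

Definition globally_hyperbolic L : Prop :=
  (forall x y, compact (causal_diamond L x y)) /\
  (forall K, compact K -> exists C : R, forall D g,
     causal L D g -> g @` D `<=` K -> (arclength D g <= C%:E)%E).

Definition locally_causally_closed L : Prop := forall x : X, exists2 U, nbhs x U &
  forall (p q : nat -> X) (p0 q0 : X),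
    (forall n, [/\ U (p n), U (q n) & caus L (p n) (q n)]) ->
    p @ \oo --> p0 -> q @ \oo --> q0 -> closure U p0 -> closure U q0 ->
    caus L p0 q0.

Definition causally_path_connected L : Prop :=
  (forall x y, chron L x y -> exists a b g,
     [/\ future_timelike L `[a, b] g, g a = x & g b = y]) /\
  (forall x y, caus L x y -> x <> y -> exists a b g,
     [/\ future_causal L `[a, b] g, g a = x & g b = y]).

Definition causal_curve_in L U (x y : X) (a b : R) g : Prop :=
  [/\ future_causal L `[a, b] g, g a = x, g b = y & g @` `[a, b] `<=` U].

Definition localizable L : Prop := forall x : X, exists Om : set X,
  [/\ open Om, Om x,
      exists C : R, forall D g,
        causal L D g -> g @` D `<=` Om -> (arclength D g <= C%:E)%E &
      exists omega : X -> X -> R,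
        [/\ {within Om `*` Om, continuous (fun p => omega p.1 p.2)},
            lorentzian_pre_length_on Om
              (CausalData (chron L) (caus L) (fun y z => (omega y z)%:E)),
            forall y, Om y -> (exists2 z, Om z & chron L y z) /\
                              (exists2 z, Om z & chron L z y) &
            forall p q, Om p -> Om q -> caus L p q -> p <> q ->
              exists a b g,
                [/\ causal_curve_in L Om p q a b g,
                    forall a' b' g', causal_curve_in L Om p q a' b' g' ->
                      (tau_length L a' b' g' <= tau_length L a b g)%E,
                    tau_length L a b g = (omega p q)%:E &
                    ((omega p q)%:E <= tau L p q)%E]]].

(* [maxe 0] accounts for the convention that the supremum of the empty set is
   0: [ereal_sup set0] is -oo. *)
Definition lorentzian_length_space L : Prop :=
  [/\ lorentzian_pre_length_space L, locally_causally_closed L,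
      causally_path_connected L, localizable L &
      forall x y, tau L x y =
        maxe 0%E (ereal_sup [set l | exists a b g,
                  causal_curve_in L setT x y a b g /\ l = tau_length L a b g])].

(* For [L' = time_dual L] this is the concavity inequality for past-directed
   maximizers; the inequality itself always refers to [L]. *)
Definition concave_along L L' U : Prop := forall al be : R -> X,
  cs_timelike_maximizer L' al -> cs_timelike_maximizer L' be ->
  al @` `[0, 1] `<=` U -> be @` `[0, 1] `<=` U ->
  chron L (al 0) (be 0) \/ al 0 = be 0 ->
  chron L (al 1) (be 1) \/ al 1 = be 1 ->
  forall t : R, 0 <= t <= 1 ->
    (t%:E * tau L (al 1%R) (be 1%R) + (1 - t)%R%:E * tau L (al 0%R) (be 0%R)
       <= tau L (al t) (be t))%E.

Definition comparison_set L U : Prop :=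
  [/\ {within U `*` U, continuous (fun p => tau L p.1 p.2)},
      forall x y, U x -> U y -> chron L x y -> exists a b g,
        causal_curve_in L U x y a b g /\ tau_length L a b g = tau L x y,
      concave_along L L U &
      concave_along L (time_dual L) U].

Definition locally_concave L : Prop :=
  forall x : X, exists2 U, nbhs x U & comparison_set L U.

Definition globally_concave L : Prop := comparison_set L setT.

Definition timelike_homotopic_rel L (x y : X) (g0 g1 : R -> X) : Prop :=
  exists H : R * R -> X,
    [/\ {within `[0, 1] `*` `[0, 1], continuous H},
        {in `[0, 1], forall t, H (0, t) = g0 t /\ H (1, t) = g1 t},
        {in `[0, 1], forall s, future_timelike L `[0, 1] (fun t => H (s, t))} &
        {in `[0, 1], forall s, H (s, 0) = x /\ H (s, 1) = y}].

Definition future_one_connected L : Prop :=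
  (forall x y, chron L x y -> exists a b g,
     [/\ future_timelike L `[a, b] g, g a = x & g b = y]) /\
  (forall x y g0 g1,
     future_timelike L `[0, 1] g0 -> g0 0 = x -> g0 1 = y ->
     future_timelike L `[0, 1] g1 -> g1 0 = x -> g1 1 = y ->
     timelike_homotopic_rel L x y g0 g1).

Definition unique_timelike_geodesic L (x y : X) : Prop :=
  exists g : R -> X,
    [/\ cs_timelike_geodesic L g, g 0 = x, g 1 = y &
        forall a b h, timelike_geodesic L a b h -> h a = x -> h b = y ->
          reparametrization a b h 0 1 g].

(* [G x y] is any constant-speed timelike geodesic from x to y on [0, 1]. *)
Definition geodesics_vary_continuously L : Prop :=
  forall G : X -> X -> R -> X,
    (forall x y, chron L x y ->
       [/\ cs_timelike_geodesic L (G x y), G x y 0 = x & G x y 1 = y]) ->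
    {within [set p : X * X * R | chron L p.1.1 p.1.2 /\ 0 <= p.2 <= 1],
      continuous (fun p : X * X * R => G p.1.1 p.1.2 p.2)}.

End Spaces.

(* Main.v *)
(** Strong causality gives every point arbitrarily small causally convex
    neighbourhoods inside a comparison neighbourhood; there [tau] is finite and
    continuous, and concavity makes maximizers unique.  Say that [g] is a
    geodesic of speed [k] if [tau (g s) (g t) = k (t - s)] for all nearby
    [s <= t].

    Comparing two geodesics with a common start along a fine grid turns the
    local concavity into a thin-triangle inequality along the whole geodesic,
    and hence into local uniqueness.  For end points near those of a given
    geodesic, a geodesic joining them is found by maximizing the sum of
    [sqrt (tau p_i p_i+1)] over chains whose vertices lie in small causal
    diamonds: at an interior maximum consecutive values of [tau] agree and every
    vertex is a midpoint, so the chain spans a geodesic.  Causal diamonds being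
    compact, limits of geodesics are geodesics.

    As in the Cartan-Hadamard theorem, a timelike curve issuing from [x] lifts
    to a continuous family of geodesics from [x] to its points, which gives
    existence, and the monodromy of this lifting along a timelike homotopy gives
    uniqueness; continuous dependence is then local existence.  In a length
    space the length of a causal curve is at most that of the geodesic with the
    same ends, so geodesics are globally maximizing, and global concavity
    follows by adding up thin triangles along the geodesic opposite to the
    common vertex and by cutting quadrilaterals along a diagonal. *)

Require Import Defs.
From mathcomp Require Import all_boot all_order all_algebra.
From mathcomp Require Import all_classical all_reals all_analysis.
From mathcomp Require Import ring lra.

Set Implicit Arguments.
Unset Strict Implicit.
Unset Printing Implicit Defensive.

Import Order.TTheory GRing.Theory Num.Theory.
Import numFieldNormedType.Exports.

Local Open Scope classical_set_scope.
Local Open Scope ring_scope.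

(** * Chains of intervals, curves and ultrafilters *)

(** Three difficulties shape the arguments. First, before a length structure is assumed, the value
    of tau between distant points is not known to agree with the length of a geodesic. The speed [k]
    therefore stands in for it, and exact values of tau are used only for pairs in a common small
    convex set. Second, geodesics parametrized by tau have no common Lipschitz bound, so
    Arzela-Ascoli gives way to pointwise limits along an ultrafilter, and the work lies in showing
    that such a limit does not jump. The limit must not degenerate to speed 0 either; this is
    excluded because the speed of the geodesic from [x] to a point moving along a future-directed
    curve never decreases. Third, concavity applies only when ends are strictly related or equal.
    Comparisons are thus made for a slightly shortened curve and passed to the limit, and chains are
    kept inside their diamonds by barriers. Moreover concavity is given only for curves that
    reparametrize Lipschitz ones, a class with no evident closure under limits; hence [tmax] and
    [geo] are merely continuous, and [ltl] records the link with the given class. *)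

Section Intervals.
Context {R : realType}.
Implicit Types (a b s t : R).

(** Real induction. The local property at the supremum of the parameters reachable from [a] bridges
    across that supremum, so it is reached and equals [b]. This replaces explicit subdivisions: [P]
    is typically an additive inequality, or an implication [A s -> A t] propagating a property. *)
Lemma interval_chain a b (P : R -> R -> Prop) : a <= b ->
  (forall s t r, a <= s -> s <= t -> t <= r -> r <= b ->
     P s t -> P t r -> P s r) ->
  (forall t, a <= t <= b -> exists2 e, 0 < e &
     forall s s', a <= s -> s <= s' -> s' <= b ->
       `|s - t| < e -> `|s' - t| < e -> P s s') ->
  P a b.
Proof.
move=> ab Ptr Ploc.
pose S := [set t | a <= t <= b /\ P a t].
have Sa : S a.
  split; first by rewrite lexx.
  have /Ploc[e e0 Pe] : a <= a <= b by rewrite lexx.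
  by apply: Pe; rewrite ?subrr ?normr0.
have supS : has_sup S by split; [exists a | exists b => t [/andP[]]].
pose c := sup S.
have ac : a <= c by apply: ub_le_sup => //; exact: supS.2.
have cb : c <= b by apply: ge_sup => [|t [/andP[]]//]; exists a.
have /Ploc[e e0 Pe] : a <= c <= b by rewrite ac cb.
have [t [/andP[at_ tb] Pat] ct] := sup_adherent e0 supS; rewrite -/c in ct.
have tc : t <= c by apply: ub_le_sup; [exact: supS.2|split => //; rewrite at_].
have key s : t <= s -> s <= b -> s < c + e -> P a s.
  move=> ts sb sce; apply: (Ptr a t s) => //; apply: Pe => //.
    by rewrite ltr_norml; apply/andP; split; lra.
  by rewrite ltr_norml; apply/andP; split; lra.
have [bce|ceb] := ltP b (c + e); first by apply: key.
have : S (c + e / 2).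
  by split; [apply/andP; split; lra|apply: key; lra].
by move/(ub_le_sup supS.2); rewrite -/c => ?; lra.
Qed.

(** Lebesgue number lemma. *)
Lemma interval_uniform a b (Q : R -> R -> Prop) :
  (forall t, a <= t <= b -> exists2 e, 0 < e &
     forall s s', a <= s <= b -> a <= s' <= b ->
       `|s - t| < e -> `|s' - t| < e -> Q s s') ->
  exists2 d, 0 < d & forall s s', a <= s <= b -> a <= s' <= b ->
    `|s - s'| < d -> Q s s'.
Proof.
move=> Qloc.
pose P d t := forall s', a <= s' <= b -> `|t - s'| < d ->
  a <= t <= b -> Q t s'.
have /compact_near_coveringP/(_ R (0^'+) P) := @segment_compact R a b.
case=> [t /=|d /= d0 dP].
  rewrite in_itv /= => /Qloc[e e0 Qe].
  exists (ball t (e / 2), [set d | d < e / 2]).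
    split; first by apply: nbhsx_ballx; rewrite divr_gt0.
    by apply: nbhs_right_lt; rewrite divr_gt0.
  move=> [t' d] /= [] + de s' s'ab t'd t'ab; rewrite /ball /= => tt'.
  apply: Qe => //; first by rewrite distrC; apply: (lt_trans tt'); lra.
  have -> : s' - t = (t' - t) - (t' - s') by ring.
  by rewrite (le_lt_trans (ler_normB _ _))// [`|t' - t|]distrC; lra.
exists (d / 2); first by rewrite divr_gt0.
move=> s s' sab s'ab ss'.
have d2 : 0 < d / 2 by rewrite divr_gt0.
apply: (dP (d / 2)) => //=.
by rewrite /ball_ /= sub0r normrN gtr0_norm //; lra.
Qed.

(** For a concave sequence vanishing at 0 the slopes [f i / i] do not increase; [step] is this for
    neighbours, cleared of denominators. *)
Lemma concave_seq (f : nat -> R) (n : nat) : f 0%N = 0 ->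
  (forall i, (0 < i < n)%N -> f i.-1 + f i.+1 <= f i *+ 2) ->
  forall i, (i <= n)%N -> i%:R * f n <= n%:R * f i.
Proof.
move=> f0 fc.
have step i : (i < n)%N -> i%:R * f i.+1 <= i.+1%:R * f i.
  elim: i => [_|i IH lin]; first by rewrite f0 mul0r mulr0.
  have := IH (ltnW lin); have := fc i.+1; rewrite /= lin => /(_ isT).
  rewrite mulr2n -!natr1 => h1 h2.
  have i0 : 0 <= i%:R :> R by [].
  by nra.
elim: n fc step => [_ _ [|]//|n IH fc step i].
rewrite leq_eqVlt => /orP[/eqP->//|lin].
have h : i%:R * f n <= n%:R * f i.
  apply: IH => // [j /andP[j0 jn]|j jn]; first by apply: fc; rewrite j0 ltnW.
  by apply: step; exact: ltnW.
have [n0|n0] := posnP n.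
  by move: lin; rewrite n0 ltnS leqn0 => /eqP->; rewrite f0 mul0r mulr0.
have := step n (leqnn _); have n0' : 0 < n%:R :> R by rewrite ltr0n.
move=> h2; rewrite -(ler_pM2l n0').
have i0 : 0 <= i%:R :> R by [].
rewrite mulrCA; apply: (le_trans (ler_wpM2l i0 h2)).
rewrite mulrCA [leRHS]mulrCA; apply: ler_wpM2l => //.
Qed.

End Intervals.

Section Curves.
Context {R : realType} {X : metricType R}.

(** Retraction of the line onto [0, 1]; precomposing with it extends a curve on [0, 1] to a
    continuous curve on the whole line. *)
Definition clamp (t : R) : R := Num.min 1 (Num.max 0 t).

Lemma clamp_itv t : 0 <= clamp t <= 1.
Proof. by rewrite /clamp le_min ler01 le_max lexx/= ge_min lexx. Qed.

Lemma clampE t : 0 <= t <= 1 -> clamp t = t.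
Proof. by case/andP=> t0 t1; rewrite /clamp (max_idPr t0) (min_idPr t1). Qed.

Lemma clamp_dist s t : `|clamp s - clamp t| <= `|s - t|.
Proof.
rewrite /clamp !minElt !maxElt !fun_if.
case: (ltP 0 s) => s0; case: (ltP 0 t) => t0;
  case: (ltP 1 s) => s1; case: (ltP 1 t) => t1;
  rewrite ?ltr10 ler_norml;
  have := ler_norm (s - t); have := ler_norm (t - s); rewrite (distrC t);
  move=> h1 h2; apply/andP; split; lra.
Qed.

Lemma continuousP_dist (g : R -> X) : continuous g <->
  forall t e, 0 < e -> exists2 d, 0 < d &
    forall s, `|s - t| < d -> mdist (g t) (g s) < e.
Proof.
split=> [cg t e e0|cg t].
  have /= := @metricType_numDomainType.cvgr_dist_lt R X R (nbhs t) _ g (g t) (cg t) e e0.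
  case=> d /= d0 dg; exists d => // s st; apply: dg => /=.
  by rewrite distrC.
apply/(@metricType_numDomainType.cvgrPdist_lt R X) => e e0; have [d d0 dg] := cg t e e0.
by exists d => // s /= ts; apply: dg; rewrite distrC.
Qed.

Lemma continuous_within_clamp (g : R -> X) :
  (forall t, 0 <= t <= 1 -> forall e, 0 < e -> exists2 d, 0 < d &
    forall s, 0 <= s <= 1 -> `|s - t| < d -> mdist (g t) (g s) < e) ->
  continuous (g \o clamp).
Proof.
move=> cg; apply/continuousP_dist => t e e0 /=.
have [d d0 dg] := cg (clamp t) (clamp_itv t) e e0.
exists d => // s st; apply: dg; first exact: clamp_itv.
exact: le_lt_trans (clamp_dist s t) st.
Qed.

Lemma continuous_glue (f g : R -> X) c : continuous f -> continuous g ->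
  f c = g c -> continuous (fun t => if t <= c then f t else g t).
Proof.
move=> /continuousP_dist cf /continuousP_dist cg fg.
apply/continuousP_dist => t e e0.
have [d d0 df] := cf t e e0; have [d' d'0 dg] := cg t e e0.
have [tc|ct|tc] := ltgtP t c.
- exists (Num.min d (c - t)); first by rewrite lt_min d0 subr_gt0.
  move=> s; rewrite lt_min => /andP[sd sc].
  have -> : s <= c by move: sc; rewrite ltr_norml => /andP[]; lra.
  exact: df.
- exists (Num.min d' (t - c)); first by rewrite lt_min d'0 subr_gt0.
  move=> s; rewrite lt_min => /andP[sd sc].
  have -> : s <= c = false.
    by apply/negbTE; rewrite -ltNge; move: sc; rewrite ltr_norml => /andP[]; lra.
  exact: dg.
- exists (Num.min d d'); first by rewrite lt_min d0.
  move=> s; rewrite lt_min => /andP[sd sd'].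
  case: ifP => _; first exact: df.
  by rewrite tc fg -tc; apply: dg.
Qed.

Definition affine (a b t : R) : R := a + t * (b - a).

Lemma affine_continuous a b : continuous (affine a b).
Proof.
move=> t; apply: cvgD; first exact: cvg_cst.
by apply: cvgM; [exact: cvg_id|exact: cvg_cst].
Qed.

Lemma comp_affine_continuous (g : R -> X) a b : continuous g ->
  continuous (g \o affine a b).
Proof.
by move=> cg t; apply: continuous_comp; [exact: affine_continuous|exact: cg].
Qed.

Lemma affine_itv a b t : a <= b -> 0 <= t <= 1 -> a <= affine a b t <= b.
Proof. by move=> ab /andP[t0 t1]; rewrite /affine; apply/andP; split; nra. Qed.

Lemma affine_le a b s t : a <= b -> s <= t -> affine a b s <= affine a b t.
Proof. by move=> ab st; rewrite /affine; nra. Qed.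

Lemma affine0 a b : affine a b 0 = a.
Proof. by rewrite /affine mul0r addr0. Qed.

Lemma affine1 a b : affine a b 1 = b.
Proof. by rewrite /affine; ring. Qed.

End Curves.

(** * Ultrafilter limits in compact sets, in place of subsequences *)

Section Ultrafilters.

Lemma fmap_ultra (T U : Type) (f : T -> U) (F : set_system T) :
  UltraFilter F -> UltraFilter (f @ F).
Proof.
move=> FU; split=> [|G GF fFG]; first exact: fmap_proper_filter.
apply/seteqP; split => A; last exact: fFG.
move=> GA; have [//|FnA] := in_ultra_setVsetC (f @^-1` A) FU.
have GnA : G (~` A) by apply: fFG.
by have [x []] := filter_ex (filterI GA GnA).
Qed.

Lemma ultra_cvg (T : Type) (X : topologicalType) (K : set X) (F : set_system T)
    (f : T -> X) : UltraFilter F -> compact K -> (\forall i \near F, K (f i)) ->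
  exists2 p, K p & f @ F --> p.
Proof.
move=> FU; rewrite compact_ultra => cK FK.
by have [p [Kp fp]] := cK _ (fmap_ultra f FU) FK; exists p.
Qed.

Lemma near_forall_lt (T : Type) (F : set_system T) (n : nat)
    (P : nat -> T -> Prop) : Filter F ->
  (forall i, (i < n)%N -> \forall x \near F, P i x) ->
  \forall x \near F, forall i, (i < n)%N -> P i x.
Proof.
move=> FF; elim: n => [|n IH] h; first by apply: filterS filterT.
have h1 := IH (fun i ni => h i (ltnW ni)).
apply: filterS2 h1 (h n (ltnSn n)) => x h1 h2 i.
by rewrite ltnS leq_eqVlt => /orP[/eqP->//|]; exact: h1.
Qed.

Lemma cvg_le (R : realType) (T : Type) (F : set_system T) (f g : T -> R) l l' :
  ProperFilter F -> f @ F --> l -> g @ F --> l' ->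
  (\forall x \near F, f x <= g x) -> l <= l'.
Proof.
move=> FP fl gl fg; rewrite leNgt; apply/negP => ll'.
have f1 := cvgr_gt _ fl ((l + l') / 2); have g1 := cvgr_lt _ gl ((l + l') / 2).
have {}f1 : \forall x \near F, (l + l') / 2 < f x by apply: f1; lra.
have {}g1 : \forall x \near F, g x < (l + l') / 2 by apply: g1; lra.
have [x [[h1 h2] h3]] := filter_ex (filterI (filterI f1 g1) fg); lra.
Qed.

Lemma ultra_seq : exists2 F : set_system nat, UltraFilter F & \oo `<=` F.
Proof. by have [F [FU sF]] := @ultraFilterLemma nat \oo _; exists F. Qed.

End Ultrafilters.

(** * Maximizers in good neighbourhoods *)

Section Definitions.
Context {R : realType} {X : metricType R}.
Implicit Types (L : causal_data X) (V : set X) (g h : R -> X) (k m : R).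

(* [fine] sends [+oo] to [0]: [tf] is meaningful only where [tau] is finite. *)
Definition tf L (p q : X) : R := fine (tau L p q).

Definition causally_convex L V := forall p q z, V p -> V q ->
  caus L p z -> caus L z q -> V z.

(* The maximizers parametrized by tau-length; what [g] does outside [[0, 1]] is
   irrelevant, but it is convenient to have it continuous everywhere. *)
Definition tmax L k g : Prop := [/\ continuous g, 0 < k &
  forall s t, 0 <= s -> s <= t -> t <= 1 ->
    tau L (g s) (g t) = (k * (t - s))%:E].

Definition geo L k g : Prop := [/\ continuous g, 0 < k &
  exists2 d, 0 < d & forall s t, 0 <= s -> s <= t -> t <= 1 -> t - s < d ->
    tau L (g s) (g t) = (k * (t - s))%:E].

Definition chron_eq L (p q : X) := chron L p q \/ p = q.

(** Kept apart from [good] because concavity is at first known only for curves of class [ltl]. That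
    every [tmax] curve with ends in [V] is of this class is shown from [pregood], and only then does
    [good] follow. *)
Record pregood L V : Prop := {
  good_open : open V;
  good_conv : causally_convex L V;
  good_fin : forall p q, V p -> V q -> tau L p q \is a fin_num;
  good_cont : forall p q, V p -> V q -> forall e, 0 < e -> exists2 d, 0 < d &
    forall p' q', mdist p p' < d -> mdist q q' < d ->
      `|tf L p q - tf L p' q'| < e;
  good_ex : forall p q, V p -> V q -> chron L p q ->
    exists k g, [/\ tmax L k g, g 0 = p & g 1 = q]
}.

Definition concave_pair L (g h : R -> X) : Prop := forall t, 0 <= t <= 1 ->
  t * tf L (g 1) (h 1) + (1 - t) * tf L (g 0) (h 0) <= tf L (g t) (h t).

Record good L V : Prop := {
  good_pre :> pregood L V;
  good_quad : forall k m g h, tmax L k g -> tmax L m h ->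
    V (g 0) -> V (g 1) -> V (h 0) -> V (h 1) ->
    chron_eq L (g 0) (h 0) -> chron_eq L (g 1) (h 1) -> concave_pair L g h
}.

(** The list is invariant under reversal of time, so that every statement about common starting
    points yields one about common end points. Closedness is asked for arbitrary filters since both
    one-sided limits and ultrafilter limits are used. *)
Record causal_spacetime L : Prop := {
  cst_refl : forall p, caus L p p;
  cst_trans : forall q p r, caus L p q -> caus L q r -> caus L p r;
  cst_chca : forall p q, chron L p q -> caus L p q;
  cst_ge0 : forall p q, (0 <= tau L p q)%E;
  cst_tri : forall p q r, caus L p q -> caus L q r ->
    (tau L p q + tau L q r <= tau L p r)%E;
  cst_gt0 : forall p q, (0 < tau L p q)%E <-> chron L p q;
  cst_irr : forall p, ~ chron L p p;
  cst_open : forall p q, chron L p q -> exists2 e, 0 < e &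
    forall p' q', mdist p p' < e -> mdist q q' < e -> chron L p' q';
  cst_closed : forall (T : Type) (F : set_system T) (f g : T -> X) p q,
    ProperFilter F -> f @ F --> p -> g @ F --> q ->
    (\forall i \near F, caus L (f i) (g i)) -> caus L p q;
  cst_anti : forall p q, caus L p q -> caus L q p -> p = q;
  cst_past : forall p, exists q, chron L q p;
  cst_future : forall p, exists q, chron L p q;
  cst_diamond : forall p q, compact (causal_diamond L p q)
}.

Record concave_spacetime L : Prop := {
  cst_causal :> causal_spacetime L;
  cst_good : forall p e, 0 < e -> exists V,
    [/\ good L V, V p & forall q, V q -> mdist p q < e]
}.

End Definitions.

Section Basics.
Context {R : realType} {X : metricType R} {L : causal_data X}.
Hypothesis H : causal_spacetime L.
Implicit Types (V : set X) (g h : R -> X) (k m : R).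

Local Notation ch := (chron L).
Local Notation ca := (caus L).
Local Notation T := (tf L).

Lemma ch_ca p q : ch p q -> ca p q.
Proof. exact: (cst_chca H). Qed.

Lemma ca_refl p : ca p p.
Proof. exact: (cst_refl H). Qed.

Lemma ca_trans q p r : ca p q -> ca q r -> ca p r.
Proof. exact: (cst_trans H). Qed.

Lemma tauP p q : (0 < tau L p q)%E <-> ch p q.
Proof. exact: (cst_gt0 H). Qed.

Lemma tau_nneg p q : (0 <= tau L p q)%E.
Proof. exact: (cst_ge0 H). Qed.

Lemma tau_tri p q r : ca p q -> ca q r -> (tau L p q + tau L q r <= tau L p r)%E.
Proof. exact: (cst_tri H). Qed.

Lemma ch_ca_trans q p r : ch p q -> ca q r -> ch p r.
Proof.
move=> pq qr; apply/tauP; apply: (lt_le_trans (proj2 (tauP p q) pq)).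
by apply: le_trans (tau_tri (ch_ca pq) qr); apply: leeDl; exact: tau_nneg.
Qed.

Lemma ca_ch_trans q p r : ca p q -> ch q r -> ch p r.
Proof.
move=> pq qr; apply/tauP; apply: lt_le_trans (tau_tri pq (ch_ca qr)).
by apply: (lt_le_trans (proj2 (tauP q r) qr)); apply: leeDr; exact: tau_nneg.
Qed.

Lemma ch_trans q p r : ch p q -> ch q r -> ch p r.
Proof. by move=> pq /ch_ca; apply: ch_ca_trans. Qed.

Lemma ch_irr p : ~ ch p p.
Proof. exact: (cst_irr H). Qed.

Lemma tauxx p : tau L p p = 0%E.
Proof.
apply/eqP; rewrite eq_le tau_nneg andbT leNgt; apply/negP => /tauP.
exact: ch_irr.
Qed.

Section InGood.
Variable V : set X.
Hypothesis gV : pregood L V.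

Lemma tfE p q : V p -> V q -> tau L p q = (T p q)%:E.
Proof. by move=> Vp Vq; rewrite /tf fineK //; apply: good_fin gV _ _ _ _. Qed.

Lemma tf_gt0 p q : V p -> V q -> (0 < T p q) <-> ch p q.
Proof. by move=> Vp Vq; rewrite -lte_fin -tfE //; exact: tauP. Qed.

Lemma tf_ge0 p q : 0 <= T p q.
Proof. by rewrite /tf; apply: fine_ge0; exact: tau_nneg. Qed.

Lemma tfxx p : T p p = 0.
Proof. by rewrite /tf tauxx. Qed.

Lemma tf_tri p q r : V p -> V q -> V r -> ca p q -> ca q r ->
  T p q + T q r <= T p r.
Proof. by move=> ? ? ? /tau_tri h /h; rewrite !tfE // -EFinD lee_fin. Qed.

Lemma good_nbhs p : V p -> exists2 e, 0 < e & forall q, mdist p q < e -> V q.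
Proof.
move=> Vp; have := open_nbhs_nbhs (conj (good_open gV) Vp).
move=> /metricType_numDomainType.nbhs_mdistP[e /= e0 eV]; by exists e.
Qed.

Lemma tf_cvg (I : Type) (F : set_system I) {FF : Filter F} (f g : I -> X) p q :
  V p -> V q -> f @ F --> p -> g @ F --> q ->
  (fun i => T (f i) (g i)) @ F --> T p q.
Proof.
move=> Vp Vq fp gq; apply/cvgrPdist_lt => e e0.
have [d d0 dT] := good_cont gV Vp Vq e0.
move/metricType_numDomainType.cvgrPdist_lt : fp => /(_ d d0) fp.
move/metricType_numDomainType.cvgrPdist_lt : gq => /(_ d d0) gq.
by near=> i; apply: dT; near: i.
Unshelve. all: by end_near. Qed.

End InGood.

Lemma tmaxE k g s t : tmax L k g -> 0 <= s -> s <= t -> t <= 1 ->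
  T (g s) (g t) = k * (t - s).
Proof. by case=> _ _ gE s0 st t1; rewrite /tf gE. Qed.

Lemma tmax_ch k g s t : tmax L k g -> 0 <= s -> s < t -> t <= 1 ->
  ch (g s) (g t).
Proof.
case=> _ k0 gE s0 st t1; apply/tauP; rewrite gE ?(ltW st)// lte_fin.
by rewrite mulr_gt0 // subr_gt0.
Qed.

Lemma tmax_ca k g s t : tmax L k g -> 0 <= s -> s <= t -> t <= 1 ->
  ca (g s) (g t).
Proof.
move=> gm s0; rewrite le_eqVlt => /orP[/eqP-> _|st t1]; first exact: ca_refl.
by apply: ch_ca; apply: (tmax_ch gm).
Qed.

Lemma tmax_in V k g t : pregood L V -> tmax L k g -> V (g 0) -> V (g 1) ->
  0 <= t <= 1 -> V (g t).
Proof.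
move=> gV gm V0 V1 /andP[t0 t1]; apply: (good_conv gV V0 V1).
  exact: (tmax_ca gm).
exact: (tmax_ca gm).
Qed.

Lemma tmax_sub k g a b : tmax L k g -> 0 <= a -> a < b -> b <= 1 ->
  tmax L (k * (b - a)) (g \o affine a b).
Proof.
move=> [cg k0 gE] a0 ab b1; split.
- exact: comp_affine_continuous.
- by rewrite mulr_gt0 // subr_gt0.
- move=> s t s0 st t1 /=; rewrite gE; first by congr EFin; rewrite /affine; ring.
  + by rewrite /affine; nra.
  + by apply: affine_le => //; exact: ltW.
  + by rewrite /affine; nra.
Qed.

Lemma ca_left g h a c : continuous g -> continuous h -> a < c ->
  (forall s, a < s -> s < c -> ca (g s) (h s)) -> ca (g c) (h c).
Proof.
move=> cg ch_ ac gh.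
apply: (@cst_closed _ _ _ H R (c^'-) g h) => //.
- exact/cvg_at_left_filter/cg.
- exact/cvg_at_left_filter/ch_.
- near=> s; apply: gh; near: s; first exact: nbhs_left_gt.
  exact: nbhs_left_lt.
Unshelve. all: by end_near. Qed.

Lemma ca_right g h a c : continuous g -> continuous h -> c < a ->
  (forall s, c < s -> s < a -> ca (g s) (h s)) -> ca (g c) (h c).
Proof.
move=> cg ch_ ac gh.
apply: (@cst_closed _ _ _ H R (c^'+) g h) => //.
- exact/cvg_at_right_filter/cg.
- exact/cvg_at_right_filter/ch_.
- near=> s; apply: gh; near: s; first exact: nbhs_right_gt.
  exact: nbhs_right_lt.
Unshelve. all: by end_near. Qed.

Lemma continuous_scale g (t : R) :
  continuous g -> continuous (fun s : R => g (s * t)).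
Proof.
move=> cg s; apply: (@continuous_comp _ _ _ (fun s : R => s * t) g); last exact: cg.
by apply: cvgM; [exact: cvg_id|exact: cvg_cst].
Qed.

(** Shortening [g] to [0, s] with [s < 1] makes the final points strictly related, [g s << h 1].
    Concavity then bounds tau between [g (s * t)] and [h t] below by a positive multiple of that
    value, and [s] tends to 1. Concavity is an explicit hypothesis so that the lemma also serves
    where only [pregood] is available. *)
Lemma tmax_le_of_concave V k m g h : pregood L V -> tmax L k g -> tmax L m h ->
  V (g 0) -> V (g 1) -> g 0 = h 0 -> g 1 = h 1 ->
  (forall s, 0 < s < 1 -> concave_pair L (g \o affine 0 s) h) ->
  forall t, 0 <= t <= 1 -> ca (g t) (h t).
Proof.
move=> gV gm hm V0 V1 e0 e1 hquad t /andP[t0 t1].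
have [->|t_gt0] := eqVneq t 0; first by rewrite e0; apply: ca_refl.
have {}t_gt0 : 0 < t by rewrite lt_def t_gt0.
have [cg _ _] := gm; have [ch_ _ _] := hm.
have key := @ca_left (fun s => g (s * t)) (fun=> h t) 0 1.
rewrite /= mul1r in key; apply: key.
- exact: continuous_scale.
- by move=> ?; exact: cvg_cst.
- by [].
move=> s s0 s1; apply: ch_ca.
have Vs : V (g s) by apply: (tmax_in gV gm) => //; rewrite !ltW.
have gs := tmax_sub gm (lexx 0) s0 (ltW s1).
have cs1 : ch (g s) (h 1) by rewrite -e1; apply: (tmax_ch gm); rewrite // ltW.
have hq : t * T (g s) (h 1) <= T (g (t * s)) (h t).
  have s01 : 0 < s < 1 by rewrite s0.
  have := hquad s s01 t; rewrite t0 t1 /= affine0 affine1 e0 => /(_ isT).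
  by rewrite tfxx mulr0 addr0 /affine add0r subr0.
have hs : 0 < T (g s) (h 1) by apply/(tf_gt0 gV) => //; rewrite -e1.
apply/(tf_gt0 gV).
- by apply: (tmax_in gV gm) => //; apply/andP; split; nra.
- by apply: (tmax_in gV hm); rewrite -?e0 -?e1 ?t0.
- by rewrite [s * t]mulrC; apply: lt_le_trans hq; rewrite mulr_gt0.
Qed.

Lemma tmax_le V k m g h : good L V -> tmax L k g -> tmax L m h ->
  V (g 0) -> V (g 1) -> g 0 = h 0 -> g 1 = h 1 ->
  forall t, 0 <= t <= 1 -> ca (g t) (h t).
Proof.
move=> gV gm hm V0 V1 e0 e1; apply: (tmax_le_of_concave gV gm hm) => // s /andP[s0 s1].
have gs := tmax_sub gm (lexx 0) s0 (ltW s1).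
have Vs : V (g s) by apply: (tmax_in gV gm) => //; rewrite !ltW.
apply: (good_quad gV gs hm); rewrite /= ?affine0 ?affine1 -?e0 -?e1 //.
  by right.
by left; apply: (tmax_ch gm); rewrite // ltW.
Qed.

Lemma tmax_uniq V k m g h : good L V -> tmax L k g -> tmax L m h ->
  V (g 0) -> V (g 1) -> g 0 = h 0 -> g 1 = h 1 ->
  forall t, 0 <= t <= 1 -> g t = h t.
Proof.
move=> gV gm hm V0 V1 e0 e1 t t01; apply: (cst_anti H).
  by apply: (tmax_le gV gm hm).
by apply: (tmax_le gV hm gm); rewrite -?e0 -?e1.
Qed.

End Basics.

Section Concatenation.
Context {R : realType} {X : metricType R} {L : causal_data X}.
Hypothesis H : causal_spacetime L.
Implicit Types (V : set X) (g h : R -> X) (k m : R).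

Local Notation ch := (chron L).
Local Notation ca := (caus L).
Local Notation T := (tf L).

Lemma tmax_len k g : tmax L k g -> T (g 0) (g 1) = k.
Proof. by move=> gm; rewrite (tmaxE gm) ?subr0 ?mulr1. Qed.

(** Equality in the reverse triangle inequality at the common point makes the concatenation
    maximizing; the break parameter [c] is the one giving both pieces the same speed. *)
Lemma tmax_glue V k m g h (c := k / (k + m)) : pregood L V -> tmax L k g -> tmax L m h ->
  V (g 0) -> V (h 1) -> g 1 = h 0 -> T (g 0) (h 1) = k + m ->
  tmax L (k + m) (fun t => if t <= c then g (t / c) else h ((t - c) / (1 - c))).
Proof.
move=> gV gm hm V0 V1 e ekm.
have [cg k0 _] := gm; have [ch_ m0 _] := hm.
have km0 : 0 < k + m by rewrite addr_gt0.
have c0 : 0 < c by rewrite divr_gt0.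
have c1 : c < 1 by rewrite ltr_pdivrMr // mul1r ltrDl.
have c1' : 0 < 1 - c by rewrite subr_gt0.
have kE : k = c * (k + m) by rewrite /c; field; rewrite gt_eqF.
have mE : m = (1 - c) * (k + m) by rewrite mulrBl mul1r -kE addrC addKr.
have Vz : V (g 1).
  apply: (good_conv gV V0 V1); first by apply: (tmax_ca H gm).
  by rewrite e; apply: (tmax_ca H hm).
have Vg t : 0 <= t <= 1 -> V (g t) by move=> t01; apply: (tmax_in H gV gm).
have Vh t : 0 <= t <= 1 -> V (h t).
  by move=> t01; apply: (tmax_in H gV hm); rewrite -?e.
pose f t := if t <= c then g (t / c) else h ((t - c) / (1 - c)).
have dl t : 0 <= t -> t <= c -> 0 <= t / c <= 1.
  by move=> t0 tc; rewrite ler_pdivrMr // mul1r tc divr_ge0 // ltW.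
have dr t : c <= t -> t <= 1 -> 0 <= (t - c) / (1 - c) <= 1.
  move=> ct t1; rewrite ler_pdivrMr // mul1r lerD2r t1 andbT divr_ge0 //.
    by rewrite subr_ge0.
  exact: ltW.
split=> //.
  apply: continuous_glue => [||/=].
  - by move=> t; apply: (@continuous_comp _ _ _ (fun t : R => t / c) g);
      [apply: cvgM; [exact: cvg_id|exact: cvg_cst]|exact: cg].
  - move=> t; apply: (@continuous_comp _ _ _ (fun t : R => (t - c) / (1 - c)) h).
      apply: cvgM; last exact: cvg_cst.
      by apply: cvgB; [exact: cvg_id|exact: cvg_cst].
    exact: ch_.
  - by rewrite divff ?gt_eqF // subrr mul0r.
move=> s t s0 st t1.
have le_l u v : 0 <= u -> u <= v -> v <= c ->
    T (g (u / c)) (g (v / c)) = (k + m) * (v - u).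
  move=> u0 uv vc; have /andP[] := dl _ u0 (le_trans uv vc).
  have /andP[_ v1] := dl _ (le_trans u0 uv) vc => u0' u1.
  rewrite (tmaxE gm) //; last by rewrite ler_pM2r ?invr_gt0.
  by rewrite {1}kE; field; rewrite gt_eqF.
have le_r u v : c <= u -> u <= v -> v <= 1 ->
    T (h ((u - c) / (1 - c))) (h ((v - c) / (1 - c))) = (k + m) * (v - u).
  move=> u0 uv vc; have /andP[] := dr _ u0 (le_trans uv vc).
  have /andP[_ v1] := dr _ (le_trans u0 uv) vc => u0' u1.
  rewrite (tmaxE hm) //; last by rewrite ler_pM2r ?invr_gt0 // lerD2r.
  by rewrite {1}mE; field; rewrite gt_eqF.
have ca_l u v : 0 <= u -> u <= v -> v <= c -> ca (g (u / c)) (g (v / c)).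
  move=> u0 uv vc; have /andP[] := dl _ u0 (le_trans uv vc).
  have /andP[_ v1] := dl _ (le_trans u0 uv) vc => u0' u1.
  by apply: (tmax_ca H gm) => //; rewrite ler_pM2r ?invr_gt0.
have ca_r u v : c <= u -> u <= v -> v <= 1 ->
    ca (h ((u - c) / (1 - c))) (h ((v - c) / (1 - c))).
  move=> u0 uv vc; have /andP[] := dr _ u0 (le_trans uv vc).
  have /andP[_ v1] := dr _ (le_trans u0 uv) vc => u0' u1.
  by apply: (tmax_ca H hm) => //; rewrite ler_pM2r ?invr_gt0 // lerD2r.
have hc : h ((c - c) / (1 - c)) = g 1 by rewrite subrr mul0r e.
have gc : g (c / c) = g 1 by rewrite divff // gt_eqF.
have gc0 : g (0 / c) = g 0 by rewrite mul0r.
have hc1 : h ((1 - c) / (1 - c)) = h 1 by rewrite divff // gt_eqF.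
rewrite /f; case: (leP s c) => sc; case: (leP t c) => tc.
- by rewrite (tfE gV) ?le_l //; apply/Vg/dl => //; apply: le_trans st.
- have Vs : V (g (s / c)) by apply/Vg/dl.
  have Vt : V (h ((t - c) / (1 - c))) by apply/Vh/dr => //; exact: ltW.
  (* For parameters on both sides of the break, a larger value would push the total from [g 0] to
     [h 1] above [k + m], and a smaller one would violate the triangle inequality through the
     break. *)
  rewrite (tfE gV) //; congr EFin; apply/eqP; rewrite eq_le; apply/andP; split.
    have h1 := le_l 0 s (lexx 0) s0 sc; rewrite gc0 in h1.
    have h2 := le_r t 1 (ltW tc) t1 (lexx 1); rewrite hc1 in h2.
    have c1_ := ca_l 0 s (lexx 0) s0 sc; rewrite gc0 in c1_.
    have c2 := ca_r t 1 (ltW tc) t1 (lexx 1); rewrite hc1 in c2.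
    have c3 : ca (g (s / c)) (h ((t - c) / (1 - c))).
      apply: (ca_trans H (q := g 1)); first by rewrite -gc; apply: ca_l.
      by rewrite -hc; apply: ca_r => //; exact: ltW.
    have := tf_tri H gV V0 Vs V1 c1_ (ca_trans H c3 c2).
    have := tf_tri H gV Vs Vt V1 c3 c2.
    by rewrite h1 h2 ekm => ? ?; nra.
  have h1 := le_l s c s0 sc (lexx c); rewrite gc in h1.
  have h2 := le_r c t (lexx c) (ltW tc) t1; rewrite hc in h2.
  have c1_ := ca_l s c s0 sc (lexx c); rewrite gc in c1_.
  have c2 := ca_r c t (lexx c) (ltW tc) t1; rewrite hc in c2.
  have := tf_tri H gV Vs Vz Vt c1_ c2.
  by rewrite h1 h2 => ?; nra.
- by move: (lt_le_trans sc st); rewrite ltNge tc.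
- have Vs : V (h ((s - c) / (1 - c))).
    by apply/Vh/dr; [exact: ltW|exact: le_trans t1].
  have Vt : V (h ((t - c) / (1 - c))) by apply/Vh/dr => //; exact: ltW.
  by rewrite (tfE gV) // le_r // ltW.
Qed.

Lemma tmax_concat V k m g h : pregood L V -> tmax L k g -> tmax L m h ->
  V (g 0) -> V (h 1) -> g 1 = h 0 -> T (g 0) (h 1) = k + m ->
  exists f, [/\ tmax L (k + m) f, f 0 = g 0, f 1 = h 1 &
    f (k / (k + m)) = g 1].
Proof.
move=> gV gm hm V0 V1 e ekm.
have [_ k0 _] := gm; have [_ m0 _] := hm.
have km0 : 0 < k + m by rewrite addr_gt0.
have c0 : 0 < k / (k + m) by rewrite divr_gt0.
have c1 : k / (k + m) < 1 by rewrite ltr_pdivrMr // mul1r ltrDl.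
exists (fun t => if t <= k / (k + m) then g (t / (k / (k + m)))
  else h ((t - k / (k + m)) / (1 - k / (k + m)))); split.
- exact: (tmax_glue gV gm hm).
- by rewrite ltW // mul0r.
- by rewrite leNgt c1 /= divff // gt_eqF // subr_gt0.
- by rewrite lexx divff // gt_eqF.
Qed.

End Concatenation.

Section Limits.
Context {R : realType} {X : metricType R} {L : causal_data X}.
Hypothesis H : concave_spacetime L.
Implicit Types (V : set X) (g h : R -> X) (k m : R).

Local Notation ch := (chron L).
Local Notation ca := (caus L).
Local Notation T := (tf L).

Lemma ch_near (I : Type) (F : set_system I) {FF : Filter F} (f g : I -> X) p q :
  ch p q -> f @ F --> p -> g @ F --> q -> \forall i \near F, ch (f i) (g i).
Proof.
move=> /(cst_open H)[e e0 he] fp gq.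
move/metricType_numDomainType.cvgrPdist_lt : fp => /(_ e e0) fp.
move/metricType_numDomainType.cvgrPdist_lt : gq => /(_ e e0) gq.
by near=> i; apply: he; near: i.
Unshelve. all: by end_near. Qed.

Lemma good_near (I : Type) (F : set_system I) {FF : Filter F} (f : I -> X) V p :
  good L V -> V p -> f @ F --> p -> \forall i \near F, V (f i).
Proof.
move=> gV Vp; move/(good_nbhs gV) : Vp => [e e0 he].
move/metricType_numDomainType.cvgrPdist_lt => /(_ e e0).
by apply: filterS => i; exact: he.
Qed.

(** The maximizers from [g 0] to [z] and from [z] to [g 1] concatenate to a maximizer, which by
    uniqueness is [g]. *)
Lemma tmax_through V l g z th : good L V -> tmax L l g -> V (g 0) -> V (g 1) ->
  0 < th < 1 -> ca (g 0) z -> ca z (g 1) ->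
  T (g 0) z = th * l -> T z (g 1) = (1 - th) * l -> z = g th.
Proof.
move=> gV gm V0 V1 /andP[th0 th1] c0 c1 T0 T1.
have [_ l0 _] := gm.
have Vz : V z by apply: (good_conv gV V0 V1).
have ch0 : ch (g 0) z by apply/(tf_gt0 H gV) => //; rewrite T0 mulr_gt0.
have ch1 : ch z (g 1).
  by apply/(tf_gt0 H gV) => //; rewrite T1 mulr_gt0 // subr_gt0.
have [k [g1 [m1 e10 e11]]] := good_ex gV V0 Vz ch0.
have [m [g2 [m2 e20 e21]]] := good_ex gV Vz V1 ch1.
have kE : k = th * l by rewrite -(tmax_len m1) e10 e11.
have mE : m = (1 - th) * l by rewrite -(tmax_len m2) e20 e21.
have kmE : k + m = l by rewrite kE mE; ring.
have [||||f [fm f0 f1 fz]] := tmax_concat H gV m1 m2; rewrite ?e10 ?e11 ?e20 ?e21 //.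
  by rewrite kmE (tmax_len gm).
rewrite -e11 -fz; have -> : k / (k + m) = th.
  by rewrite kmE kE mulfK // gt_eqF.
apply: (tmax_uniq H gV fm gm); rewrite ?f0 ?f1 ?e10 ?e21 //.
by rewrite !ltW.
Qed.

(** Continuity of maximizers in their end points. The points [gs i th] eventually lie in a compact
    diamond slightly larger than that of [g 0] and [g 1]; their limit turns the triangle inequality
    into an equality, hence lies on [g]. *)
Lemma tmax_cvg (I : Type) (F : set_system I) V l g (ks : I -> R)
    (gs : I -> R -> X) : UltraFilter F -> good L V -> tmax L l g ->
  V (g 0) -> V (g 1) -> (\forall i \near F, tmax L (ks i) (gs i)) ->
  (fun i => gs i 0) @ F --> g 0 -> (fun i => gs i 1) @ F --> g 1 ->
  forall th, 0 < th < 1 -> (fun i => gs i th) @ F --> g th.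
Proof.
move=> FU gV gm V0 V1 gsm gs0 gs1 th /andP[th0 th1].
have FP : ProperFilter F by exact: ultra_proper.
have [a a0] := cst_past H (g 0); have [b b1] := cst_future H (g 1).
have Fa := ch_near a0 (cvg_cst a) gs0.
have Fb := ch_near b1 gs1 (cvg_cst b).
have th01 : 0 <= th <= 1 by rewrite !ltW.
have [z _ gz] : exists2 z, causal_diamond L a b z & (fun i => gs i th) @ F --> z.
  apply: ultra_cvg; first exact: (cst_diamond H).
  near=> i; have im : tmax L (ks i) (gs i) by near: i.
  split; [apply: (ca_trans H (q := gs i 0))|apply: (ca_trans H (q := gs i 1))].
  - by apply: (ch_ca H); near: i; exact: Fa.
  - by apply: (tmax_ca H im) => //; exact: ltW.
  - by apply: (tmax_ca H im) => //; exact: ltW.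
  - by apply: (ch_ca H); near: i; exact: Fb.
suff <- : z = g th by [].
have c0 : ca (g 0) z.
  apply: (cst_closed H _ gs0 gz); near=> i.
  have im : tmax L (ks i) (gs i) by near: i.
  by apply: (tmax_ca H im) => //; exact: ltW.
have c1 : ca z (g 1).
  apply: (cst_closed H _ gz gs1); near=> i.
  have im : tmax L (ks i) (gs i) by near: i.
  by apply: (tmax_ca H im) => //; exact: ltW.
have Vz : V z by apply: (good_conv gV V0 V1).
have ksl : ks @ F --> l.
  rewrite -(tmax_len gm); apply: cvg_trans (tf_cvg gV V0 V1 gs0 gs1).
  apply: near_eq_cvg; near=> i; apply: tmax_len; near: i; exact: gsm.
apply: (tmax_through gV gm) => //; first by rewrite th0.
  apply: (@cvg_unique _ _ ((fun i => T (gs i 0) (gs i th)) @ F)) => //.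
    exact: (tf_cvg gV).
  have : (fun i => th * ks i) @ F --> th * l by apply: cvgM => //; exact: cvg_cst.
  apply: cvg_trans; apply: near_eq_cvg; near=> i.
  have im : tmax L (ks i) (gs i) by near: i.
  by rewrite (tmaxE im (lexx 0) (ltW th0) (ltW th1)) subr0 mulrC.
apply: (@cvg_unique _ _ ((fun i => T (gs i th) (gs i 1)) @ F)) => //.
  exact: (tf_cvg gV).
have : (fun i => (1 - th) * ks i) @ F --> (1 - th) * l.
  by apply: cvgM => //; exact: cvg_cst.
apply: cvg_trans; apply: near_eq_cvg; near=> i.
have im : tmax L (ks i) (gs i) by near: i.
by rewrite (tmaxE im (ltW th0) (ltW th1) (lexx 1)) mulrC.
Unshelve. all: by end_near. Qed.

End Limits.

(** * Comparison of geodesics *)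

Section Comparison.
Context {R : realType} {X : metricType R} {L : causal_data X}.
Hypothesis H : concave_spacetime L.
Implicit Types (g h : R -> X) (k m : R).

Local Notation ch := (chron L).
Local Notation ca := (caus L).
Local Notation T := (tf L).

Lemma fine_grid (d : R) (N : nat) : 0 < d ->
  exists n, [/\ (N < n)%N, (0 < n)%N & n%:R^-1 < d].
Proof.
move=> d0; pose n := (Num.bound d^-1 + N).+1.
exists n; split=> //; first by rewrite /n ltnS leq_addl.
have n0 : 0 < n%:R :> R by rewrite ltr0n.
rewrite -[d]invrK ltf_pV2 ?posrE ?invr_gt0 //.
apply: lt_le_trans (archi_boundP _) _; first by rewrite invr_ge0 ltW.
by rewrite ler_nat /n -addSn ltnW // ltnS leq_addr.
Qed.

Lemma grid_cell n (x : R) : 0 <= x <= n.+1%:R ->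
  exists2 i, (i < n.+1)%N & i%:R <= x <= i.+1%:R.
Proof.
elim: n => [|n IH] /andP[x0 xn]; first by exists 0%N; rewrite // x0.
have [xn1|/ltW xn1] := leP x n.+1%:R.
  by have [|i ni hi] := IH; [rewrite x0|exists i => //; exact: ltnW].
by exists n.+1; rewrite // xn1.
Qed.

Lemma grid_window n (t : R) : (1 < n)%N -> 0 <= t <= 1 ->
  exists2 j, (0 < j < n)%N & j.-1%:R / n%:R <= t <= j.+1%:R / n%:R.
Proof.
case: n => // -[//|n] _ /andP[t0 t1].
have n0 : 0 < n.+2%:R :> R by rewrite ltr0n.
have [|i ni /andP[ix xi]] := @grid_cell n.+1 (t * n.+2%:R).
  by rewrite mulr_ge0 // ler_piMl // ltW.
have [i0|i0] := posnP i.
  exists 1%N => //=; rewrite mul0r t0 ler_pdivlMr //.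
  by apply: (le_trans xi); rewrite i0 ler_nat.
exists i; first by rewrite i0.
rewrite ler_pdivrMr // ler_pdivlMr // xi andbT.
by apply: le_trans ix; rewrite ler_nat leq_pred.
Qed.

Lemma tmax_geo k g : tmax L k g -> geo L k g.
Proof. by move=> [cg k0 gE]; split=> //; exists 2 => // s t *; apply: gE. Qed.

(** Local equalities add up by the reverse triangle inequality, which gives a lower bound only:
    beyond its local scale a geodesic is not known to maximize. *)
Lemma geo_tau k g s t : geo L k g -> 0 <= s -> s <= t -> t <= 1 ->
  ca (g s) (g t) /\ ((k * (t - s))%:E <= tau L (g s) (g t))%E.
Proof.
move=> [cg k0 [d d0 gE]] s0 st t1.
apply: (interval_chain st (P := fun s t => ca (g s) (g t) /\
   ((k * (t - s))%:E <= tau L (g s) (g t))%E)).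
  move=> a b c sa ab bc ct [ca1 h1] [ca2 h2]; split; first exact: (ca_trans H ca1).
  apply: le_trans (tau_tri H ca1 ca2).
  have -> : k * (c - a) = k * (b - a) + k * (c - b) by ring.
  by rewrite EFinD; apply: leeD.
move=> a /andP[sa at_]; exists (d / 2); first by rewrite divr_gt0.
move=> b c sb bc ct; rewrite !ltr_norml => /andP[? ?] /andP[? ?].
have E : tau L (g b) (g c) = (k * (c - b))%:E.
  by apply: gE => //; [exact: le_trans sb|exact: le_trans t1|lra].
split; last by rewrite E.
have [->|bc'] := eqVneq b c; first exact: (ca_refl H).
apply/(ch_ca H)/(tauP H); rewrite E lte_fin mulr_gt0 // subr_gt0.
by rewrite lt_def eq_sym bc'.
Qed.

Lemma geo_ca k g s t : geo L k g -> 0 <= s -> s <= t -> t <= 1 ->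
  ca (g s) (g t).
Proof. by move=> gg s0 st t1; have [] := geo_tau gg s0 st t1. Qed.

Lemma geo_ch k g s t : geo L k g -> 0 <= s -> s < t -> t <= 1 ->
  ch (g s) (g t).
Proof.
move=> gg s0 st t1; have [_ h] := geo_tau gg s0 (ltW st) t1.
apply/(tauP H); apply: lt_le_trans h; have [_ k0 _] := gg.
by rewrite lte_fin mulr_gt0 // subr_gt0.
Qed.

Lemma geo_sub k g a b : geo L k g -> 0 <= a -> a < b -> b <= 1 ->
  geo L (k * (b - a)) (g \o affine a b).
Proof.
move=> [cg k0 [d d0 gE]] a0 ab b1; have ba : 0 < b - a by rewrite subr_gt0.
split.
- exact: comp_affine_continuous.
- by rewrite mulr_gt0.
- exists d => // s t s0 st t1 std /=.
  rewrite gE; first by congr EFin; rewrite /affine; ring.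
  + by rewrite /affine; nra.
  + by apply: affine_le => //; exact: ltW.
  + by rewrite /affine; nra.
  + by rewrite /affine; nra.
Qed.

Section DiscreteComparison.
Variables (k : R) (al be : R -> X) (n : nat) (V : nat -> set X) (s0 : R).
Local Notation u i := (i%:R / n%:R : R).
Hypotheses (n1 : (1 < n)%N) (gal : geo L k al).
Hypotheses (start : al 0 = be 0) (ends : ca (al 1) (be 1)).
Hypotheses (s00 : 0 < s0) (s01 : s0 < 1).
Hypothesis gV : forall i, (0 < i < n)%N -> good L (V i).
Hypothesis wal : forall i s, (0 < i < n)%N -> s0 <= s <= 1 ->
  [/\ exists k', tmax L k' (al \o affine (s * u i.-1) (s * u i.+1)),
      V i (al (s * u i.-1)) & V i (al (s * u i.+1))].
Hypothesis wbe : forall i, (0 < i < n)%N ->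
  [/\ exists k', tmax L k' (be \o affine (u i.-1) (u i.+1)),
      V i (be (u i.-1)) & V i (be (u i.+1))].

(** The strict relations at the grid points that concavity on each window requires. Shrinking [al]
    by [s < 1] makes them possible although only [al 1 <= be 1] is assumed. *)
Let A s := forall i, (0 < i <= n)%N -> ch (al (s * u i)) (be (u i)).

Let n0 : 0 < n%:R :> R. Proof. by rewrite ltr0n ltnW. Qed.
Let un : u n = 1. Proof. by rewrite divff // gt_eqF. Qed.

Let mid s i : (0 < i)%N ->
  affine (s * u i.-1) (s * u i.+1) (1 / 2) = s * u i.
Proof.
case: i => // i _ /=; rewrite /affine -!natr1.
by field; rewrite gt_eqF.
Qed.

Let mid1 i : (0 < i)%N -> affine (u i.-1) (u i.+1) (1 / 2) = u i.
Proof. by move=> i0; have := mid 1 i0; rewrite !mul1r. Qed.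

Let half01 : 0 <= (1 / 2 : R) <= 1. Proof. by apply/andP; split; lra. Qed.

Let Val i s : (0 < i < n)%N -> s0 <= s <= 1 -> V i (al (s * u i)).
Proof.
move=> hi hs; have [[k' h] h1 h2] := wal hi hs; have /andP[i0 _] := hi.
rewrite -(mid s i0); apply: (tmax_in H (gV hi) h) => /=.
- by rewrite affine0.
- by rewrite affine1.
- exact: half01.
Qed.

Let Vbe i : (0 < i < n)%N -> V i (be (u i)).
Proof.
move=> hi; have [[k' h] h1 h2] := wbe hi; have /andP[i0 _] := hi.
rewrite -(mid1 i0); apply: (tmax_in H (gV hi) h) => /=.
- by rewrite affine0.
- by rewrite affine1.
- exact: half01.
Qed.

(** Concavity on the window from [u i.-1] to [u i.+1], read at its midpoint, says that the values of
    tau at the grid points form a concave sequence; it vanishes at 0 because the curves share their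
    start. *)
Let conc s : s0 <= s <= 1 -> A s -> forall i, (i <= n)%N ->
  i%:R * T (al (s * u n)) (be (u n)) <= n%:R * T (al (s * u i)) (be (u i)).
Proof.
move=> hs As.
apply: (@concave_seq R (fun i => T (al (s * u i)) (be (u i))) n).
  by rewrite !mul0r mulr0 start (tfxx H).
move=> i hi; have /andP[i0 iN] := hi.
have [[k1 h1] Va Vb] := wal hi hs; have [[k2 h2] Vc Vd] := wbe hi.
have := good_quad (gV hi) h1 h2; rewrite /concave_pair /= !affine0 !affine1.
move=> /(_ Va Vb Vc Vd) hq.
have e0 : chron_eq L (al (s * u i.-1)) (be (u i.-1)).
  case: {h1 h2 hi Va Vb Vc Vd hq} i i0 iN => // -[|i] _ iN /=.
    by right; rewrite !mul0r mulr0.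
  by left; apply: As; rewrite /= ltnW // ltnW.
have e1 : chron_eq L (al (s * u i.+1)) (be (u i.+1)) by left; apply: As.
have := hq e0 e1 _ half01; rewrite (mid s i0) (mid1 i0).
by move=> h; rewrite [leRHS]mulr2n; lra.
Qed.

Let hn : (0 < n.-1 < n)%N. Proof. by case: n n1 => // -[]//= p _; rewrite ltnSn. Qed.
Let nE : n.-1.+1 = n. Proof. by case: n n1. Qed.

Let Vn s : s0 <= s <= 1 -> V n.-1 (al s).
Proof. by move=> hs; have [_ _] := wal hn hs; rewrite nE un mulr1. Qed.

Let Vb1 : V n.-1 (be 1).
Proof. by have [_ _] := wbe hn; rewrite nE un. Qed.

(* The set of [s] satisfying [A] is open, and closed because concavity keeps the
   values of [tau] at the grid points away from 0. *)
Lemma comparison_lt s : A s0 -> s0 <= s < 1 -> A s.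
Proof.
move=> A0 /andP[s0s s1].
have calc i : continuous (fun v : R => al (v * u i)).
  by apply: continuous_scale; case: gal.
have endc v : 0 <= v < 1 -> ch (al v) (be 1).
  move=> /andP[v0 v1]; apply: (ch_ca_trans H (q := al 1)) => //.
  exact: (geo_ch gal).
apply: (interval_chain s0s (P := fun v w => A v -> A w)) => //.
  by move=> v w x _ _ _ _ h1 h2 /h1/h2.
move=> t /andP[s0t ts].
have t01 : s0 <= t <= 1 by rewrite s0t (le_trans ts) // ltW.
have [At|nAt] := pselect (A t).
  have : \forall v \near t, forall i, (i < n.+1)%N -> (0 < i)%N ->
      ch (al (v * u i)) (be (u i)).
    apply: (@near_forall_lt _ (nbhs t) n.+1
      (fun i v => (0 < i)%N -> ch (al (v * u i)) (be (u i)))) => i iN.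
    have [i0|i0] := posnP i; first by apply: nearW => v; rewrite i0.
    have chi : ch (al (t * u i)) (be (u i)) by apply: At; rewrite i0.
    have h : \forall v \near t, ch (al (v * u i)) (be (u i)).
      by apply: (ch_near H chi (calc i t)); exact: cvg_cst.
    by apply: filterS h.
  case=> e /= e0 he; exists e => // v w _ _ _ _ wt _ i /andP[i0 iN].
  by have := he w; rewrite /ball_ /= distrC => /(_ wt i iN i0).
have [i hi nch] : exists2 i, (0 < i <= n)%N & ~ ch (al (t * u i)) (be (u i)).
  by move/existsNP : nAt => [i] /not_implyP[hi h]; exists i.
have iN : (0 < i < n)%N.
  have /andP[i0] := hi; rewrite leq_eqVlt i0 => /orP[/eqP iE|//].
  exfalso; apply: nch; rewrite iE un mulr1; apply: endc.
  by rewrite (le_trans (ltW s00) s0t) (le_lt_trans ts).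
have s01' : s0 <= s <= 1 by rewrite s0s ltW.
pose kap := T (al s) (be 1).
have kap0 : 0 < kap.
  apply/(tf_gt0 H (gV hn)); [exact: Vn|exact: Vb1|].
  by apply: endc; rewrite s1 (le_trans (ltW s00)).
have ft0 : T (al (t * u i)) (be (u i)) = 0.
  apply/eqP; rewrite eq_le (tf_ge0 H) // andbT leNgt; apply/negP.
  by move=> /(tf_gt0 H (gV iN) (Val iN t01) (Vbe iN)).
have : (fun v : R => T (al (v * u i)) (be (u i))) @ t --> (0 : R).
  rewrite -ft0; apply: (tf_cvg (gV iN) (Val iN t01) (Vbe iN) (calc i t)).
  exact: cvg_cst.
(* Near [t] the value at grid point [i] falls below [kap / n]. If [A v] held there, [conc] would
   bound it below by [i / n] times tau from [al v] to [be 1], hence by [kap / n]. So [A] fails near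
   [t] and the implication is vacuous. *)
move=> /cvgrPdist_lt/(_ (kap / n%:R)).
rewrite divr_gt0 // => /(_ isT) [e /= e0 he].
exists e => // v w s0v vw ws vt wt Av; exfalso.
have v01 : s0 <= v <= 1 by rewrite s0v (le_trans vw) // (le_trans ws) // ltW.
have := he v; rewrite /ball_ /= distrC => /(_ vt).
rewrite sub0r normrN ger0_norm ?(tf_ge0 H) // ltr_pdivlMr // => lt1.
have := conc v01 Av (ltnW (proj2 (andP iN))).
rewrite un mulr1 => le1.
have le2 : kap <= T (al v) (be 1).
  have vs : v <= s by exact: le_trans ws.
  have cvs : ca (al v) (al s).
    apply: (geo_ca gal) => //; first exact: le_trans (ltW s00) s0v.
    exact: ltW.
  have csb : ca (al s) (be 1).
    by apply/(ch_ca H)/endc; rewrite s1 (le_trans (ltW s00)).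
  have := tf_tri H (gV hn) (Vn v01) (Vn s01') Vb1 cvs csb.
  by apply: le_trans; rewrite lerDr (tf_ge0 H).
have i1 : 1 <= i%:R :> R by rewrite ler1n; case/andP: iN.
have : T (al v) (be 1) <= i%:R * T (al v) (be 1).
  by rewrite ler_peMl // (tf_ge0 H).
by rewrite mulrC in lt1; lra.
Qed.

(** An arbitrary [t] sits at relative position [th] in a window of width [2 / n], where concavity
    interpolates between the bounds of [conc] at its two ends. This is done for [s < 1], and [s]
    then tends to 1. *)
Lemma comparison_all t : A s0 -> 0 <= t <= 1 ->
  ca (al t) (be t) /\ t * T (al 1) (be 1) <= T (al t) (be t).
Proof.
move=> A0 t01; have [j hj /andP[jt tj]] := grid_window n1 t01.
have /andP[j0 jn] := hj.
have n0' := n0.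
have [[k2 h2] Vc Vd] := wbe hj.
pose th := (t - u j.-1) * n%:R / 2.
have jE : j.-1%:R = j%:R - 1 :> R by rewrite -{2}(prednK j0) -natr1 addrK.
have j1E : j.+1%:R = j%:R + 1 :> R by rewrite natr1.
have thE s : affine (s * u j.-1) (s * u j.+1) th = s * t.
  by rewrite /affine /th jE j1E; field; rewrite gt_eqF.
have th01 : 0 <= th <= 1.
  have : t * n%:R <= j.+1%:R by rewrite -ler_pdivlMr.
  have : j.-1%:R <= t * n%:R by rewrite -ler_pdivrMr.
  rewrite /th mulrBl divfK ?gt_eqF // jE j1E => ? ?.
  by apply/andP; split; lra.
have Vt : V j (be t).
  rewrite -[t]mul1r -thE !mul1r; apply: (tmax_in H (gV hj) h2) => //=.
    by rewrite affine0.
  by rewrite affine1.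
have Vs s : s0 <= s <= 1 -> V j (al (s * t)).
  move=> hs; have [[k1 h1] Va Vb] := wal hj hs.
  rewrite -thE; apply: (tmax_in H (gV hj) h1) => //=.
    by rewrite affine0.
  by rewrite affine1.
have cal : continuous al by case: gal.
have endc v : 0 <= v < 1 -> ch (al v) (be 1).
  move=> /andP[v0 v1]; apply: (ch_ca_trans H (q := al 1)) => //.
  exact: (geo_ch gal).
have key s : s0 < s -> s < 1 -> t * T (al s) (be 1) <= T (al (s * t)) (be t).
  move=> s0s s1.
  have hs : s0 <= s <= 1 by rewrite !ltW.
  have As : A s by apply: comparison_lt; rewrite // s1 ltW.
  have [[k1 h1] Va Vb] := wal hj hs.
  have := good_quad (gV hj) h1 h2; rewrite /concave_pair /= !affine0 !affine1.
  move=> /(_ Va Vb Vc Vd) hq.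
  have e0 : chron_eq L (al (s * u j.-1)) (be (u j.-1)).
    have [z|z] := posnP j.-1; first by right; rewrite z !mul0r mulr0.
    by left; apply: As; rewrite z (leq_trans (leq_pred _) (ltnW jn)).
  have e1 : chron_eq L (al (s * u j.+1)) (be (u j.+1)) by left; apply: As.
  have := hq e0 e1 _ th01.
  rewrite thE -[X in be X]mul1r -[X in _ (1 * X)]mul1r.
  have -> : affine (u j.-1) (u j.+1) th = t.
    by have := thE 1; rewrite !mul1r.
  rewrite !mul1r; apply: le_trans.
  have cj : (j.-1 <= n)%N by rewrite (leq_trans (leq_pred _) (ltnW jn)).
  have := conc hs As cj; have := conc hs As jn; rewrite un mulr1.
  set F := T (al s) _; set f1 := T _ _; set f0 := T _ _ => h11 h00.
  have F0 : 0 <= F by exact: (tf_ge0 H).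
  rewrite -(ler_pM2l n0').
  have : n%:R * (t * F) = th * (j.+1%:R * F) + (1 - th) * (j.-1%:R * F).
    by rewrite /th jE j1E; field; rewrite gt_eqF.
  move=> ->; have /andP[tha thb] := th01.
  by nra.
have cv1 : (fun v : R => t * T (al v) (be 1)) @ 1^'- --> t * T (al 1) (be 1).
  apply: cvgM; first exact: cvg_cst.
  have l11 : s0 <= (1 : R) <= 1 by rewrite ltW /=.
  apply: (tf_cvg (gV hn) (Vn l11) Vb1); last exact: cvg_cst.
  exact/cvg_at_left_filter/cal.
have scal : (fun v : R => al (v * t)) @ 1^'- --> al t.
  have := @continuous_scale _ _ al t cal 1; rewrite /continuous_at mul1r => h.
  exact: cvg_at_left_filter.
have Vt' : V j (al t) by have := Vs 1; rewrite mul1r; apply; rewrite ltW /=.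
have cv2 : (fun v : R => T (al (v * t)) (be t)) @ 1^'- --> T (al t) (be t).
  by apply: (tf_cvg (gV hj) Vt' Vt) => //; exact: cvg_cst.
split; last first.
  apply: (ler_cvg_to cv1 cv2); near=> v.
  by apply: key; near: v; [exact: nbhs_left_gt|exact: nbhs_left_lt].
apply: (cst_closed H _ scal (cvg_cst (be t))); near=> v.
have v0 : s0 < v by near: v; exact: nbhs_left_gt.
have v1 : v < 1 by near: v; exact: nbhs_left_lt.
have [->|tn0] := eqVneq t 0.
  by rewrite mulr0 start; exact: (ca_refl H).
have v01 : s0 <= v <= 1 by rewrite !ltW.
have tp : 0 < t by rewrite lt_def tn0; case/andP: t01.
apply/(ch_ca H)/(tf_gt0 H (gV hj) (Vs v v01) Vt).
apply: lt_le_trans (key v v0 v1); rewrite mulr_gt0 //.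
apply/(tf_gt0 H (gV hn)); [exact: Vn|exact: Vb1|].
by apply: endc; rewrite v1 (le_trans (ltW s00)) // ltW.
Unshelve. all: by end_near. Qed.

End DiscreteComparison.

End Comparison.

(** * Geodesics in good neighbourhoods and geodesics close to a given one *)

Section Tubes.
Context {R : realType} {X : metricType R} {L : causal_data X}.
Hypothesis H : concave_spacetime L.
Implicit Types (g h : R -> X) (k m : R).

Local Notation ch := (chron L).
Local Notation ca := (caus L).
Local Notation T := (tf L).

Lemma geo_in V k g t : good L V -> geo L k g -> V (g 0) -> V (g 1) ->
  0 <= t <= 1 -> V (g t).
Proof.
move=> gV gg V0 V1 /andP[t0 t1]; apply: (good_conv gV V0 V1).
  exact: (geo_ca H gg).
exact: (geo_ca H gg).
Qed.

Lemma geo_window k g : geo L k g -> exists2 d, 0 < d & forall a b,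
  0 <= a -> a < b -> b <= 1 -> b - a < d ->
  tmax L (k * (b - a)) (g \o affine a b).
Proof.
move=> [cg k0 [d d0 gE]]; exists d => // a b a0 ab b1 bad.
have ba : 0 < b - a by rewrite subr_gt0.
split.
- exact: comp_affine_continuous.
- by rewrite mulr_gt0.
- move=> s t s0 st t1 /=.
  rewrite gE; first by congr EFin; rewrite /affine; ring.
  + by rewrite /affine; nra.
  + by apply: affine_le => //; exact: ltW.
  + by rewrite /affine; nra.
  + by rewrite /affine; nra.
Qed.

Lemma chron_start (al be : R -> X) n : continuous al -> (forall i, (0 < i <= n)%N ->
    ch (al 0) (be (i%:R / n%:R : R))) ->
  exists s0 : R, [/\ 0 < s0, s0 < 1 & forall i, (0 < i <= n)%N ->
    ch (al (s0 * (i%:R / n%:R : R))) (be (i%:R / n%:R : R))].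
Proof.
move=> cal hch.
have : \forall s \near (0 : R)^'+, forall i, (i < n.+1)%N -> (0 < i)%N ->
    ch (al (s * (i%:R / n%:R : R))) (be (i%:R / n%:R : R)).
  apply: (@near_forall_lt _ (at_right (0 : R)) n.+1 (fun i s => (0 < i)%N ->
     ch (al (s * (i%:R / n%:R : R))) (be (i%:R / n%:R : R)))) => i iN.
  have [i0|i0] := posnP i; first by apply: nearW => v; rewrite i0.
  have h : \forall s \near (0 : R)^'+,
      ch (al (s * (i%:R / n%:R : R))) (be (i%:R / n%:R : R)).
    apply: (@ch_near _ _ _ H _ _ _ (fun s : R => al (s * (i%:R / n%:R : R)))
      (fun=> be (i%:R / n%:R : R)) (al 0)); [| |exact: cvg_cst].
      by apply: hch; rewrite i0.
    have := @continuous_scale _ _ al (i%:R / n%:R) cal 0.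
    by rewrite /continuous_at mul0r => hc; exact: cvg_at_right_filter.
  by apply: filterS h => e he _.
move=> hs; near (0 : R)^'+ => s0.
exists s0; split; [by near: s0; exact: nbhs_right_gt| |].
  by near: s0; apply: nbhs_right_lt.
move=> i /andP[i0 iN]; have : forall i, (i < n.+1)%N -> (0 < i)%N ->
    ch (al (s0 * (i%:R / n%:R : R))) (be (i%:R / n%:R : R)) by near: s0.
exact.
Unshelve. all: by end_near. Qed.

(** One set [V] serves all windows. Since [al 0 = be 0 << be (i / n)] for [i > 0], the strict
    relations hold once [al] is shrunk by a small enough [s0], which starts the comparison. *)
Lemma geo_le_in_good V k m al be : good L V -> geo L k al -> geo L m be ->
  V (al 0) -> V (al 1) -> al 0 = be 0 -> al 1 = be 1 ->
  forall t, 0 <= t <= 1 -> ca (al t) (be t).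
Proof.
move=> gV gal gbe V0 V1 e0 e1 t t01.
have [da da0 wa] := geo_window gal; have [db db0 wb] := geo_window gbe.
have [|n [n1 n0 nd]] := @fine_grid R (Num.min da db / 2) 1.
  by rewrite divr_gt0 // lt_min da0.
have n0' : 0 < n%:R :> R by rewrite ltr0n.
have {nd} : 2 / n%:R < Num.min da db by lra.
rewrite lt_min => /andP[nda ndb].
have Va s : 0 <= s <= 1 -> V (al s) by move=> ?; apply: (geo_in gV gal).
have Vb s : 0 <= s <= 1 -> V (be s).
  by move=> ?; apply: (geo_in gV gbe); rewrite -?e0 -?e1.
have u01 i : (i <= n)%N -> 0 <= (i%:R / n%:R : R) <= 1.
  by move=> iN; rewrite divr_ge0 //= ler_pdivrMr // mul1r ler_nat.
have hw i : (0 < i < n)%N -> [/\ 0 <= i.-1%:R / n%:R :> R,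
    i.-1%:R / n%:R < i.+1%:R / n%:R :> R, i.+1%:R / n%:R <= 1 :> R &
    i.+1%:R / n%:R - i.-1%:R / n%:R = 2 / n%:R :> R].
  case: i => // i /= iN; split.
  - by rewrite divr_ge0.
  - by rewrite ltr_pM2r ?invr_gt0 // ltr_nat.
  - by have /andP[] := u01 _ iN.
  - by rewrite -mulrBl -!natr1; congr (_ / _); ring.
have [||s0 [s00 s01 hs]] := @chron_start al be n; first by case: gal.
  move=> i /andP[i0 iN]; rewrite e0; apply: (geo_ch H gbe) => //.
    by rewrite divr_gt0 // ltr0n.
  by have /andP[] := u01 _ iN.
have [] := @comparison_all _ _ _ H k al be n (fun=> V) s0 n1 gal e0 _ s00 s01
   _ _ _ t hs t01 => //.
- by rewrite e1; exact: (ca_refl H).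
- move=> i s hi /andP[s0s s1]; have [h1 h2 h3 h4] := hw i hi.
  have sp : 0 < s by exact: lt_le_trans s0s.
  split.
  + eexists; apply: wa.
    * by rewrite mulr_ge0 // ltW.
    * by rewrite ltr_pM2l.
    * by rewrite (le_trans _ h3) // ler_piMl //; apply: le_trans (ltW h2).
    * rewrite -mulrBr h4; apply: le_lt_trans nda.
      by rewrite ler_piMl // divr_ge0.
  + by apply: Va; apply/andP; split; nra.
  + by apply: Va; apply/andP; split; nra.
- move=> i hi; have [h1 h2 h3 h4] := hw i hi; split.
  + by eexists; apply: wb => //; rewrite h4.
  + by apply: Vb; rewrite h1 (le_trans (ltW h2)).
  + by apply: Vb; rewrite h3 (le_trans h1) // ltW.
Qed.

(** The maximizer between the end points is also a geodesic, so the two curves coincide; their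
    speeds are then compared on an initial piece short enough for [g] to maximize there. *)
Lemma geo_len_in_good V k g : good L V -> geo L k g -> V (g 0) -> V (g 1) ->
  T (g 0) (g 1) = k.
Proof.
move=> gV gg V0 V1.
have [m [b [bm b0 b1]]] := good_ex gV V0 V1 (geo_ch H gg (lexx 0) ltr01 (lexx 1)).
have gb := tmax_geo bm.
have e t : 0 <= t <= 1 -> g t = b t.
  move=> t01; apply: (cst_anti H).
    by apply: (geo_le_in_good gV gg gb).
  by apply: (geo_le_in_good gV gb gg); rewrite ?b0 ?b1.
have [cg k0 [d d0 gE]] := gg.
pose s := Num.min (d / 2) 1.
have s0 : 0 < s by rewrite lt_min divr_gt0 //=.
have s1 : s <= 1 by rewrite ge_min lexx orbT.
have sd : s < d.
  by rewrite (le_lt_trans (_ : _ <= d / 2)) // ?ge_min ?lexx //; lra.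
have := gE 0 s (lexx 0) (ltW s0) s1; rewrite subr0 => /(_ sd).
rewrite !e ?lexx ?ler01 ?(ltW s0) //; case: (bm) => _ _ -> //; last exact: ltW.
rewrite subr0 => -[] /(mulIf (lt0r_neq0 s0)) <-.
by rewrite -(tmax_len bm) b0 b1.
Qed.

(** The radius of maximality in [geo] depends on the curve. This lemma trades it for a condition on
    the end points alone, which holds uniformly for families of geodesics. *)
Lemma geo_tmax V k g : good L V -> geo L k g -> V (g 0) -> V (g 1) -> tmax L k g.
Proof.
move=> gV gg V0 V1; have [cg k0 _] := gg; split=> // s t s0 st t1.
have [<-|st'] := eqVneq s t; first by rewrite (tauxx H) subrr mulr0.
have {}st' : s < t by rewrite lt_def eq_sym st'.
have Vs : V (g s) by apply: (geo_in gV gg) => //; rewrite s0 (le_trans st).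
have Vt : V (g t) by apply: (geo_in gV gg) => //; rewrite t1 (le_trans s0).
have := geo_len_in_good gV (geo_sub gg s0 st' t1).
by rewrite /= affine0 affine1 (tfE gV Vs Vt) => ->.
Qed.

Lemma geo_sub_tmax V k g a b : good L V -> geo L k g -> 0 <= a -> a < b ->
  b <= 1 -> V (g a) -> V (g b) -> tmax L (k * (b - a)) (g \o affine a b).
Proof.
move=> gV gg a0 ab b1 Va Vb; apply: (geo_tmax gV); first exact: geo_sub.
  by rewrite /= affine0.
by rewrite /= affine1.
Qed.

Lemma tube g e : continuous g -> 0 < e -> exists2 d, 0 < d &
  forall s t, 0 <= s -> s <= t -> t <= 1 -> t - s < d ->
  exists V, [/\ good L V, V (g s), V (g t) & forall p q, V p -> V q -> mdist p q < e].
Proof.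
move=> cg e0.
have [t _|d d0 dh] := @interval_uniform R 0 1 (fun s t => exists V,
    [/\ good L V, V (g s), V (g t) & forall p q, V p -> V q -> mdist p q < e]).
  have e2 : 0 < e / 2 by rewrite divr_gt0.
  have [V [gV Vt hV]] := cst_good H (g t) e2.
  have [r r0 hr] := good_nbhs gV Vt.
  have [d d0 hd] := proj1 (continuousP_dist g) cg t r r0.
  exists d => // s s' _ _ hs hs'; exists V; split => //.
  - exact/hr/hd.
  - exact/hr/hd.
  - move=> p q /hV hp /hV hq; apply: (le_lt_trans (metric_triangle p (g t) q)).
    by rewrite metric_sym; lra.
exists d => // s t s0 st t1 tsd; apply: dh.
- by rewrite s0 (le_trans st).
- by rewrite t1 (le_trans s0).
- by rewrite distrC ger0_norm // subr_ge0.
Qed.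

Definition uclose (e : R) h g := forall t : R, 0 <= t <= 1 -> mdist (g t) (h t) < e.

Lemma ball_good V p : good L V -> V p -> \forall e \near (0 : R)^'+, forall q,
  mdist p q < e -> V q.
Proof.
move=> gV Vp; have [e e0 he] := good_nbhs gV Vp.
near=> r => q pq; apply: he; apply: (lt_trans pq).
by near: r; exact: nbhs_right_lt.
Unshelve. all: by end_near. Qed.

Lemma ball_chron p q : ch p q -> \forall e \near (0 : R)^'+, forall p' q',
  mdist p p' < e -> mdist q q' < e -> ch p' q'.
Proof.
move=> /(cst_open H)[e e0 he].
near=> r => p' q' pp' qq'.
have re : r < e by near: r; exact: nbhs_right_lt.
by apply: he; [exact: lt_trans re|exact: lt_trans re].
Unshelve. all: by end_near. Qed.

(** The grid, the good sets and the starting value [s0] are chosen from [g] alone, which makes the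
    comparison uniform over all pairs of geodesics near [g]. *)
Lemma thin_triangle k g : geo L k g -> exists2 e, 0 < e &
  forall k1 k2 h1 h2, geo L k1 h1 -> geo L k2 h2 -> uclose e h1 g -> uclose e h2 g ->
    h1 0 = h2 0 -> ca (h1 1) (h2 1) -> forall t, 0 <= t <= 1 ->
    ca (h1 t) (h2 t) /\ t * T (h1 1) (h2 1) <= T (h1 t) (h2 t).
Proof.
move=> gg; have [cg k0 _] := gg.
have [d d0 dV] := tube cg ltr01.
(* A window of two cells on each side has length at most [4 / n], which must be less than [d]. *)
have [|n [n1 n0 nd]] := @fine_grid R (d / 5) 1; first by rewrite divr_gt0.
have n0' : 0 < n%:R :> R by rewrite ltr0n.
have ni0 : 0 < n%:R^-1 :> R by rewrite invr_gt0.
pose u i : R := i%:R / n%:R.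
have u01 i : (i <= n)%N -> 0 <= u i <= 1.
  by move=> iN; rewrite /u divr_ge0 //= ler_pdivrMr // mul1r ler_nat.
have ule i j : (i <= j)%N -> u i <= u j.
  by move=> ij; rewrite /u ler_pM2r // ler_nat.
(* Multiplying by [s >= s0] moves a grid point down by at most one cell, so [s * u i.-1] may go down
   to [u (i - 2)]; truncated subtraction gives 0 at the first points. *)
pose lo i := u (i - 2)%N; pose hi i := u (minn n (i + 2)).
have lohi i : (i <= n)%N -> [/\ 0 <= lo i, lo i <= hi i, hi i <= 1 & hi i - lo i < d].
  move=> iN; split.
  - by rewrite /lo /u divr_ge0.
  - by apply: ule; rewrite leq_min (leq_trans (leq_subr _ _)) // 
      (leq_trans (leq_subr _ _)) // leq_addr.
  - by have /andP[] := u01 (minn n (i + 2)) (geq_minl _ _).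
  - rewrite /hi /lo /u -mulrBl.
    have h : (minn n (i + 2))%:R - (i - 2)%:R <= 4 :> R.
      rewrite lerBlDr -natrD ler_nat (leq_trans (geq_minr _ _)) //.
      by rewrite addnC -[4%N]/(2 + 2)%N -addnA leq_add2l -leq_subLR.
    by apply: (@le_lt_trans _ _ (4 / n%:R)); [rewrite ler_pM2r|lra].
have /choice[V hV] : forall i, exists V, (i <= n)%N ->
    [/\ good L V, V (g (lo i)) & V (g (hi i))].
  move=> i; have [iN|iN] := leqP i n; last by exists set0.
  have [a b c e] := lohi i iN; have [V [v1 v2 v3 _]] := dV _ _ a b c e.
  by exists V.
(* Starting near 1 rather than near 0 keeps the shrunk windows inside the sets [V i]. The relation
   [h1 (s0 * u i) << h2 (u i)] comes from the one along [g], because chronology is open. *)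
pose s0 : R := 1 - n%:R^-1.
have n1' : n%:R^-1 < 1 :> R by rewrite invf_lt1 // ltr1n.
have s00 : 0 < s0 by rewrite /s0; lra.
have s01 : s0 < 1 by rewrite /s0; lra.
have : \forall e \near (0 : R)^'+, forall i, (i < n.+1)%N ->
    [/\ forall q, mdist (g (lo i)) q < e -> V i q,
        forall q, mdist (g (hi i)) q < e -> V i q &
        (0 < i)%N -> forall p q, mdist (g (s0 * u i)) p < e ->
          mdist (g (u i)) q < e -> ch p q].
  apply: (@near_forall_lt _ _ n.+1 (fun i e =>
    [/\ forall q, mdist (g (lo i)) q < e -> V i q,
        forall q, mdist (g (hi i)) q < e -> V i q &
        (0 < i)%N -> forall p q, mdist (g (s0 * u i)) p < e ->
          mdist (g (u i)) q < e -> ch p q])) => i iN.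
  have [gV Vl Vh] := hV i iN.
  have f1 := ball_good gV Vl; have f2 := ball_good gV Vh.
  have f3 : \forall e \near (0 : R)^'+, (0 < i)%N -> forall p q,
      mdist (g (s0 * u i)) p < e -> mdist (g (u i)) q < e -> ch p q.
    have [i0|i0] := posnP i; first by apply: nearW => e; rewrite i0.
    have ui0 : 0 < u i by rewrite /u divr_gt0 // ltr0n.
    have f3 : ch (g (s0 * u i)) (g (u i)).
      apply: (geo_ch H gg); first by rewrite mulr_ge0 // ltW.
        by rewrite gtr_pMl.
      by have /andP[] := u01 i iN.
    by apply: filterS (ball_chron f3) => e he _.
  by near=> e; split; near: e.
move=> hE; near (0 : R)^'+ => e.
have e0 : 0 < e by near: e; exact: nbhs_right_gt.
have hE' i : (i < n.+1)%N ->
    [/\ forall q, mdist (g (lo i)) q < e -> V i q,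
        forall q, mdist (g (hi i)) q < e -> V i q &
        (0 < i)%N -> forall p q, mdist (g (s0 * u i)) p < e ->
          mdist (g (u i)) q < e -> ch p q].
  by move: i; near: e; exact: hE.
exists e => // k1 k2 h1 h2 g1 g2 cl1 cl2 st en t t01.
have win i a b : (0 < i < n)%N -> lo i <= a -> a < b -> b <= hi i ->
    (exists k', tmax L k' (h1 \o affine a b)) /\
    (exists k', tmax L k' (h2 \o affine a b)) /\
    [/\ V i (h1 a), V i (h1 b), V i (h2 a) & V i (h2 b)].
  move=> /andP[_ /ltnW iN] la ab bh; have [l0 lh h1' _] := lohi i iN.
  have lo01 : 0 <= lo i <= 1 by rewrite l0 (le_trans lh).
  have hi01 : 0 <= hi i <= 1 by rewrite h1' (le_trans l0).
  have [hl hh _]   := hE' i iN; have [gV _ _] := hV i iN.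
  have sub kk hf : geo L kk hf -> uclose e hf g -> V i (hf a) /\ V i (hf b).
    move=> gf clf; have Vlo := hl _ (clf _ lo01); have Vhi := hh _ (clf _ hi01).
    have a0 : 0 <= a by exact: le_trans la.
    have b1 : b <= 1 by exact: le_trans h1'.
    split; apply: (good_conv gV Vlo Vhi).
    - by apply: (geo_ca H gf) => //; exact: le_trans (ltW ab) b1.
    - by apply: (geo_ca H gf) => //; exact: le_trans (ltW ab) bh.
    - by apply: (geo_ca H gf) => //; exact: le_trans la (ltW ab).
    - by apply: (geo_ca H gf) => //; exact: le_trans a0 (ltW ab).
  have [Va1 Vb1] := sub _ _ g1 cl1; have [Va2 Vb2] := sub _ _ g2 cl2.
  split; last split.
  - by eexists; apply: (geo_sub_tmax gV g1) => //; [exact: le_trans la|exact: le_trans h1'].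
  - by eexists; apply: (geo_sub_tmax gV g2) => //; [exact: le_trans la|exact: le_trans h1'].
  - by [].
have hw i : (0 < i < n)%N -> [/\ u i.-1 < u i.+1, lo i <= u i.-1 & u i.+1 <= hi i].
  move=> /andP[i0 iN]; split.
  - by rewrite /u ltr_pM2r // ltr_nat; case: (i) i0.
  - by apply: ule; rewrite -subn1 leq_sub2l.
  - by apply: ule; rewrite leq_min iN /= addn2.
have := @comparison_all _ _ _ H k1 h1 h2 n V s0 n1 g1 st en s00 s01 _ _ _ t.
apply => //.
- by move=> i /andP[_ /ltnW iN]; case: (hV i iN).
- move=> i s hi' /andP[s0s s1]; have [w1 w2 w3] := hw i hi'.
  have /andP[i0 iN] := hi'.
  have sp : 0 < s by exact: lt_le_trans s0s.
  have [|||a1 [a2 [a3 a4 a5 a6]]] := win i (s * u i.-1) (s * u i.+1) hi'.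
  + have := u01 i.-1 (leq_trans (leq_pred _) (ltnW iN)); move=> /andP[p0 p1].
    have : lo i <= s0 * u i.-1.
      case: (i) i0 p0 p1 => // -[|j] _ p0 p1.
        by rewrite /lo /u /= !mul0r mulr0.
      rewrite /lo subn2 /= /s0 mulrBl mul1r lerBrDr.
      rewrite -(lerD2l (- u j)) addrA addNr add0r.
      apply: (@le_trans _ _ n%:R^-1); first by rewrite ler_piMr // ltW.
      by rewrite /u -natr1 mulrDl mul1r addrA addNr add0r.
    move=> h; apply: (le_trans h); rewrite ler_wpM2r //.
  + by rewrite ltr_pM2l.
  + apply: le_trans w3; rewrite ler_piMl //.
    by have /andP[] := u01 i.+1 iN.
  + by split.
- move=> i hi'; have [w1 w2 w3] := hw i hi'.
  by have [a1 [a2 [a3 a4 a5 a6]]] := win i _ _ hi' w2 w1 w3; split.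
- move=> i /andP[i0 iN]; have [_ _ h] := hE' i iN; apply: h => //.
    by apply: cl1; have /andP[p0 p1] := u01 i iN; apply/andP; split; nra.
  exact/cl2/u01.
Unshelve. all: by end_near. Qed.

Lemma geo_near_uniq k g : geo L k g -> exists2 e, 0 < e &
  forall k1 k2 h1 h2, geo L k1 h1 -> geo L k2 h2 -> uclose e h1 g -> uclose e h2 g ->
    h1 0 = h2 0 -> h1 1 = h2 1 -> forall t, 0 <= t <= 1 -> h1 t = h2 t.
Proof.
move=> /thin_triangle[e e0 he]; exists e => // k1 k2 h1 h2 g1 g2 c1 c2 e01 e11 t t01.
apply: (cst_anti H).
  by have [] := he _ _ _ _ g1 g2 c1 c2 e01 _ t t01; rewrite ?e11 //; exact: (ca_refl H).
by have [] := he _ _ _ _ g2 g1 c2 c1 (esym e01) _ t t01; rewrite ?e11 //; exact: (ca_refl H).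
Qed.

(** First variation at the common vertex: the points at parameter [s] have tau at least [s] times
    the value at the far ends, while the sides have tau [k1 * s] and [k2 * s] from the vertex. The
    triangle inequality there is divided by [s]. *)
Lemma geo_len_mono k g : geo L k g -> exists2 e, 0 < e &
  forall k1 k2 h1 h2, geo L k1 h1 -> geo L k2 h2 -> uclose e h1 g -> uclose e h2 g ->
    h1 0 = h2 0 -> ca (h1 1) (h2 1) -> k1 + T (h1 1) (h2 1) <= k2.
Proof.
move=> gg; have [e e0 he] := thin_triangle gg.
exists e => // k1 k2 h1 h2 g1 g2 cl1 cl2 e01 c11.
have [V [gV V0 _]] := cst_good H (h1 0) ltr01.
have [c1 _ [d1 d10 E1]] := g1; have [c2 _ [d2 d20 E2]] := g2.
have n1 : \forall s \near (0 : R)^'+, V (h1 s).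
  exact/(good_near gV V0)/cvg_at_right_filter/c1.
have n2 : \forall s \near (0 : R)^'+, V (h2 s).
  by apply: (good_near gV V0); rewrite e01; exact/cvg_at_right_filter/c2.
near (0 : R)^'+ => s.
have s0 : 0 < s by near: s; exact: nbhs_right_gt.
have s1 : s <= 1 by near: s; apply: nbhs_right_le.
have sd1 : s < d1 by near: s; exact: nbhs_right_lt.
have sd2 : s < d2 by near: s; exact: nbhs_right_lt.
have V1 : V (h1 s) by near: s.
have V2 : V (h2 s) by near: s.
have s01 : 0 <= s <= 1 by rewrite ltW.
have [cs hs] := he _ _ _ _ g1 g2 cl1 cl2 e01 c11 s s01.
have := tf_tri H gV V0 V1 V2 (geo_ca H g1 (lexx 0) (ltW s0) s1) cs.
have T1 : T (h1 0) (h1 s) = k1 * s.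
  by rewrite /tf E1 ?subr0 // ltW.
have T2 : T (h1 0) (h2 s) = k2 * s.
  by rewrite e01 /tf E2 ?subr0 // ltW.
rewrite T1 T2 => hh; have hs' : s * (k1 + T (h1 1) (h2 1)) <= s * k2 by lra.
by rewrite ler_pM2l in hs'.
Unshelve. all: by end_near. Qed.

End Tubes.

(** * Local existence of geodesics *)

Section Chains.
Context {R : realType} {X : metricType R} {L : causal_data X}.
Hypothesis H : concave_spacetime L.
Implicit Types (g h : R -> X) (k m : R).

Local Notation ch := (chron L).
Local Notation ca := (caus L).
Local Notation T := (tf L).

(** The curve [f] runs through the maximizer from [c i] to [c i.+1] during the time interval from
    [i] to [i + 1]. *)
Lemma geo_of_chain n (V : nat -> set X) (c : nat -> X) (kap : R) :
  (1 < n)%N -> 0 < kap ->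
  (forall i, (0 < i < n)%N ->
     [/\ good L (V i), V i (c i.-1), V i (c i) & V i (c i.+1)]) ->
  (forall i, (i < n)%N -> ca (c i) (c i.+1) /\ T (c i) (c i.+1) = kap) ->
  (forall i, (0 < i < n)%N -> T (c i.-1) (c i.+1) = kap * 2) ->
  exists2 g, geo L (kap * n%:R) g & forall i, (i <= n)%N -> g (i%:R / n%:R) = c i.
Proof.
move=> n1 k0 hV hc1 hc2.
have n0 : 0 < n%:R :> R by rewrite ltr0n ltnW.
have win i : (i < n)%N -> exists j, [/\ (0 < j < n)%N, good L (V j), V j (c i) & V j (c i.+1)].
  move=> iN; have [i0|i0] := posnP i.
    by exists 1%N; rewrite i0; have [] := hV 1%N; rewrite ?n1.
  by exists i; have [] := hV i; rewrite i0 iN.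
have /choice[gs hgs] : forall i, exists g, (i < n)%N ->
    [/\ tmax L kap g, g 0 = c i & g 1 = c i.+1].
  move=> i; have [iN|iN] := ltnP i n; last by exists (fun=> c 0%N).
  have [j [_ gV V0 V1]] := win i iN; have [ci Ti] := hc1 i iN.
  have chi : ch (c i) (c i.+1) by apply/(tf_gt0 H gV); rewrite // Ti.
  have [k [g [gm g0 g1]]] := good_ex gV V0 V1 chi.
  exists g => _; split=> //.
  by rewrite -Ti -g0 -g1 (tmax_len gm).
have [f [cf fE]] : exists f : R -> X, continuous f /\
    forall i, (i < n)%N -> forall t : R, 0 <= t <= 1 -> f (i%:R + t) = gs i t.
  suff : forall m : nat, (m <= n)%N -> exists f : R -> X, continuous f /\
    (m = 0%N \/ f m%:R = c m) /\
    forall i, (i < m)%N -> forall t : R, 0 <= t <= 1 -> f (i%:R + t) = gs i t.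
    by move=> /(_ n (leqnn n))[f [cf [_ fE]]]; exists f.
  elim=> [_|m IH mn].
    by exists (fun=> c 0%N); split; [move=> ?; exact: cvg_cst|split; [left|]].
  have [gm gm0 gm1] := hgs m mn.
  have cg : continuous (fun t : R => gs m (t - m%:R)).
    move=> t; apply: (@continuous_comp _ _ _ (fun t : R => t - m%:R) (gs m)).
      by apply: cvgB; [exact: cvg_id|exact: cvg_cst].
    by case: gm => cg _ _; exact: cg.
  have [f [cf [fm fE]]] := IH (ltnW mn).
  have [m0|m0] := eqVneq m 0%N.
    exists (fun t : R => gs m (t - m%:R)); split=> //; split.
      by right; rewrite -natr1 addrC addKr.
    by move=> i; rewrite m0 ltnS leqn0 => /eqP-> t t01; rewrite add0r subr0.
  have {}fm : f m%:R = c m by case: fm => // h; rewrite h in m0.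
  exists (fun t : R => if t <= m%:R then f t else gs m (t - m%:R)); split.
    by apply: continuous_glue => //; rewrite subrr gm0.
  split.
    by right; rewrite ler_nat ltnn -natr1 addrC addKr.
  move=> i; rewrite ltnS leq_eqVlt => /orP[/eqP->|im] t /andP[t0 t1].
    have [->|tn0] := eqVneq t 0; first by rewrite addr0 lexx fm gm0.
    by rewrite gerDl leNgt lt_def tn0 t0 /= addrC addKr.
  have -> : i%:R + t <= m%:R.
    by apply: (@le_trans _ _ i.+1%:R); rewrite ?ler_nat // -natr1 lerD2l.
  by apply: fE => //; rewrite t0.
pose g t := f (t * n%:R).
have gu i : (i <= n)%N -> g (i%:R / n%:R) = c i.
  move=> iN; rewrite /g divfK ?gt_eqF //; have [i0|i0] := posnP i.
    have nn : (0 < n)%N by exact: ltnW.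
    by have [_ h _] := hgs 0%N nn; rewrite i0 -h -fE ?addr0 // lexx ler01.
  have pn : (i.-1 < n)%N by rewrite prednK.
  have [_ _ h] := hgs _ pn; rewrite prednK // in h.
  by rewrite -h -fE ?lexx ?ler01 // natr1 prednK.
have cell i s t : (i < n)%N -> i%:R <= s -> s <= t -> t <= i.+1%:R ->
    tau L (f s) (f t) = (kap * (t - s))%:E.
  move=> iN is_ st ti; have [gm _ _] := hgs i iN.
  have i1 : i.+1%:R = i%:R + 1 :> R by rewrite natr1.
  rewrite i1 in ti.
  rewrite -[s](subrK i%:R) -[t](subrK i%:R) ![_ - i%:R + _]addrC !fE //; last 2 first.
  - by apply/andP; split; lra.
  - by apply/andP; split; lra.
  case: gm => _ _ ->; [by congr (_%:E); ring|lra|lra|lra].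
(* The value [2 * kap] two vertices apart is equality in the triangle inequality, so the two pieces
   form one maximizer, which [f] follows by uniqueness. *)
have cell2 i s t : (i.+1 < n)%N -> i%:R <= s -> s <= i.+1%:R -> i.+1%:R <= t ->
    t <= i.+2%:R -> tau L (f s) (f t) = (kap * (t - s))%:E.
  move=> iN is_ si it ti.
  have [gV V0 V1 V2] := hV i.+1 iN; rewrite /= in V0.
  have [m1 a0 a1] := hgs i (ltnW iN); have [m2 b0 b1] := hgs i.+1 iN.
  have T2 := hc2 i.+1 iN; rewrite /= in T2.
  have [||||F [Fm F0 F1 Fh]] := tmax_concat H gV m1 m2; rewrite ?a0 ?b0 ?a1 ?b1 //.
    by rewrite T2; ring.
  have hE : kap / (kap + kap) = 1 / 2 :> R by field; rewrite gt_eqF //; lra.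
  rewrite hE a1 in Fh.
  have [h1 h2] : (forall u, 0 <= u <= 1 -> F (affine 0 (1 / 2) u) = gs i u) /\
                 (forall u, 0 <= u <= 1 -> F (affine (1 / 2) 1 u) = gs i.+1 u).
    split.
      have s1 : tmax L ((kap + kap) * (1 / 2 - 0)) (F \o affine 0 (1 / 2)).
        by apply: tmax_sub => //; lra.
      apply: (tmax_uniq H gV s1 m1); rewrite /= ?affine0 ?affine1 ?F0 ?Fh ?a0 ?a1 //.
    have s1 : tmax L ((kap + kap) * (1 - 1 / 2)) (F \o affine (1 / 2) 1).
      by apply: tmax_sub => //; lra.
    by apply: (tmax_uniq H gV s1 m2); rewrite /= ?affine0 ?affine1 ?F1 ?Fh ?b0 ?b1.
  have i1 : i.+1%:R = i%:R + 1 :> R by rewrite natr1.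
  have i2 : i.+2%:R = i.+1%:R + 1 :> R by rewrite natr1.
  rewrite -[s](subrK i%:R) -[t](subrK i.+1%:R) ![_ - _ + _]addrC !fE //; last 3 first.
  - by apply/andP; split; lra.
  - exact: ltnW.
  - by apply/andP; split; lra.
  rewrite -h1 -?h2; last 2 first.
  - by apply/andP; split; lra.
  - by apply/andP; split; lra.
  case: Fm => _ _ ->; rewrite /affine; [by congr (_%:E); rewrite i1; field|lra|lra|lra].
exists g => //; split.
- move=> t; apply: (@continuous_comp _ _ _ (fun t : R => t * n%:R) f); last exact: cf.
  by apply: cvgM; [exact: cvg_id|exact: cvg_cst].
- by rewrite mulr_gt0.
(* An interval shorter than one cell meets at most two consecutive cells. *)
exists n%:R^-1; first by rewrite invr_gt0.
move=> s t s0 st t1 std; rewrite /g.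
have sn0 : 0 <= s * n%:R by rewrite mulr_ge0 // ltW.
have tn1 : t * n%:R <= n%:R by rewrite ler_piMl // ltW.
have stn : s * n%:R <= t * n%:R by rewrite ler_pM2r.
have td : t * n%:R < s * n%:R + 1.
  by rewrite -ltrBlDl -mulrBl -ltr_pdivlMr // mul1r.
have -> : kap * n%:R * (t - s) = kap * (t * n%:R - s * n%:R) by ring.
have [|i iN /andP[i1 i2]] := @grid_cell R n.-1 (s * n%:R).
  by rewrite sn0 prednK ?(ltnW n1) //= (le_trans stn).
rewrite prednK ?(ltnW n1) // in iN.
have [ti|ti] := leP (t * n%:R) i.+1%:R; first exact: (cell i).
have [iN'|iN'] := ltnP i.+1 n.
  apply: (cell2 i) => //; first exact: ltW.
  by rewrite -natr1; apply: (le_trans (ltW td)); rewrite lerD2r.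
have : i.+1%:R < n%:R :> R by exact: lt_le_trans tn1.
by rewrite ltr_nat ltnNge iN'.
Qed.

(** Equality case of the strict concavity of the square root, via the parallelogram identity for
    [x - y] and [x + y]. *)
Lemma sqrt_balanced (a b t : R) : 0 <= a -> 0 <= b -> a + b <= t ->
  2 * Num.sqrt (t / 2) <= Num.sqrt a + Num.sqrt b -> a = t / 2 /\ b = t / 2.
Proof.
move=> a0 b0 abt h.
have t0 : 0 <= t / 2 by lra.
have := sqr_sqrtr a0; have := sqr_sqrtr b0; have := sqr_sqrtr t0.
have := sqrtr_ge0 a; have := sqrtr_ge0 b; have := sqrtr_ge0 (t / 2).
move: h; set x := Num.sqrt a; set y := Num.sqrt b; set z := Num.sqrt _.
move=> h z0 y0 x0 hz hy hx.
have xyz : (2 * z) ^+ 2 <= (x + y) ^+ 2.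
  by rewrite ler_sqr ?nnegrE ?addr_ge0 // mulr_ge0.
have xy2 : (x - y) ^+ 2 <= 0.
  have -> : (x - y) ^+ 2 = 2 * (x ^+ 2 + y ^+ 2) - (x + y) ^+ 2 by ring.
  have E : (2 * z) ^+ 2 = 4 * z ^+ 2 by ring.
  by rewrite E in xyz; lra.
have xy : x = y.
  by apply/eqP; rewrite -subr_eq0 -sqrf_eq0 eq_le xy2 sqr_ge0.
have E1 : (2 * z) ^+ 2 = 4 * z ^+ 2 by ring.
have E2 : (x + y) ^+ 2 = 4 * x ^+ 2 by rewrite xy; ring.
rewrite E1 E2 in xyz.
rewrite -xy in hy; have z2 : z ^+ 2 <= x ^+ 2 by lra.
by rewrite hz hx in z2; rewrite hx in hy; split; lra.
Qed.

(** The entries of [p] at 0 and from [n] on are ignored, so the end points can move while [p] ranges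
    over a fixed compact product. *)
Definition chain (n : nat) (x y : X) (p : nat -> X) (i : nat) : X :=
  if (i == 0)%N then x else if (i < n)%N then p i else y.

(* Thanks to the square root, [energy] increases under midpoint replacement
   unless the two adjacent values of [tau] agree. *)
Definition energy n x y p : R :=
  \sum_(i < n) Num.sqrt (T (chain n x y p i) (chain n x y p i.+1)).

Definition replace (p : nat -> X) (i : nat) (z : X) (j : nat) : X :=
  if j == i then z else p j.

Lemma energy_replace n x y p i z : (0 < i < n)%N ->
  energy n x y (replace p i z) <= energy n x y p ->
  Num.sqrt (T (chain n x y p i.-1) z) + Num.sqrt (T z (chain n x y p i.+1)) <=
  Num.sqrt (T (chain n x y p i.-1) (chain n x y p i)) +
  Num.sqrt (T (chain n x y p i) (chain n x y p i.+1)).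
Proof.
move=> /andP[i0 iN].
have E j : chain n x y (replace p i z) j = if j == i then z else chain n x y p j.
  rewrite /chain /replace; case: eqP => [j0|_].
    by case: eqP => // ji; rewrite -ji j0 in i0.
  by case: ltnP => jn; case: eqP => // ji; move: jn; rewrite ji leqNgt iN.
have ip : (i.-1 < n)%N by rewrite (leq_ltn_trans (leq_pred _)).
have ipi : (i.-1 == i)%N = false by rewrite -{2}(prednK i0) ltn_eqF.
rewrite /energy; rewrite -!(big_mkord xpredT (fun j => Num.sqrt (T (_ j) (_ j.+1)))).
have S (q : nat -> X) : \sum_(0 <= j < n) Num.sqrt (T (q j) (q j.+1)) =
    \sum_(0 <= j < i.-1) Num.sqrt (T (q j) (q j.+1)) +
    (Num.sqrt (T (q i.-1) (q i)) + Num.sqrt (T (q i) (q i.+1))) +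
    \sum_(i.+1 <= j < n) Num.sqrt (T (q j) (q j.+1)).
  rewrite (@big_cat_nat _ _ _ i.-1) ?(ltnW ip) //= (big_ltn ip) prednK //.
  by rewrite (big_ltn iN) !addrA.
rewrite !S !E eqxx ipi gtn_eqF // -!addrA.
have -> : \sum_(0 <= j < i.-1) Num.sqrt (T (chain n x y (replace p i z) j)
      (chain n x y (replace p i z) j.+1)) =
    \sum_(0 <= j < i.-1) Num.sqrt (T (chain n x y p j) (chain n x y p j.+1)).
  apply: eq_big_nat => j /andP[_ ji]; rewrite !E !ltn_eqF //.
    by rewrite -ltnS prednK in ji.
  exact: leq_trans (leq_pred _).
have -> : \sum_(i.+1 <= j < n) Num.sqrt (T (chain n x y (replace p i z) j)
      (chain n x y (replace p i z) j.+1)) =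
    \sum_(i.+1 <= j < n) Num.sqrt (T (chain n x y p j) (chain n x y p j.+1)).
  apply: eq_big_nat => j /andP[ij _]; rewrite !E !gtn_eqF //.
  exact: leq_trans ij _.
by rewrite lerD2l !addrA lerD2r.
Qed.

End Chains.

(** * Maximizing chains between points near the ends of a geodesic *)

Section LocalExistence.
Context {R : realType} {X : metricType R} {L : causal_data X}.
Hypothesis H : concave_spacetime L.
Implicit Types (g h : R -> X) (k m : R).

Local Notation ch := (chron L).
Local Notation ca := (caus L).
Local Notation T := (tf L).

Lemma grid_tube k g e : geo L k g -> 0 < e ->
  exists n (V : nat -> set X), (1 < n)%N /\ forall i, (i <= n)%N ->
  [/\ good L (V i),
      forall t, 0 <= t <= 1 -> (i%:R - 2) / n%:R <= t <= (i%:R + 2) / n%:R ->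
        V i (g t) &
      forall p q, V i p -> V i q -> mdist p q < e].
Proof.
move=> gg e0; have [cg k0 _] := gg.
have [d d0 dV] := tube H cg e0.
have [|n [n1 n0 nd]] := @fine_grid R (d / 5) 1; first by rewrite divr_gt0.
have n0' : 0 < n%:R :> R by rewrite ltr0n.
have ni0 : 0 < n%:R^-1 :> R by rewrite invr_gt0.
suff /choice[V hV] : forall i, exists V : set X, (i <= n)%N ->
    [/\ good L V, forall t, 0 <= t <= 1 ->
        (i%:R - 2) / n%:R <= t <= (i%:R + 2) / n%:R -> V (g t) &
      forall p q, V p -> V q -> mdist p q < e] by exists n, V.
move=> i; have [iN|iN] := leqP i n; last by exists set0.
pose a : R := Num.max 0 ((i%:R - 2) / n%:R).
pose b : R := Num.min 1 ((i%:R + 2) / n%:R).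
have iN' : i%:R <= n%:R :> R by rewrite ler_nat.
have i0' : 0 <= i%:R :> R by [].
have a0 : 0 <= a by rewrite le_max lexx.
have b1 : b <= 1 by rewrite ge_min lexx.
have ab : a <= b.
  rewrite ge_max !le_min; apply/andP; split; apply/andP; split => //.
  - by rewrite ler_pdivrMr // mul1r; lra.
  - by rewrite ler_pM2r //; lra.
have bad : b - a < d.
  apply: (@le_lt_trans _ _ ((i%:R + 2) / n%:R - (i%:R - 2) / n%:R)).
    by apply: lerB; rewrite ?ge_min ?le_max lexx orbT.
  by rewrite -mulrBl; lra.
have [V [gV Va Vb dm]] := dV a b a0 ab b1 bad.
exists V => _; split=> // t /andP[t0 t1] /andP[ta tb].
have ta' : a <= t by rewrite ge_max t0.
have tb' : t <= b by rewrite le_min t1.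
by apply: (good_conv gV Va Vb); apply: (geo_ca H gg).
Qed.

(** Barrier principle: if one of two neighbouring segments weakly precedes the other at both ends
    and strictly at one, concavity makes it strict at the middle. It stops the midpoints of a chain
    from leaving their diamonds. *)
Lemma mid_barrier V k m g h : good L V -> tmax L k g -> tmax L m h ->
  V (g 0) -> V (g 1) -> V (h 0) -> V (h 1) ->
  chron_eq L (g 0) (h 0) -> chron_eq L (g 1) (h 1) ->
  ch (g 0) (h 0) \/ ch (g 1) (h 1) -> ch (g (1 / 2)) (h (1 / 2)).
Proof.
move=> gV gm hm g0 g1 h0 h1 e0 e1 st.
have h01 : 0 <= (1 / 2 : R) <= 1 by apply/andP; split; lra.
apply/(tf_gt0 H gV); [exact: (tmax_in H gV gm)|exact: (tmax_in H gV hm)|].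
apply: lt_le_trans (good_quad gV gm hm g0 g1 h0 h1 e0 e1 h01).
have p1 := tf_ge0 H (g 1) (h 1); have p0 := tf_ge0 H (g 0) (h 0).
by case: st => /(tf_gt0 H gV) st;
  [have {}st := st g0 h0|have {}st := st g1 h1]; lra.
Qed.

Section Grid.
Variables (k e : R) (g : R -> X) (n : nat) (V : nat -> set X).
Hypotheses (gg : geo L k g) (n1 : (1 < n)%N).
Hypothesis hV : forall i, (i <= n)%N ->
  [/\ good L (V i),
      forall t, 0 <= t <= 1 -> (i%:R - 2) / n%:R <= t <= (i%:R + 2) / n%:R ->
        V i (g t) &
      forall p q, V i p -> V i q -> mdist p q < e].

Let u i : R := i%:R / n%:R.
Let b : R := (2 * n%:R)^-1.
(** Both bounds are affine in [i], so the midpoint of a window of [lo] or [up] is its value at the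
    central index. Moreover [lo] fixes 0 and [up] fixes 1, hence a barrier meets the chain at one
    end of the geodesic. For [c = b], half a grid cell, they stay within half a cell of [u i] and
    [up b i < lo b i.+1], so successive diamonds [J i] are chronologically ordered. *)
Let lo c i : R := (1 - c) * u i.
Let up c i : R := u i + c * (1 - u i).
Let J i : set X := causal_diamond L (g (lo b i)) (g (up b i)).

Let n0 : 0 < n%:R :> R. Proof. by rewrite ltr0n ltnW. Qed.
Let un : u n = 1. Proof. by rewrite /u divff // gt_eqF. Qed.
Let u0 : u 0 = 0. Proof. by rewrite /u mul0r. Qed.
Let u01 i : (i <= n)%N -> 0 <= u i <= 1.
Proof.
by move=> iN; rewrite /u divr_ge0 //= ler_pdivrMr // mul1r ler_nat.
Qed.
Let uS i : u i.+1 = u i + n%:R^-1.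
Proof. by rewrite /u -natr1 mulrDl mul1r. Qed.
Let b0 : 0 < b. Proof. by rewrite /b invr_gt0 mulr_gt0. Qed.
Let bE : n%:R^-1 = 2 * b.
Proof. by rewrite /b; field; rewrite gt_eqF. Qed.
Let b4 : 4 * b <= 1.
Proof.
rewrite /b ler_pdivrMr ?mulr_gt0 // mul1r.
have : 2 <= n%:R :> R by rewrite ler_nat.
lra.
Qed.

Let hloc c i : (i <= n)%N -> 0 <= c <= 2 * b ->
  [/\ 0 <= lo c i, u i - c <= lo c i, lo c i <= u i, u i <= up c i &
      up c i <= u i + c] /\ up c i <= 1.
Proof.
move=> iN /andP[c0 cb]; have /andP[p0 p1] := u01 iN.
have := b4 => b4'; have c1 : c <= 1 by lra.
have h1 := mulr_ge0 c0 p0; rewrite -subr_ge0 in p1; have h2 := mulr_ge0 c0 p1.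
have c1' : 0 <= 1 - c by lra.
have h3 := mulr_ge0 c1' p0; have h4 := mulr_ge0 c1' p1.
by rewrite /lo /up; split; first split; lra.
Qed.

Let Vg i j t : (i <= n)%N -> (j <= n)%N -> (i <= j.+1)%N -> (j <= i.+1)%N ->
  0 <= t <= 1 -> u i - 2 * b <= t <= u i + 2 * b -> V j (g t).
Proof.
move=> iN jN ij ji t01 /andP[ta tb]; have [_ h _] := hV jN; apply: h => //.
have ij' : i%:R <= j%:R + 1 :> R by rewrite natr1 ler_nat.
have ji' : j%:R <= i%:R + 1 :> R by rewrite natr1 ler_nat.
have E1 : u i - 2 * b = (i%:R - 1) / n%:R by rewrite -bE /u mulrBl mul1r.
have E2 : u i + 2 * b = (i%:R + 1) / n%:R by rewrite -bE /u mulrDl mul1r.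
rewrite E1 in ta; rewrite E2 in tb; apply/andP; split.
  by apply: le_trans ta; rewrite ler_pM2r ?invr_gt0 //; lra.
by apply: (le_trans tb); rewrite ler_pM2r ?invr_gt0 //; lra.
Qed.

Let b2 : 0 <= b <= 2 * b. Proof. by have b0' := b0; apply/andP; split; lra. Qed.

Let Vlohi c i j : (i <= n)%N -> (j <= n)%N -> (i <= j.+1)%N -> (j <= i.+1)%N ->
  0 <= c <= 2 * b -> V j (g (lo c i)) /\ V j (g (up c i)).
Proof.
move=> iN jN ij ji hc; have [[l0 l1 l2 l3 l4] l5] := hloc iN hc.
have /andP[p0 p1] := u01 iN; have /andP[q0 q1] := hc.
split; apply: (Vg iN jN ij ji); apply/andP; split; lra.
Qed.

Let JV i j z : (i <= n)%N -> (j <= n)%N -> (i <= j.+1)%N -> (j <= i.+1)%N ->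
  J i z -> V j z.
Proof.
move=> iN jN ij ji [h1 h2]; have [gV _ _] := hV jN.
have [Va Vb] := Vlohi iN jN ij ji b2.
exact: (good_conv gV Va Vb).
Qed.

Let lohi i : (i < n)%N -> ch (g (up b i)) (g (lo b i.+1)).
Proof.
move=> iN; have [[l0 l1 l2 l3 l4] l5] := hloc (ltnW iN) b2.
have [[m0 m1 m2 m3 m4] m5] := hloc iN b2.
have /andP[p0 p1] := u01 (ltnW iN); have /andP[q0 q1] := u01 iN.
apply: (geo_ch H gg); [lra| |lra].
rewrite /up /lo uS bE; have : u i.+1 = u i + 2 * b by rewrite uS bE.
by move: q1; rewrite uS bE => q1 _; have := b0; have := b4; nra.
Qed.

(** Open conditions on an end point, satisfied by [g 0]; together with [Ey] and [K] they make every
    admissible chain chronological. *)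
Let Ex x := [/\ V 0%N x, V 1%N x & ch x (g (lo b 1))].
Let Ey y := [/\ V n y, V n.-1 y & ch (g (up b n.-1)) y].
Let K (p : nat -> X) := forall i, (0 < i < n)%N -> J i (p i).
Let np : n.-1.+1 = n. Proof. by rewrite prednK // ltnW. Qed.

Let chainV x y p i j : Ex x -> Ey y -> K p ->
  (i <= n)%N -> (j <= n)%N -> (i <= j.+1)%N -> (j <= i.+1)%N ->
  V j (chain n x y p i).
Proof.
move=> [x0 x1 _] [y0 y1 _] Kp iN jN ij ji; rewrite /chain.
have [i0|i0] := posnP i; first by rewrite i0 in ji; case: j {jN ij} ji => [|[]].
case: ltnP => iN'; first by apply: (JV iN jN ij ji); apply: Kp; rewrite i0.
have {}iN : i = n by apply/eqP; rewrite eqn_leq iN.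
move: ij jN; rewrite iN -{1}np ltnS [(j <= n)%N]leq_eqVlt => nj /orP[/eqP->//|jn].
suff -> : j = n.-1 by [].
by apply/eqP; rewrite eqn_leq nj andbT -ltnS np.
Qed.

Let chainch x y p i : Ex x -> Ey y -> K p -> (i < n)%N ->
  ch (chain n x y p i) (chain n x y p i.+1).
Proof.
move=> [_ _ x2] [_ _ y2] Kp iN; rewrite /chain /=.
have [i0|i0] := posnP i.
  rewrite i0 n1; have [h _] := Kp 1%N n1.
  exact: (ch_ca_trans H x2 h).
rewrite iN; have [_ h] : J i (p i) by apply: Kp; rewrite i0.
case: ltnP => iN'.
  have [h' _] : J i.+1 (p i.+1) by apply: Kp.
  by apply: (ca_ch_trans H h); apply: (ch_ca_trans H (lohi iN)).
have ip : i = n.-1 by apply/eqP; rewrite -eqSS np eqn_leq iN.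
by rewrite ip in h *; apply: (ca_ch_trans H h).
Qed.

Let energy_cvg (I : Type) (F : set_system I) {FF : Filter F} (xs ys : I -> X)
    (ps : I -> nat -> X) x y p : Ex x -> Ey y -> K p ->
  xs @ F --> x -> ys @ F --> y ->
  (forall i, (0 < i < n)%N -> (fun z => ps z i) @ F --> p i) ->
  (fun z => @energy _ _ L n (xs z) (ys z) (ps z)) @ F --> @energy _ _ L n x y p.
Proof.
move=> ex ey Kp xsx ysy psp.
have cc i : (fun z => chain n (xs z) (ys z) (ps z) i) @ F --> chain n x y p i.
  rewrite /chain; have [i0|i0] := posnP i; first by [].
  by case: ltnP => iN //; apply: psp; rewrite i0.
rewrite /energy; apply: cvg_big => [|i _]; first exact: add_continuous.
have iN := ltn_ord i.
apply: continuous_cvg; first exact: sqrt_continuous.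
have [gV _ _] := hV iN.
apply: (tf_cvg gV); [| |exact: cc|exact: cc]; apply: chainV => //.
- exact: ltnW.
- exact: leqW.
Qed.

Let gK : K (g \o u).
Proof.
move=> i /andP[i0 /ltnW iN] /=; have [[l0 l1 l2 l3 l4] l5] := hloc iN b2.
have /andP[p0 p1] := u01 iN.
by split; apply: (geo_ca H gg).
Qed.

Let exg : Ex (g 0).
Proof.
have /andP[c0 c1] := b2; have := b4 => b4'.
split; [apply: (@Vg 0%N)|apply: (@Vg 0%N)|] => //; rewrite ?u0 ?lexx ?ler01 //;
  try by apply/andP; split; lra.
- exact: ltnW.
- have [[l0 l1 l2 l3 l4] l5] := hloc (ltnW n1) b2.
  have /andP[p0 p1] := u01 (ltnW n1).
  apply: (geo_ch H gg) => //; last exact: le_trans p1.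
  by rewrite /lo mulr_gt0 //; [lra|rewrite /u divr_gt0 // ltr0n].
Qed.

Let eyg : Ey (g 1).
Proof.
have /andP[c0 c1] := b2; have := b4 => b4'.
have h1 : 0 <= (1 : R) <= 1 by rewrite ler01 lexx.
split; [apply: (@Vg n)|apply: (@Vg n)|] => //; rewrite ?un ?np //;
  try by apply/andP; split; lra.
- exact: leq_pred.
- exact: leq_trans (leq_pred _) (leqnSn _).
- have nn : (n.-1 < n)%N by rewrite np.
  have := lohi nn; rewrite np => h.
  apply: (ch_ca_trans H h); have [[l0 l1 l2 l3 l4] l5] := hloc (leqnn n) b2.
  by apply: (geo_ca H gg) => //; rewrite un in l2.
Qed.

Let maximizer_exists x y : Ex x -> Ey y -> exists2 p, K p &
  forall q, K q -> @energy _ _ L n x y q <= @energy _ _ L n x y p.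
Proof.
move=> ex ey.
(* Coordinates outside the interior of the chain are frozen, so that Tychonoff applies to the
   product over all natural numbers. *)
pose A i := if (0 < i < n)%N then J i else [set g 0].
pose K' : set (prod_topology (fun _ : nat => X)) := [set p | forall i, A i (p i)].
have cK : compact K'.
  apply: tychonoff => i; rewrite /A; case: ifP => _; first exact: (cst_diamond H).
  exact: compact_set1.
pose ext (p : nat -> X) i := if (0 < i < n)%N then p i else g 0.
have extK p : K p -> K' (ext p).
  by move=> Kp i; rewrite /A /ext; case: ifP => // /Kp.
have K'K p : K' p -> K p.
  by move=> Kp i hi; have := Kp i; rewrite /A hi.
have extE p i : chain n x y (ext p) i = chain n x y p i.
  rewrite /chain /ext; have [//|i0] := posnP i.
  by case: ltnP => iN; rewrite ?iN.
have [||p pK pmax] := @compact_EVT_max {ptws nat -> X} R (@energy _ _ L n x y) K' _ cK.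
- by exists (ext (g \o u)); apply/extK/gK.
- apply/subspace_continuousP => p /K'K Kp.
  apply: (@energy_cvg _ _ _ (fun=> x) (fun=> y) id) => //; try exact: cvg_cst.
  move=> i _; apply: cvg_within_filter; first exact: (@proj_continuous _ _ i p).
- exists p; first by apply/K'K; rewrite inE in pK.
  move=> q Kq; have := pmax (ext q); rewrite inE => /(_ (extK _ Kq)).
  by rewrite /energy; under eq_bigr do rewrite !extE.
Qed.

(** The last hypothesis says that replacing a vertex by the midpoint of its neighbours is
    admissible, which is all that interiority of the maximum is needed for. *)
Let max_geo x y p : Ex x -> Ey y -> K p ->
  (forall q, K q -> @energy _ _ L n x y q <= @energy _ _ L n x y p) ->
  (forall i, (0 < i < n)%N -> exists k' f, [/\ tmax L k' f,
     f 0 = chain n x y p i.-1, f 1 = chain n x y p i.+1 & J i (f (1 / 2))]) ->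
  exists k' f, [/\ geo L k' f, f 0 = x, f 1 = y, uclose e f g &
    forall i, (i <= n)%N -> f (u i) = chain n x y p i].
Proof.
move=> ex ey Kp pmax hmid.
pose c := chain n x y p.
have cV i j : (i <= n)%N -> (j <= n)%N -> (i <= j.+1)%N -> (j <= i.+1)%N -> V j (c i).
  exact: chainV.
have cch i : (i < n)%N -> ch (c i) (c i.+1) by exact: chainch.
have bal i : (0 < i < n)%N -> T (c i.-1) (c i) = T (c i.-1) (c i.+1) / 2 /\
    T (c i) (c i.+1) = T (c i.-1) (c i.+1) / 2.
  move=> hi; have /andP[i0 iN] := hi.
  have ip : (i.-1 <= n)%N by rewrite (leq_trans (leq_pred _)) // ltnW.
  have [k' [f [fm f0 f1 Jf]]] := hmid i hi.
  have [gV _ _] := hV (ltnW iN).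
  have V0 : V i (c i.-1).
    by apply: cV; rewrite ?(ltnW iN) ?prednK // (leq_trans (leq_pred _)).
  have V1 : V i (c i) by apply: cV; rewrite ?(ltnW iN).
  have V2 : V i (c i.+1) by apply: cV => //; [exact: ltnW|exact/leqW/leqnSn].
  have cch0 : ch (c i.-1) (c i).
    by have := cch i.-1; rewrite prednK //; apply; rewrite (leq_trans _ iN).
  have cch1 := cch i iN.
  have Kr : K (replace p i (f (1 / 2))).
    move=> j hj; rewrite /replace; case: eqP => [->//|_]; exact: Kp.
  have := energy_replace hi (pmax _ Kr).
  have h01 : 0 <= (1 / 2 : R) <= 1 by apply/andP; split; lra.
  have /andP[hh0 hh1] := h01.
  have k'E : k' = T (c i.-1) (c i.+1) by rewrite -(tmax_len fm) f0 f1.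
  rewrite -f0 -f1.
  have -> : T (f 0) (f (1 / 2)) = T (c i.-1) (c i.+1) / 2.
    by rewrite (tmaxE fm (lexx 0) hh0 hh1) k'E; field.
  have -> : T (f (1 / 2)) (f 1) = T (c i.-1) (c i.+1) / 2.
    by rewrite (tmaxE fm hh0 hh1 (lexx 1)) k'E; field.
  rewrite f0 f1 => hs.
  apply: sqrt_balanced; try exact: (tf_ge0 H).
    by apply: (tf_tri H gV) => //; exact: (ch_ca H).
  by move: hs; rewrite -/c; set zz := Num.sqrt (T (c i.-1) (c i.+1) / 2); lra.
pose kap := T (c 0%N) (c 1%N).
have [gV1 _ _] := hV (ltnW n1).
have kap0 : 0 < kap.
  by apply/(tf_gt0 H gV1); [apply: cV|apply: cV|apply: cch]; rewrite // ltnW.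
have kE i : (i < n)%N -> T (c i) (c i.+1) = kap.
  elim: i => [//|i IH] iN.
  have [h1 h2] := bal i.+1 iN; rewrite h2 -h1; apply: IH; exact: ltnW.
have [|||f gf fE] := @geo_of_chain _ _ _ H n V c kap n1 kap0.
- move=> i /andP[i0 iN]; have [gV _ _] := hV (ltnW iN); split => //.
  + by apply: cV; rewrite ?(ltnW iN) ?prednK // (leq_trans (leq_pred _)) // ltnW.
  + by apply: cV; rewrite ?(ltnW iN).
  + by apply: cV => //; [exact: ltnW|exact/leqW/leqnSn].
- by move=> i iN; split; [exact/(ch_ca H)/cch|exact: kE].
- move=> i hi; have [_ h] := bal i hi; have /andP[_ iN] := hi.
  by have := kE i iN; rewrite h => <-; field.
exists (kap * n%:R), f; split => //.
- by have := fE 0%N (leq0n _); rewrite mul0r.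
- have := fE n (leqnn n); rewrite divff ?gt_eqF // /c /chain ltnn.
  by rewrite gtn_eqF // ltnW.
move=> t /andP[t0 t1].
have [|i iN /andP[i1 i2]] := @grid_cell R n.-1 (t * n%:R).
  by rewrite mulr_ge0 //= ?np ?ler_piMl // ltW.
rewrite np in iN.
have ut : u i <= t <= u i.+1 by rewrite /u ler_pdivrMr // ler_pdivlMr // i1.
have /andP[uit tui] := ut.
have [gV _ dm] := hV iN.
have V0 : V i.+1 (f (u i)) by rewrite fE 1?ltnW //; apply: cV; rewrite // ltnW.
have V1 : V i.+1 (f (u i.+1)) by rewrite fE //; apply: cV.
have /andP[p0 p1] := u01 iN; have /andP[q0 q1] := u01 (ltnW iN).
apply: dm; last by apply: (good_conv gV V0 V1); apply: (geo_ca H gf).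
apply: (@Vg i.+1 i.+1) => //; first by rewrite t0.
by move: tui uit; rewrite uS bE; have := b0 => *; apply/andP; split; lra.
Qed.

(** For [b < c' < 2 * b] the curve through the points [g (lo c' j)] lies strictly below the vertices
    with [j > 0], since [g (lo c' j) << g (lo b j) <= c j], and meets the chain at [j = 0]. The
    barrier principle places it below the midpoint, and [c'] decreases to [b]. The upper bound is
    symmetric, with contact at [j = n]. *)
Let base_mid p i : K p -> (0 < i < n)%N -> exists k' f, [/\ tmax L k' f,
  f 0 = chain n (g 0) (g 1) p i.-1, f 1 = chain n (g 0) (g 1) p i.+1 &
  J i (f (1 / 2))].
Proof.
move=> Kp hi; have /andP[i0 iN] := hi.
have [gV _ _] := hV (ltnW iN).
pose c := chain n (g 0) (g 1) p.
have cV j : (j <= n)%N -> (j <= i.+1)%N -> (i <= j.+1)%N -> V i (c j).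
  by move=> *; apply: chainV => //; rewrite ltnW.
have ip : (i.-1 < n)%N by rewrite (leq_ltn_trans (leq_pred _)).
have V0 : V i (c i.-1).
  by apply: cV; rewrite ?prednK // ?(ltnW ip) // (leq_trans (leq_pred _)).
have V2 : V i (c i.+1) by apply: cV; rewrite // ltnW.
have cch0 : ch (c i.-1) (c i).
  by have := chainch exg eyg Kp ip; rewrite prednK.
have cch1 : ch (c i) (c i.+1) by apply: chainch.
have [k' [f [fm f0 f1]]] := good_ex gV V0 V2 (ch_trans H cch0 cch1).
exists k', f; split => //.
have [cg _ _] := gg.
have aff c' : 0 <= c' <= 2 * b -> affine (lo c' i.-1) (lo c' i.+1) (1 / 2) = lo c' i /\
     affine (up c' i.-1) (up c' i.+1) (1 / 2) = up c' i.
  move=> _; have E : u i = u i.-1 + 2 * b by rewrite -bE -uS prednK.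
  have E' : u i.+1 = u i.-1 + 2 * b + 2 * b by rewrite -E -bE -uS.
  by rewrite /affine /lo /up E E'; split; field.
have low c' : b < c' -> c' < 2 * b -> ch (g (lo c' i)) (f (1 / 2)).
  move=> bc cb; have hc : 0 <= c' <= 2 * b by have := b0 => *; apply/andP; split; lra.
  have [<- _] := aff c' hc.
  have lt12 : lo c' i.-1 < lo c' i.+1.
    rewrite /lo ltr_pM2l; last by have := b4 => *; lra.
    by rewrite /u ltr_pM2r ?invr_gt0 // ltr_nat; case: (i) i0.
  have [[l0 l1 l2 l3 l4] l5] := hloc (ltnW ip) hc.
  have [[m0 m1 m2 m3 m4] m5] := hloc iN hc.
  have /andP[p0 p1] := u01 iN.
  have ii : (i <= i.-1.+1)%N by rewrite prednK.
  have ii' : (i.-1 <= i.+1)%N by rewrite (leq_trans (leq_pred _)).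
  have [Va _] := Vlohi (ltnW ip) (ltnW iN) ii' ii hc.
  have [Vb _] := Vlohi iN (ltnW iN) (leqnn _) (leqW (leqnSn _)) hc.
  have gm : tmax L (k * (lo c' i.+1 - lo c' i.-1)) (g \o affine (lo c' i.-1) (lo c' i.+1)).
    by apply: (geo_sub_tmax H gV gg) => //; lra.
  have key j : (0 < j)%N -> (j <= n)%N -> ch (g (lo c' j)) (c j).
    move=> j0 jN; have [[r0 r1 r2 r3 r4] r5] := hloc jN hc.
    have /andP[v0 v1] := u01 jN.
    have uj : 0 < u j by rewrite /u divr_gt0 // ltr0n.
    have lc : lo c' j < lo b j by rewrite /lo ltr_pM2r //; lra.
    have [[s0 s1 s2 s3 s4] s5] := hloc jN b2.
    apply: (ch_ca_trans H (q := g (lo b j))).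
      by apply: (geo_ch H gg) => //; lra.
    rewrite /c /chain gtn_eqF //; case: ltnP => jn.
      by have [] : J j (p j) by apply: Kp; rewrite j0.
    by apply: (geo_ca H gg) => //; lra.
  apply: (mid_barrier gV gm fm); rewrite /= ?affine0 ?affine1 ?f0 ?f1 //.
  - have [i10|i10] := posnP i.-1; last by left; apply: key => //; exact: ltnW.
    by right; rewrite i10 /lo u0 mulr0.
  - by left; apply: key.
  - by right; apply: key.
have high c' : b < c' -> c' < 2 * b -> ch (f (1 / 2)) (g (up c' i)).
  move=> bc cb; have hc : 0 <= c' <= 2 * b by have := b0 => *; apply/andP; split; lra.
  have [_ <-] := aff c' hc.
  have lt12 : up c' i.-1 < up c' i.+1.
    have : u i.-1 < u i.+1.
      by rewrite /u ltr_pM2r ?invr_gt0 // ltr_nat; case: (i) i0.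
    by rewrite /up; have := b4 => *; nra.
  have [[l0 l1 l2 l3 l4] l5] := hloc (ltnW ip) hc.
  have [[m0 m1 m2 m3 m4] m5] := hloc iN hc.
  have /andP[p0 p1] := u01 iN; have /andP[p0' p1'] := u01 (ltnW ip).
  have ii : (i <= i.-1.+1)%N by rewrite prednK.
  have ii' : (i.-1 <= i.+1)%N by rewrite (leq_trans (leq_pred _)).
  have [_ Va] := Vlohi (ltnW ip) (ltnW iN) ii' ii hc.
  have [_ Vb] := Vlohi iN (ltnW iN) (leqnn _) (leqW (leqnSn _)) hc.
  have gm : tmax L (k * (up c' i.+1 - up c' i.-1)) (g \o affine (up c' i.-1) (up c' i.+1)).
    by apply: (geo_sub_tmax H gV gg) => //; lra.
  have key j : (j < n)%N -> ch (c j) (g (up c' j)).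
    move=> jN; have [[r0 r1 r2 r3 r4] r5] := hloc (ltnW jN) hc.
    have /andP[v0 v1] := u01 (ltnW jN).
    have uj : u j < 1 by rewrite /u ltr_pdivrMr // mul1r ltr_nat.
    have lc : up b j < up c' j by rewrite /up ltrD2l ltr_pM2r // subr_gt0.
    have [[s0 s1 s2 s3 s4] s5] := hloc (ltnW jN) b2.
    apply: (ca_ch_trans H (q := g (up b j))); last first.
      by apply: (geo_ch H gg) => //; lra.
    rewrite /c /chain; have [j0|j0] := posnP j.
      by apply: (geo_ca H gg) => //; lra.
    by rewrite jN; have [] : J j (p j) by apply: Kp; rewrite j0.
  apply: (mid_barrier gV fm gm); rewrite /= ?affine0 ?affine1 ?f0 ?f1 //.
  - by left; apply: key.
  - have [i10|i10] := ltnP i.+1 n; first by left; apply: key.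
    right; have -> : i.+1 = n by apply/eqP; rewrite eqn_leq iN.
    by rewrite /up un subrr mulr0 addr0 /c /chain ltnn gtn_eqF // ltnW.
  - by left; apply: key.
have b0' := b0.
have cst : continuous (fun _ : R => f (1 / 2)) by move=> ?; exact: cvg_cst.
split.
  have cl : continuous (fun c' : R => g (lo c' i)).
    move=> x; apply: (@continuous_comp _ _ _ (fun c' : R => lo c' i) g); last exact: cg.
    by apply: cvgM; [apply: cvgB; [exact: cvg_cst|exact: cvg_id]|exact: cvg_cst].
  apply: (@ca_right _ _ _ H (fun c' : R => g (lo c' i)) (fun=> f (1 / 2)) (2 * b)) => //.
    by lra.
  by move=> s bs sb; exact/(ch_ca H)/low.
have cl : continuous (fun c' : R => g (up c' i)).
  move=> x; apply: (@continuous_comp _ _ _ (fun c' : R => up c' i) g); last exact: cg.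
  apply: cvgD; first exact: cvg_cst.
  by apply: cvgM; [exact: cvg_id|exact: cvg_cst].
apply: (@ca_right _ _ _ H (fun=> f (1 / 2)) (fun c' : R => g (up c' i)) (2 * b)) => //.
  by lra.
by move=> s bs sb; exact/(ch_ca H)/high.
Qed.

(** Base end points admit any chain in [K], and uniqueness identifies the maximizing ones with the
    grid points of [g]. Maximizing chains for nearby end points converge to such a chain, so the
    midpoints of their neighbours converge to [g (u i)], which lies strictly inside [J i]; they are
    thus eventually admissible. *)
Lemma local_existence_grid :
  (forall k' f, geo L k' f -> f 0 = g 0 -> f 1 = g 1 -> uclose e f g ->
     forall t, 0 <= t <= 1 -> f t = g t) ->
  forall (F : set_system nat) (xs ys : nat -> X), UltraFilter F ->
  xs @ F --> g 0 -> ys @ F --> g 1 ->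
  \forall z \near F, exists k' f,
    [/\ geo L k' f, f 0 = xs z, f 1 = ys z & uclose e f g].
Proof.
move=> guniq F xs ys FU xsg ysg.
have FP : ProperFilter F by exact: ultra_proper.
have FF : Filter (nbhs F) by exact: filter_filter.
have nn : (n.-1 <= n)%N by exact: leq_pred.
have FEx : \forall z \near F, Ex (xs z).
  have [v0 v1 v2] := exg.
  have [gV0 _ _] := hV (leq0n n); have [gV1 _ _] := hV (ltnW n1).
  have f0 := good_near gV0 v0 xsg; have f1 := good_near gV1 v1 xsg.
  have f2 : \forall z \near F, ch (xs z) (g (lo b 1)).
    by apply: (ch_near H v2 xsg); exact: cvg_cst.
  by near=> z; split; near: z; [exact: f0|exact: f1|exact: f2].
have FEy : \forall z \near F, Ey (ys z).
  have [v0 v1 v2] := eyg.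
  have [gV0 _ _] := hV (leqnn n); have [gV1 _ _] := hV nn.
  have f0 := good_near gV0 v0 ysg; have f1 := good_near gV1 v1 ysg.
  have f2 : \forall z \near F, ch (g (up b n.-1)) (ys z).
    by apply: (ch_near H v2 _ ysg); exact: cvg_cst.
  by near=> z; split; near: z; [exact: f0|exact: f1|exact: f2].
have /choice[ps hps] : forall z, exists p, Ex (xs z) -> Ey (ys z) -> K p /\
    forall q, K q -> @energy _ _ L n (xs z) (ys z) q <= @energy _ _ L n (xs z) (ys z) p.
  move=> z; have [ex|nex] := pselect (Ex (xs z)); last by exists (fun=> g 0).
  have [ey|ney] := pselect (Ey (ys z)); last by exists (fun=> g 0).
  by have [p Kp pm] := maximizer_exists ex ey; exists p.
have FK : \forall z \near F, K (ps z).
  by apply: filterS2 FEx FEy => z ex ey; have [] := hps z ex ey.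
have /choice[q hq] : forall i, exists q, (0 < i < n)%N ->
    J i q /\ (fun z => ps z i) @ F --> q.
  move=> i; have [hi|hi] := boolP (0 < i < n)%N; last by exists (g 0).
  have [|q Jq qq] := @ultra_cvg _ _ (J i) F (fun z => ps z i) FU (cst_diamond H (p := _) (q := _)).
    by apply: filterS FK => z; exact.
  by exists q.
have Kq : K q by move=> i /hq[].
(* The admissible set [K] is the same for all end points, so any competitor [p] for the base problem
   also competes in the nearby ones, and the inequality passes to the limit. *)
have qmax p : K p -> @energy _ _ L n (g 0) (g 1) p <= @energy _ _ L n (g 0) (g 1) q.
  move=> Kp.
  have c1 : (fun z => @energy _ _ L n (xs z) (ys z) p) @ F -->
      @energy _ _ L n (g 0) (g 1) p.
    apply: (@energy_cvg _ F _ xs ys (fun=> p) _ _ p exg eyg Kp xsg ysg).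
    by move=> i _; exact: cvg_cst.
  have c2 : (fun z => @energy _ _ L n (xs z) (ys z) (ps z)) @ F -->
      @energy _ _ L n (g 0) (g 1) q.
    apply: (@energy_cvg _ F _ xs ys ps _ _ q exg eyg Kq xsg ysg).
    by move=> i /hq[].
  apply: (ler_cvg_to c1 c2).
  by apply: filterS2 FEx FEy => z ex ey; have [_] := hps z ex ey; apply.
have [k' [f [gf f0 f1 cf fE]]] :=
  max_geo exg eyg Kq qmax (fun i => @base_mid q i Kq).
have qE i : (i <= n)%N -> chain n (g 0) (g 1) q i = g (u i).
  by move=> iN; rewrite -fE // (guniq _ _ gf) //; exact: u01.
pose c z := chain n (xs z) (ys z) (ps z).
have cc i : (i <= n)%N -> (fun z => c z i) @ F --> g (u i).
  move=> iN; rewrite -qE // /c /chain; have [//|i0] := posnP i.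
  by case: ltnP => iN' //; have [|_] := hq i; rewrite ?i0.
have Fmid : \forall z \near F, forall i, (i < n)%N -> (0 < i)%N ->
    exists k' f, [/\ tmax L k' f, f 0 = c z i.-1, f 1 = c z i.+1 & J i (f (1 / 2))].
  apply: (@near_forall_lt _ F n (fun i z => (0 < i)%N ->
    exists k' f, [/\ tmax L k' f, f 0 = c z i.-1, f 1 = c z i.+1 & J i (f (1 / 2))])) => i iN.
  have [i0|i0] := posnP i; first by apply: nearW => z; rewrite i0.
  have [gV hg _] := hV (ltnW iN).
  have ip : (i.-1 < n)%N by rewrite (leq_ltn_trans (leq_pred _)).
  have Ei : u i = u i.-1 + 2 * b by rewrite -bE -uS prednK.
  have Ei' : u i.+1 = u i.-1 + 2 * b + 2 * b by rewrite -Ei -bE -uS.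
  have b0' := b0.
  have /andP[p0 p1] := u01 iN; have /andP[q0 q1] := u01 (ltnW ip).
  have V0 : V i (g (u i.-1)).
    by apply: (@Vg i i) => //; rewrite ?(ltnW iN) //; apply/andP; split; lra.
  have V2 : V i (g (u i.+1)).
    by apply: (@Vg i i) => //; rewrite ?(ltnW iN) //; apply/andP; split; lra.
  have lt12 : u i.-1 < u i.+1 by lra.
  have gm := geo_sub_tmax H gV gg q0 lt12 p1 V0 V2.
  have /choice[fs hfs] : forall z, exists kf : R * (R -> X),
      V i (c z i.-1) -> V i (c z i.+1) -> ch (c z i.-1) (c z i.+1) ->
      [/\ tmax L kf.1 kf.2, kf.2 0 = c z i.-1 & kf.2 1 = c z i.+1].
    move=> z; have [v0|nv] := pselect (V i (c z i.-1)); last by exists (0, g).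
    have [v2|nv] := pselect (V i (c z i.+1)); last by exists (0, g).
    have [v3|nv] := pselect (ch (c z i.-1) (c z i.+1)); last by exists (0, g).
    by have [k1 [f1' [h1 h2 h3]]] := good_ex gV v0 v2 v3; exists (k1, f1').
  have F0 := good_near gV V0 (cc _ (ltnW ip)).
  have F2 := good_near gV V2 (cc _ iN).
  have Fch : \forall z \near F, ch (c z i.-1) (c z i.+1).
    apply: (ch_near H _ (cc _ (ltnW ip)) (cc _ iN)).
    exact: (geo_ch H gg).
  have Ffs : \forall z \near F, [/\ tmax L (fs z).1 (fs z).2,
      (fs z).2 0 = c z i.-1 & (fs z).2 1 = c z i.+1].
    by near=> z; apply: hfs; near: z; [exact: F0|exact: F2|exact: Fch].
  have hcv : (fun z => (fs z).2 (1 / 2)) @ F --> g (u i).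
    have -> : g (u i) = (g \o affine (u i.-1) (u i.+1)) (1 / 2).
      by rewrite /= /affine Ei Ei'; congr g; field.
    apply: (@tmax_cvg _ _ _ H _ F (V i) _ _ (fun z => (fs z).1)
       (fun z => (fs z).2) FU gV gm); rewrite /= ?affine0 ?affine1 //.
    - by apply: filterS Ffs => z [].
    - apply: cvg_trans (cc _ (ltnW ip)); apply: near_eq_cvg.
      by apply: filterS Ffs => z [].
    - apply: cvg_trans (cc _ iN); apply: near_eq_cvg.
      by apply: filterS Ffs => z [].
    - by apply/andP; split; lra.
  have [[l0 l1 l2 l3 l4] l5] := hloc (ltnW iN) b2.
  have lu : lo b i < u i by rewrite /lo gtr_pMl; lra.
  have ui1 : u i < 1 by lra.
  have uh : u i < up b i by rewrite /up ltrDl mulr_gt0 // subr_gt0.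
  have G1 : \forall z \near F, ch (g (lo b i)) ((fs z).2 (1 / 2)).
    apply: (ch_near H _ (cvg_cst _) hcv); apply: (geo_ch H gg) => //; lra.
  have G2 : \forall z \near F, ch ((fs z).2 (1 / 2)) (g (up b i)).
    apply: (ch_near H _ hcv (cvg_cst _)); apply: (geo_ch H gg) => //; lra.
  near=> z => _.
  have [h1 h2 h3] : [/\ tmax L (fs z).1 (fs z).2,
      (fs z).2 0 = c z i.-1 & (fs z).2 1 = c z i.+1] by near: z; exact: Ffs.
  have h4 : ch (g (lo b i)) ((fs z).2 (1 / 2)) by near: z; exact: G1.
  have h5 : ch ((fs z).2 (1 / 2)) (g (up b i)) by near: z; exact: G2.
  by exists (fs z).1, (fs z).2; split => //; split; exact: (ch_ca H).
near=> z.
have ex : Ex (xs z) by near: z; exact: FEx.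
have ey : Ey (ys z) by near: z; exact: FEy.
have hm : forall i, (i < n)%N -> (0 < i)%N -> exists k' f,
    [/\ tmax L k' f, f 0 = c z i.-1, f 1 = c z i.+1 & J i (f (1 / 2))].
  by near: z; exact: Fmid.
have [Kz zmax] := hps z ex ey.
have [|k2 [f2 [h1 h2 h3 h4 _]]] := max_geo ex ey Kz zmax.
  by move=> i /andP[i0 iN]; apply: hm.
by exists k2, f2.
Unshelve. all: by end_near. Qed.

End Grid.

Lemma local_existence k g e : geo L k g -> 0 < e -> exists2 d, 0 < d &
  forall x y, mdist (g 0) x < d -> mdist (g 1) y < d ->
  exists k' f, [/\ geo L k' f, f 0 = x, f 1 = y & uclose e f g].
Proof.
move=> gg e0; apply: contrapT => hn.
have [eU eU0 hU] := geo_near_uniq H gg.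
(* The geodesics obtained must be close enough to [g] for local uniqueness to identify the limiting
   chain. *)
have e'0 : 0 < Num.min e eU by rewrite lt_min e0.
have [n [V [n1 hV]]] := grid_tube gg e'0.
have /choice[xy hxy] : forall z : nat, exists p : X * X,
    [/\ mdist (g 0) p.1 < z.+1%:R^-1, mdist (g 1) p.2 < z.+1%:R^-1 &
    ~ exists k' f, [/\ geo L k' f, f 0 = p.1, f 1 = p.2 & uclose e f g]].
  move=> z; apply: contrapT => hz; apply: hn; exists z.+1%:R^-1.
    by rewrite invr_gt0.
  move=> x y xd yd; apply: contrapT => hf; apply: hz.
  by exists (x, y).
have [F FU sF] := ultra_seq.
have FP : ProperFilter F by exact: ultra_proper.
have small (f : nat -> X) p : (forall z, mdist p (f z) < z.+1%:R^-1) -> f @ F --> p.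
  move=> hf; apply/metricType_numDomainType.cvgrPdist_lt => r r0.
  have : \forall z \near F, z.+1%:R^-1 < r by apply: sF; exact: near_infty_natSinv_lt (PosNum r0).
  by apply: filterS => z; exact: lt_trans.
have c1 : (fun z => (xy z).1) @ F --> g 0 by apply: small => z; case: (hxy z).
have c2 : (fun z => (xy z).2) @ F --> g 1 by apply: small => z; case: (hxy z).
have gclose : uclose eU g g by move=> t _; rewrite mdistxx.
have [|z [k' [f [h1 h2 h3 h4]]]] := filter_ex (local_existence_grid gg n1 hV _ FU c1 c2).
  move=> k' f gf f0 f1 cf; apply: (hU _ _ _ _ gf gg) => //.
  by move=> t /cf; rewrite lt_min => /andP[].
have [_ _ h] := hxy z; apply: h; exists k', f; split => //.
by move=> t /h4; rewrite lt_min => /andP[].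
Qed.

End LocalExistence.

(** * Time duality and limits of geodesics *)

Section Duality.
Context {R : realType} {X : metricType R}.
Implicit Types (L : causal_data X) (V : set X) (g h : R -> X) (k m : R).

Definition rev_curve g (t : R) := g (1 - t).

Lemma rev_curve_continuous g : continuous g -> continuous (rev_curve g).
Proof.
move=> cg t; apply: (@continuous_comp _ _ _ (fun t : R => 1 - t) g); last exact: cg.
by apply: cvgB; [exact: cvg_cst|exact: cvg_id].
Qed.

Lemma time_dualK L : time_dual (time_dual L) = L.
Proof. by case: L. Qed.

Lemma tmax_dual L k g : tmax L k g -> tmax (time_dual L) k (rev_curve g).
Proof.
move=> [cg k0 gE]; split=> //; first exact: rev_curve_continuous.
move=> s t s0 st t1; rewrite /rev_curve /= gE; [by congr (_%:E); ring|lra..].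
Qed.

Lemma geo_dual L k g : geo L k g -> geo (time_dual L) k (rev_curve g).
Proof.
move=> [cg k0 [d d0 gE]]; split=> //; first exact: rev_curve_continuous.
exists d => // s t s0 st t1 std; rewrite /rev_curve /= gE; [by congr (_%:E); ring|lra..].
Qed.

Lemma good_dual L V : good L V -> good (time_dual L) V.
Proof.
move=> gV; split; first split.
- exact: (good_open gV).
- by move=> p q z Vp Vq pz zq; apply: (good_conv gV Vq Vp).
- by move=> p q Vp Vq; apply: (good_fin gV).
- move=> p q Vp Vq e e0; have [d d0 hd] := good_cont gV Vq Vp e0.
  by exists d => // p' q' hp hq; apply: hd.
- move=> p q Vp Vq pq; have [k [g [gm g0 g1]]] := good_ex gV Vq Vp pq.
  exists k, (rev_curve g); split; first exact: tmax_dual.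
    by rewrite /rev_curve subr0.
  by rewrite /rev_curve subrr.
- move=> k m g h gm hm g0 g1 h0 h1 e0 e1 t /andP[t0 t1].
  have := tmax_dual gm; rewrite time_dualK => gm'.
  have := tmax_dual hm; rewrite time_dualK => hm'.
  have := good_quad gV hm' gm'; rewrite /concave_pair /rev_curve subr0 subrr.
  move=> /(_ h1 h0 g1 g0) /(_ _ _ (1 - t)).
  have c0 : chron_eq L (h 1) (g 1) by case: e1 => [|->]; [left|right].
  have c1 : chron_eq L (h 0) (g 0) by case: e0 => [|->]; [left|right].
  move=> /(_ c0 c1); have -> : 1 - (1 - t) = t by ring.
  move=> hq; rewrite addrC; apply: hq; apply/andP; split; lra.
Qed.

Lemma concave_spacetime_dual L :
  concave_spacetime L -> concave_spacetime (time_dual L).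
Proof.
move=> H; split => /=; first split => /=.
- exact: (cst_refl H).
- by move=> q p r pq qr; apply: (cst_trans H qr pq).
- by move=> p q; apply: (cst_chca H).
- by move=> p q; apply: (cst_ge0 H).
- by move=> p q r pq qr; rewrite addeC; apply: (cst_tri H).
- by move=> p q; apply: (cst_gt0 H).
- exact: (cst_irr H).
- by move=> p q /(cst_open H)[e e0 he]; exists e => // p' q' hp hq; apply: he.
- by move=> T F f g p q FF fp gq; apply: (cst_closed H FF gq fp).
- by move=> p q pq qp; apply: (cst_anti H).
- exact: (cst_future H).
- exact: (cst_past H).
- move=> p q; rewrite (_ : causal_diamond _ p q = causal_diamond L q p).
    exact: (cst_diamond H).
  by apply/seteqP; split => z [].
- move=> p e /(cst_good H p)[V [gV Vp dV]]; exists V; split => //.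
  exact: good_dual.
Qed.

End Duality.

(** * Pointwise limits of geodesics have no jumps *)

Section Compactness.
Context {R : realType} {X : metricType R}.
Implicit Types (L : causal_data X) (V : set X) (g h : R -> X) (k m : R).

Lemma cvg_mdist (I : Type) (F : set_system I) {FF : Filter F} (f : I -> X) p w :
  f @ F --> p -> (fun i => mdist w (f i)) @ F --> mdist w p.
Proof.
move=> fp; apply/cvgrPdist_lt => e e0.
move/metricType_numDomainType.cvgrPdist_lt : fp => /(_ e e0).
apply: filterS => i hi; rewrite ltr_norml.
have := metric_triangle w p (f i); have := metric_triangle w (f i) p.
by rewrite [mdist (f i) p]metric_sym => h1 h2; apply/andP; split; lra.
Qed.

Lemma mdist_continuous g w : continuous g -> continuous (fun t => mdist w (g t)).
Proof. by move=> cg t; apply: cvg_mdist; exact: cg. Qed.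

Section Limits.
Context {L : causal_data X}.
Hypothesis H : concave_spacetime L.
Context {I : Type} {F : set_system I}.
Hypothesis FU : UltraFilter F.
Variables (ks : I -> R) (gs : I -> R -> X) (l0 : R) (K : set X) (z : R -> X).
Hypothesis gsg : forall i, geo L (ks i) (gs i).
Hypotheses (l00 : 0 < l0) (ksl : forall i, l0 <= ks i).
Hypotheses (cK : compact K) (gsK : forall i t, 0 <= t <= 1 -> K (gs i t)).
Hypothesis gz : forall t, 0 <= t <= 1 -> (fun i => gs i t) @ F --> z t.

Local Notation ch := (chron L).
Local Notation ca := (caus L).
Local Notation T := (tf L).

Let FP : ProperFilter F. Proof. exact: ultra_proper. Qed.

Lemma lim_mono u v : 0 <= u -> u <= v -> v <= 1 -> ca (z u) (z v).
Proof.
move=> u0 uv v1; have FP' := FP; have FF : Filter F by exact: filter_filter.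
apply: (cst_closed H _ (gz _) (gz _)).
- by rewrite u0 (le_trans uv).
- by rewrite v1 (le_trans u0).
- by apply: nearW => i; apply: (geo_ca H (gsg i)).
Qed.

(** The common lower bound [l0] on the speeds keeps tau away from 0 in the limit. *)
Lemma lim_chron V u v : good L V -> V (z u) -> V (z v) -> 0 <= u -> u < v ->
  v <= 1 -> ch (z u) (z v).
Proof.
move=> gV Vu Vv u0 uv v1; have FP' := FP; have FF : Filter F by exact: filter_filter.
have u01 : 0 <= u <= 1 by rewrite u0 ltW // (lt_le_trans uv).
have v01 : 0 <= v <= 1 by rewrite v1 ltW // (le_lt_trans u0).
apply/(tf_gt0 H gV) => //; apply: (@lt_le_trans _ _ (l0 * (v - u))).
  by rewrite mulr_gt0 // subr_gt0.
have h : (fun i => T (gs i u) (gs i v)) @ F --> T (z u) (z v).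
  exact: (tf_cvg gV Vu Vv (gz u01) (gz v01)).
have hc : (fun=> l0 * (v - u)) @ F --> l0 * (v - u) by exact: cvg_cst.
apply: (cvg_le FP' hc h); near=> i.
have V1 : V (gs i u) by near: i; exact: (good_near gV Vu (gz u01)).
have V2 : V (gs i v) by near: i; exact: (good_near gV Vv (gz v01)).
have := tmax_len (geo_sub_tmax H gV (gsg i) u0 uv v1 V1 V2).
rewrite /= affine0 affine1 => ->.
by rewrite ler_wpM2r // subr_ge0 ltW.
Unshelve. all: by end_near. Qed.

(* The pointwise limit [z] has no jump to the right of [u]. *)
Lemma lim_right u : 0 <= u < 1 -> forall V, good L V -> V (z u) ->
  exists2 v, u < v <= 1 & V (z v).
Proof.
move=> /andP[u0 u1]; have FP' := FP; have FF : Filter F by exact: filter_filter.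
have [G [GU sG]] := ultraFilterLemma (at_right_proper_filter u).
have GP : ProperFilter G by exact: ultra_proper.
have GF : Filter G by exact: filter_filter.
have Kz t : 0 <= t <= 1 -> K (z t).
  move=> t01; have [|p Kp gp] := @ultra_cvg _ _ K F (fun i => gs i t) FU cK.
    by apply: nearW => i; exact: gsK.
  suff -> : z t = p by [].
  by apply: (@cvg_unique _ (@metric_hausdorff R X) _ _ _ _ (gz t01) gp).
have Gu : \forall v \near G, u < v by apply: sG; exact: nbhs_right_gt.
have Glt c : u < c -> \forall v \near G, v < c.
  by move=> uc; apply: sG; exact: nbhs_right_lt.
have [|w Kw zw] := @ultra_cvg _ _ K G z GU cK.
  near=> v; apply: Kz; apply/andP; split.
    by apply: (le_trans u0); apply: ltW; near: v; exact: Gu.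
  by apply: ltW; near: v; exact: Glt.
have caw v : u < v -> v <= 1 -> ca w (z v).
  move=> uv v1; apply: (cst_closed H GP zw (cvg_cst (z v))); near=> v'.
  have uv' : u < v' by near: v'; exact: Gu.
  have v'v : v' < v by near: v'; exact: Glt.
  by apply: lim_mono => //; [exact: le_trans (ltW uv')|exact: ltW].
have wnear V : good L V -> V w -> exists v0, [/\ u < v0, v0 <= 1 &
    forall v, u < v -> v <= v0 -> V (z v)].
  move=> gV Vw; have GV : \forall v \near G, V (z v) by exact: (good_near gV Vw zw).
  have G1 := Glt 1 u1.
  have [v0 [[h1 h2] h3]] := filter_ex (filterI (filterI Gu G1) GV).
  exists v0; split=> //; first exact: ltW.
  move=> v uv vv0.
  have [v' [[h4 h5] h6]] := filter_ex (filterI (filterI Gu (Glt v uv)) GV).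
  apply: (good_conv gV h6 h3).
    by apply: lim_mono; [exact: le_trans (ltW h4)|exact: ltW|exact: le_trans (ltW h2)].
  by apply: lim_mono => //; [exact: le_trans (ltW uv)|exact: ltW].
suff wu : w = z u.
  move=> V gV Vzu; rewrite -wu in Vzu; have [v0 [h1 h2 h3]] := wnear V gV Vzu.
  by exists v0; [rewrite h1|apply: h3].
(* At a jump the curves [gs i] run from far from [w] at time [u] to near [w] at time [v0], and cross
   the sphere of radius [r / 2] around [w] at times [rs i]. The limit [q] of the crossing points
   will be shown to satisfy both [q <= w] and [w <= q], contradicting its distance [r / 2] from
   [w]. *)
apply: contrapT => nwu.
have wu0 : 0 < mdist w (z u) by rewrite mdist_gt0; apply/eqP.
have [V [gV Vw dV]] := cst_good H w wu0.
have [r r0 hr] := good_nbhs gV Vw.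
have ru : r <= mdist w (z u).
  rewrite leNgt; apply/negP => /hr /dV; by rewrite ltxx.
have r20 : 0 < r / 2 by rewrite divr_gt0.
have [C [gC Cw dC]] := cst_good H w r20.
have CV q : C q -> V q by move=> /dC h; apply: hr; lra.
have [v0 [uv0 v01 Cv0]] := wnear C gC Cw.
have u01 : 0 <= u <= 1 by rewrite u0 ltW.
have v001 : 0 <= v0 <= 1 by rewrite v01 (le_trans u0) // ltW.
have F1 : \forall i \near F, r / 2 < mdist w (gs i u).
  apply: (cvgr_gt _ (cvg_mdist (w := w) (gz u01))); lra.
have F2 : \forall i \near F, C (gs i v0).
  exact: (good_near gC (Cv0 v0 uv0 (lexx _)) (gz v001)).
have /choice[rs hrs] : forall i, exists r', r / 2 < mdist w (gs i u) ->
    C (gs i v0) -> u <= r' <= v0 /\ mdist w (gs i r') = r / 2.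
  move=> i; have [h1|h1] := pselect (r / 2 < mdist w (gs i u)); last by exists 0.
  have [h2|h2] := pselect (C (gs i v0)); last by exists 0.
  have cg : continuous (gs i) by case: (gsg i).
  have [|||c cI cE] := @IVT R (fun t => mdist w (gs i t)) u v0 (r / 2).
  - exact: ltW.
  - by apply: continuous_subspaceT; exact: mdist_continuous.
  - have h3 := dC _ h2; rewrite ge_min le_max (ltW h3) (ltW h1) orbT /= ?orbT //.
  - by exists c => _ _; split => //; move: cI; rewrite in_itv.
have Frs : \forall i \near F, u <= rs i <= v0.
  near=> i; have [] := hrs i _ _ => //; near: i; [exact: F1|exact: F2].
have Frs2 : \forall i \near F, mdist w (gs i (rs i)) = r / 2.
  near=> i; have [] := hrs i _ _ => //; near: i; [exact: F1|exact: F2].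
have [|q Kq gq] := @ultra_cvg _ _ K F (fun i => gs i (rs i)) FU cK.
  near=> i; apply: gsK; have /andP[h1 h2] : u <= rs i <= v0 by near: i; exact: Frs.
  by rewrite (le_trans u0 h1) (le_trans h2).
have wq : mdist w q = r / 2.
  apply: (@cvg_unique _ _ ((fun i => mdist w (gs i (rs i))) @ F)) => //.
    exact: cvg_mdist.
  by apply: cvg_near_cst; near=> i; near: i; exact: Frs2.
have [|s suv rss] := @ultra_cvg _ _ `[u, v0]%classic F rs FU (@segment_compact R u v0).
  by near=> i; rewrite /= in_itv /=; near: i; exact: Frs.
move: suv; rewrite /= in_itv /= => /andP[us sv0].
have qv v : s < v -> v <= v0 -> ca q (z v).
  move=> sv vv0; have v1 : 0 <= v <= 1 by apply/andP; split; lra.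
  apply: (cst_closed H _ gq (gz v1)); near=> i.
  have /andP[h1 h2] : u <= rs i <= v0 by near: i; exact: Frs.
  have h3 : rs i < v by near: i; exact: (cvgr_lt _ rss).
  by apply: (geo_ca H (gsg i)); lra.
(* If the crossing times stayed above [u], then [q] would lie causally between two values of [z] in
   the convex set [C], hence closer than [r / 2] to [w]. *)
have su : s = u.
  apply/eqP; rewrite eq_le us andbT leNgt; apply/negP => us'.
  pose v' := (u + s) / 2.
  have v'1 : 0 <= v' <= 1 by rewrite /v'; apply/andP; split; lra.
  have c1 : ca (z v') q.
    apply: (cst_closed H _ (gz v'1) gq); near=> i.
    have h3 : v' < rs i by near: i; apply: (cvgr_gt _ rss); rewrite /v'; lra.
    have /andP[h1 h2] : u <= rs i <= v0 by near: i; exact: Frs.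
    by apply: (geo_ca H (gsg i)); lra.
  have c2 : ca q (z v0).
    apply: (cst_closed H _ gq (gz v001)); near=> i.
    have /andP[h1 h2] : u <= rs i <= v0 by near: i; exact: Frs.
    by apply: (geo_ca H (gsg i)); lra.
  have Cv' : C (z v') by apply: Cv0; rewrite /v'; lra.
  have := dC _ (good_conv gC Cv' (Cv0 v0 uv0 (lexx _)) c1 c2).
  by rewrite wq ltxx.
rewrite su in qv.
have qw : ca q w.
  apply: (cst_closed H GP (cvg_cst q) zw); near=> v.
  have uv : u < v by near: v; exact: Gu.
  have vv0 : v < v0 by near: v; exact: Glt.
  by apply: qv => //; exact: ltW.
have Vz0 : V (z v0) by apply/CV/Cv0.
have wz0 : ch w (z v0).
  pose v' := (u + v0) / 2.
  have uv' : u < v' by rewrite /v'; lra.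
  have v'v0 : v' < v0 by rewrite /v'; lra.
  apply: (ca_ch_trans H (q := z v')); first by apply: caw => //; lra.
  apply: (lim_chron gC) => //; [exact: Cv0 (ltW _)|exact: Cv0|lra].
have qz0 : ch q (z v0) by exact: (ca_ch_trans H qw).
have Vq : V q by apply: hr; rewrite wq; lra.
have [m [be [bm be0 be1]]] := good_ex gV Vq Vz0 qz0.
(* The segments of [gs i] on [rs i, v0] converge to the maximizer [be] from [q] to [z v0]. As [rs i]
   tends to [u], an interior point of [be] follows [z v'] for some [v' > u], hence follows [w];
   letting [th] tend to 0 gives [w <= q]. *)
have hcv th : 0 < th < 1 ->
    (fun i => (gs i \o affine (rs i) v0) th) @ F --> be th.
  move=> th01; apply: (@tmax_cvg _ _ _ H _ F V m be
    (fun i => ks i * (v0 - rs i)) (fun i => gs i \o affine (rs i) v0)) => //.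
  - by rewrite be0.
  - by rewrite be1.
  - near=> i.
    have /andP[h1 h2] : u <= rs i <= v0 by near: i; exact: Frs.
    apply: (geo_sub_tmax H gV) => //.
    + exact: le_trans h1.
    + by near: i; apply: (cvgr_lt _ rss); rewrite su.
    + by near: i; exact: (good_near gV Vq gq).
    + by near: i; exact: (good_near gV Vz0 (gz v001)).
  - rewrite be0; apply: cvg_trans gq; apply: near_eq_cvg; apply: nearW => i.
    by rewrite /= affine0.
  - rewrite be1; apply: cvg_trans (gz v001); apply: near_eq_cvg; apply: nearW => i.
    by rewrite /= affine1.
have wbe th : 0 < th -> th < 1 -> ca w (be th).
  move=> th0 th1; pose v' := u + th * (v0 - u) / 2.
  have tv : 0 < th * (v0 - u) by rewrite mulr_gt0 // subr_gt0.
  have tv1 : th * (v0 - u) <= v0 - u by rewrite ler_piMl ?ltW // subr_gt0.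
  have v'1 : 0 <= v' <= 1 by rewrite /v'; apply/andP; split; lra.
  apply: (ca_trans H (q := z v')); first by apply: caw; rewrite /v'; lra.
  have th01 : 0 < th < 1 by rewrite th0.
  apply: (cst_closed H _ (gz v'1) (hcv th th01)); near=> i.
  have /andP[h1 h2] : u <= rs i <= v0 by near: i; exact: Frs.
  have h3 : v' <= affine (rs i) v0 th.
    rewrite /v' /affine; have : th * (rs i - u) <= rs i - u.
      by rewrite ler_piMl ?subr_ge0 // ltW.
    by move=> h; lra.
  have h4 : affine (rs i) v0 th <= v0.
    have : th * (v0 - rs i) <= v0 - rs i by rewrite ler_piMl ?subr_ge0 // ltW.
    by rewrite /affine => h; lra.
  by apply: (geo_ca H (gsg i)) => //; lra.
have wq' : ca w q.
  rewrite -be0; have cb : continuous be by case: bm.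
  apply: (@ca_right _ _ _ H (fun=> w) be 1) => //.
  by move=> ?; exact: cvg_cst.
have := cst_anti H wq' qw => wE.
by move: r20; rewrite -wq wE mdistxx ltxx.
Unshelve. all: by end_near. Qed.

End Limits.
End Compactness.

Section GeodesicLimits.
Context {R : realType} {X : metricType R} {L : causal_data X}.
Hypothesis H : concave_spacetime L.
Context {I : Type} {F : set_system I}.
Hypothesis FU : UltraFilter F.
Implicit Types (V : set X) (g h : R -> X) (k m : R).

Local Notation ch := (chron L).
Local Notation ca := (caus L).
Local Notation T := (tf L).

Section Pointwise.
Variables (ks : I -> R) (gs : I -> R -> X) (l0 : R) (K : set X) (z : R -> X).
Hypothesis gsg : forall i, geo L (ks i) (gs i).
Hypotheses (l00 : 0 < l0) (ksl : forall i, l0 <= ks i).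
Hypotheses (cK : compact K) (gsK : forall i t, 0 <= t <= 1 -> K (gs i t)).
Hypothesis gz : forall t, 0 <= t <= 1 -> (fun i => gs i t) @ F --> z t.

Lemma lim_left u : 0 < u <= 1 -> forall V, good L V -> V (z u) ->
  exists2 v, 0 <= v < u & V (z v).
Proof.
move=> /andP[u0 u1] V gV Vu.
have H' := concave_spacetime_dual H.
have r01 (t : R) : 0 <= t <= 1 -> 0 <= 1 - t <= 1.
  by move=> /andP[? ?]; apply/andP; split; lra.
have [|||||v /andP[v0 v1] Vv] := @lim_right _ _ _ H' _ _ FU ks
  (fun i => rev_curve (gs i)) l0 K (rev_curve z) _ l00 ksl cK _ _ (1 - u) _ V
  (good_dual gV).
- by move=> i; apply: geo_dual.
- by move=> i t t01; apply/gsK/r01.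
- by move=> t t01; apply/gz/r01.
- by apply/andP; split; lra.
- by rewrite /rev_curve opprB addrC subrK.
- by exists (1 - v); [apply/andP; split; lra|].
Qed.

Lemma lim_window u V : 0 <= u <= 1 -> good L V -> V (z u) ->
  exists2 d, 0 < d & forall v, 0 <= v <= 1 -> `|v - u| < d -> V (z v).
Proof.
move=> /andP[u0 u1] gV Vu.
have mono := lim_mono H FU gsg gz.
have [d1 d10 h1] : exists2 d, 0 < d & forall v, u <= v -> v <= 1 -> v < u + d -> V (z v).
  have [u1'|u1'] := ltP u 1.
    have [|v /andP[v0 v1] Vv] := lim_right H FU gsg l00 ksl cK gsK gz _ gV Vu.
      by rewrite u0.
    exists (v - u); first by rewrite subr_gt0.
    move=> v' uv' v'1 v'v; have v'v' : v' <= v by lra.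
    by apply: (good_conv gV Vu Vv); apply: mono => //; lra.
  exists 1 => // v uv v1 _; have -> : v = u by lra.
  by [].
have [d2 d20 h2] : exists2 d, 0 < d & forall v, 0 <= v -> v <= u -> u - d < v -> V (z v).
  have [u0'|u0'] := ltP 0 u.
    have [|v /andP[v0 v1] Vv] := lim_left _ gV Vu; first by rewrite u0'.
    exists (u - v); first by rewrite subr_gt0.
    move=> v' uv' v'1 v'v; have v'v' : v <= v' by lra.
    by apply: (good_conv gV Vv Vu); apply: mono => //; lra.
  exists 1 => // v v0 vu _; have -> : v = u by lra.
  by [].
exists (Num.min d1 d2); first by rewrite lt_min d10.
move=> v /andP[v0 v1]; rewrite lt_min !ltr_norml => /andP[/andP[a1 a2] /andP[a3 a4]].
by case: (leP u v) => uv; [apply: h1|apply: h2] => //; lra.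
Qed.

(** Inside one good set the speed [ks i] is a quotient of tau by the parameter difference, so the
    speeds converge and the limit inherits the identity. Uniform closeness needs finitely many grid
    points only: between two of them causal convexity traps both curves in the same small set. *)
Lemma lim_geo : exists k g, [/\ geo L k g, l0 <= k, forall t, 0 <= t <= 1 -> g t = z t &
  forall e, 0 < e -> \forall i \near F, uclose e (gs i) g].
Proof.
have FP : ProperFilter F by exact: ultra_proper.
have FF : Filter F by exact: filter_filter.
pose g := z \o clamp.
have gE t : 0 <= t <= 1 -> g t = z t by move=> t01; rewrite /g /= clampE.
have cg : continuous g.
  apply: continuous_within_clamp => t t01 e e0.
  have [V [gV Vt dV]] := cst_good H (z t) e0.
  have [d d0 hd] := lim_window t01 gV Vt.
  by exists d => // s s01 st; apply/dV/hd.
have conv V s t : good L V -> V (z s) -> V (z t) -> 0 <= s -> s < t -> t <= 1 ->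
    ks @ F --> T (z s) (z t) / (t - s).
  move=> gV Vs Vt s0 st t1.
  have s01 : 0 <= s <= 1 by rewrite s0 ltW // (lt_le_trans st).
  have t01 : 0 <= t <= 1 by rewrite t1 ltW // (le_lt_trans s0).
  have h : (fun i => T (gs i s) (gs i t)) @ F --> T (z s) (z t).
    exact: (tf_cvg gV Vs Vt (gz s01) (gz t01)).
  have h2 : (fun i => T (gs i s) (gs i t) / (t - s)) @ F --> T (z s) (z t) / (t - s).
    by apply: cvgM => //; exact: cvg_cst.
  apply: cvg_trans h2; apply: near_eq_cvg; near=> i.
  have V1 : V (gs i s) by near: i; exact: (good_near gV Vs (gz s01)).
  have V2 : V (gs i t) by near: i; exact: (good_near gV Vt (gz t01)).
  have := tmax_len (geo_sub_tmax H gV (gsg i) s0 st t1 V1 V2).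
  by rewrite /= affine0 affine1 => ->; rewrite mulfK // gt_eqF // subr_gt0.
have [k kk] : exists k, ks @ F --> k.
  have [V [gV Vz _]] := cst_good H (z 0) ltr01.
  have [|d d0 hd] := lim_window _ gV Vz; first by rewrite lexx ler01.
  pose t := Num.min (d / 2) 1.
  have t0 : 0 < t by rewrite lt_min divr_gt0 //=.
  have t1 : t <= 1 by rewrite ge_min lexx orbT.
  have td : t < d.
    by rewrite (le_lt_trans (_ : _ <= d / 2)) // ?ge_min ?lexx //; lra.
  have Vt : V (z t).
    by apply: hd; rewrite ?(ltW t0) // subr0 ger0_norm // ltW.
  by eexists; exact: (conv V 0 t gV Vz Vt (lexx 0) t0 t1).
have lk : l0 <= k.
  have hc : (fun=> l0) @ F --> l0 by exact: cvg_cst.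
  by apply: (cvg_le FP hc kk); apply: nearW.
have k0 : 0 < k by exact: lt_le_trans lk.
have tauE V s t : good L V -> V (z s) -> V (z t) -> 0 <= s -> s <= t -> t <= 1 ->
    tau L (z s) (z t) = (k * (t - s))%:E.
  move=> gV Vs Vt s0 st t1.
  have [<-|nst] := eqVneq s t; first by rewrite (tauxx H) subrr mulr0.
  have {}st : s < t by rewrite lt_def eq_sym nst.
  have := conv V s t gV Vs Vt s0 st t1.
  move=> /(@cvg_unique _ (@Rhausdorff R) _ _ _ _ kk) ->.
  by rewrite (tfE gV) // divfK // gt_eqF // subr_gt0.
exists k, g; split => //.
  split=> //.
  have [t t01|d d0 hd] := @interval_uniform R 0 1 (fun s t => s <= t ->
     tau L (z s) (z t) = (k * (t - s))%:E).
    have [V [gV Vt _]] := cst_good H (z t) ltr01.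
    have [d d0 hd] := lim_window t01 gV Vt.
    exists d => // s s' s01 s'01 sd s'd ss'.
    have /andP[s0 s1] := s01; have /andP[s'0 s'1] := s'01.
    by apply: (tauE V) => //; exact: hd.
  exists d => // s t s0 st t1 std.
  have s01 : 0 <= s <= 1 by rewrite s0 (le_trans st).
  have t01 : 0 <= t <= 1 by rewrite t1 (le_trans s0).
  by rewrite !gE //; apply: hd => //; rewrite distrC ger0_norm // subr_ge0.
move=> e e0; have [d d0 dV] := tube H cg e0.
have [n [n1 n0 nd]] := @fine_grid R d 1 d0.
have n0' : 0 < n%:R :> R by rewrite ltr0n.
pose u i : R := i%:R / n%:R.
have u01 i : (i <= n)%N -> 0 <= u i <= 1.
  by move=> iN; rewrite /u divr_ge0 //= ler_pdivrMr // mul1r ler_nat.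
have uS i : u i.+1 = u i + n%:R^-1 by rewrite /u -natr1 mulrDl mul1r.
have ni0 : 0 < n%:R^-1 :> R by rewrite invr_gt0.
have /choice[V hV] : forall i, exists V, (i < n)%N ->
    [/\ good L V, V (g (u i)), V (g (u i.+1)) & forall p q, V p -> V q -> mdist p q < e].
  move=> i; have [iN|iN] := ltnP i n; last by exists set0.
  have /andP[p0 p1] := u01 i (ltnW iN); have /andP[q0 q1] := u01 i.+1 iN.
  have [||V h] := dV (u i) (u i.+1) p0 _ q1; [by rewrite uS; lra|by rewrite uS; lra|].
  by exists V.
have Fi : \forall i \near F, forall j, (j < n)%N -> V j (gs i (u j)) /\ V j (gs i (u j.+1)).
  apply: (@near_forall_lt _ F n (fun j i => V j (gs i (u j)) /\ V j (gs i (u j.+1)))).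
  move=> j jn; have [gV V0 V1 _] := hV j jn.
  rewrite gE in V0; last exact: u01 (ltnW jn).
  rewrite gE in V1; last exact: u01.
  near=> i; split; near: i.
    exact: (good_near gV V0 (gz (u01 _ (ltnW jn)))).
  exact: (good_near gV V1 (gz (u01 _ jn))).
near=> i => t /andP[t0 t1].
have [|j jn /andP[j1 j2]] := @grid_cell R n.-1 (t * n%:R).
  by rewrite mulr_ge0 ?prednK //= ?ler_piMl // ltW.
rewrite prednK // in jn.
have h : forall j, (j < n)%N -> V j (gs i (u j)) /\ V j (gs i (u j.+1)).
  by near: i; exact: Fi.
have [V0 V1] := h j jn; have [gV V2 V3 dm] := hV j jn.
have ut : u j <= t by rewrite /u ler_pdivrMr.
have tu : t <= u j.+1 by rewrite /u ler_pdivlMr.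
have /andP[p0 p1] := u01 j (ltnW jn); have /andP[q0 q1] := u01 j.+1 jn.
have mono := lim_mono H FU gsg gz.
apply: dm.
  apply: (good_conv gV V2 V3); rewrite !gE ?t0 ?p0 ?q0 //; exact: mono.
by apply: (good_conv gV V0 V1); apply: (geo_ca H (gsg i)).
Unshelve. all: by end_near. Qed.

End Pointwise.

Lemma geo_compact (ks : I -> R) (gs : I -> R -> X) (l0 : R) (K : set X) :
  (forall i, geo L (ks i) (gs i)) -> 0 < l0 -> (forall i, l0 <= ks i) ->
  compact K -> (forall i t, 0 <= t <= 1 -> K (gs i t)) ->
  exists k g, [/\ geo L k g, l0 <= k,
    forall t, 0 <= t <= 1 -> (fun i => gs i t) @ F --> g t &
    forall e, 0 < e -> \forall i \near F, uclose e (gs i) g].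
Proof.
move=> gsg l00 ksl cK gsK.
have FP : ProperFilter F by exact: ultra_proper.
have /choice[z gz] : forall t : R, exists p : X, 0 <= t <= 1 ->
    (fun i => gs i t) @ F --> p.
  move=> t; have [t01|nt01] := pselect (0 <= t <= 1).
    have [|p _ gp] := @ultra_cvg _ _ K F (fun i => gs i t) FU cK.
      by apply: nearW => i; exact: gsK.
    by exists p.
  have [i _] := filter_ex (@filterT _ F _).
  by exists (gs i t) => /nt01.
have [k [g [gg lk gE hc]]] := lim_geo gsg l00 ksl cK gsK gz.
by exists k, g; split => // t t01; rewrite gE //; exact: gz.
Qed.

End GeodesicLimits.

(** * Lifting timelike curves, monodromy *)

Section Lifting.
Context {R : realType} {X : metricType R} {L : causal_data X}.
Hypothesis H : concave_spacetime L.
Implicit Types (V : set X) (g h c : R -> X) (k m : R) (lam mu : R -> R -> X).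

Local Notation ch := (chron L).
Local Notation ca := (caus L).
Local Notation T := (tf L).

Definition eq01 g h := forall t : R, 0 <= t <= 1 -> g t = h t.

Lemma geo_len_eq k m g h : geo L k g -> geo L m h -> eq01 g h -> k = m.
Proof.
move=> [cg _ [d1 d10 E1]] [ch_ _ [d2 d20 E2]] gh.
pose u := Num.min (Num.min (d1 / 2) (d2 / 2)) 1.
have u0 : 0 < u by rewrite !lt_min !divr_gt0 //=.
have u1 : u <= 1 by rewrite ge_min lexx orbT.
have u2 : u <= Num.min (d1 / 2) (d2 / 2) by rewrite ge_min lexx.
have ud1 : u < d1.
  by apply: (le_lt_trans u2); rewrite gt_min; apply/orP; left; lra.
have ud2 : u < d2.
  by apply: (le_lt_trans u2); rewrite gt_min; apply/orP; right; lra.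
have := E1 0 u (lexx 0) (ltW u0) u1; have := E2 0 u (lexx 0) (ltW u0) u1.
rewrite subr0 => /(_ ud2) e2 /(_ ud1).
have u01 : 0 <= u <= 1 by rewrite ltW.
by rewrite !gh ?lexx ?ler01 // e2 => -[] /(mulIf (lt0r_neq0 u0)).
Qed.

Lemma uclose_trans e1 e2 e g h f : uclose e1 h g -> uclose e2 f h ->
  e1 + e2 <= e -> uclose e f g.
Proof.
move=> c1 c2 ee t t01; have := c1 t t01; have := c2 t t01.
by have := metric_triangle (g t) (h t) (f t); lra.
Qed.

Lemma uclose_le e1 e g h : uclose e1 h g -> e1 <= e -> uclose e h g.
Proof. by move=> c1 ee t t01; apply: lt_le_trans ee; exact: c1. Qed.

(** A local inverse of the exponential map at [g 0]: the geodesic to [y] near [g]. Its values are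
    taken within [e / 2] of [g], which leaves room for geodesics near them to remain in the range
    [e] of uniqueness; that yields continuity in [y]. *)
Lemma local_section k g : geo L k g -> exists e d (sec : X -> R -> X),
  [/\ 0 < e, 0 < d,
   forall y, mdist (g 1) y < d -> [/\ exists k', geo L k' (sec y), sec y 0 = g 0,
      sec y 1 = y & uclose e (sec y) g],
   forall y k' f, mdist (g 1) y < d -> geo L k' f -> f 0 = g 0 -> f 1 = y ->
      uclose e f g -> eq01 f (sec y) &
   forall y, mdist (g 1) y < d -> forall r, 0 < r -> exists2 r', 0 < r' &
     forall y', mdist (g 1) y' < d -> mdist y y' < r' -> uclose r (sec y') (sec y)].
Proof.
move=> gg; have [e e0 hU] := geo_near_uniq H gg.
have e2 : 0 < e / 2 by rewrite divr_gt0.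
have [d d0 hd] := local_existence H gg e2.
have /choice[sec hsec] : forall y, exists f, mdist (g 1) y < d ->
    [/\ exists k', geo L k' f, f 0 = g 0, f 1 = y & uclose (e / 2) f g].
  move=> y; have [yd|yd] := pselect (mdist (g 1) y < d); last by exists g.
  have [|k' [f [h1 h2 h3 h4]]] := hd (g 0) y _ yd; first by rewrite mdistxx.
  by exists f => _; split => //; exists k'.
have uniq y k' f : mdist (g 1) y < d -> geo L k' f -> f 0 = g 0 -> f 1 = y ->
    uclose e f g -> eq01 f (sec y).
  move=> yd gf f0 f1 cf; have [[k1 h1] h2 h3 h4] := hsec y yd.
  apply: (hU _ _ _ _ gf h1) => //; rewrite ?f0 ?f1 //.
  by apply: (uclose_le h4); lra.
exists e, d, sec; split => //.
  move=> y yd; have [h1 h2 h3 h4] := hsec y yd; split => //.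
  by apply: (uclose_le h4); lra.
move=> y yd r r0; have [[k1 h1] h2 h3 h4] := hsec y yd.
have re0 : 0 < Num.min r (e / 2) by rewrite lt_min r0.
have [r' r'0 hr'] := local_existence H h1 re0.
exists r' => // y' y'd yy'.
have [||k2 [f [f1 f2 f3 f4]]] := hr' (g 0) y'; rewrite ?h2 ?mdistxx ?h3 //.
have rl : Num.min r (e / 2) <= r by rewrite ge_min lexx.
have el : Num.min r (e / 2) <= e / 2 by rewrite ge_min lexx orbT.
have fe : uclose e f g by apply: (uclose_trans h4 f4); lra.
move=> t t01; rewrite -(uniq _ _ _ y'd f1 f2 f3 fe t t01).
by apply: lt_le_trans rl; exact: f4.
Qed.

(** A lift of [c] through the exponential map at [x], continuous for the uniform distance. *)
Definition geo_lift x c (a b : R) lam : Prop :=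
  (forall t, a <= t <= b -> [/\ exists k, geo L k (lam t), lam t 0 = x & lam t 1 = c t]) /\
  (forall t, a <= t <= b -> forall e, 0 < e -> exists2 d, 0 < d &
     forall s, a <= s <= b -> `|s - t| < d -> uclose e (lam s) (lam t)).

Lemma lift_sub x c a b a' b' lam : geo_lift x c a b lam -> a <= a' -> b' <= b ->
  geo_lift x c a' b' lam.
Proof.
move=> [h1 h2] aa' bb'; have sub t : a' <= t <= b' -> a <= t <= b.
  by move=> /andP[? ?]; apply/andP; split; lra.
split=> [t /sub|t /sub ht e e0]; first exact: h1.
by have [d d0 hd] := h2 t ht e e0; exists d => // s /sub; exact: hd.
Qed.

(** Agreement of two lifts is an open condition by local uniqueness of geodesics, and disagreement
    is open because the lifts are continuous. *)
Lemma lift_uniq x c a b lam mu : a <= b -> geo_lift x c a b lam -> geo_lift x c a b mu ->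
  eq01 (lam a) (mu a) -> eq01 (lam b) (mu b).
Proof.
move=> ab [l1 l2] [m1 m2].
apply: (interval_chain ab (P := fun s t => eq01 (lam s) (mu s) -> eq01 (lam t) (mu t))).
  by move=> s t r _ _ _ _ h1 h2 /h1/h2.
move=> t tab; have [[k lg] l0 lc] := l1 t tab.
have [eqt|neqt] := pselect (eq01 (lam t) (mu t)).
  have [e e0 hU] := geo_near_uniq H lg.
  have [d d0 hd] := l2 t tab e e0; have [d' d'0 hd'] := m2 t tab e e0.
  exists (Num.min d d'); first by rewrite lt_min d0.
  move=> s s' as_ ss' s'b _; rewrite lt_min => /andP[s'd s'd'] _.
  have s'ab : a <= s' <= b by rewrite s'b (le_trans as_).
  have [[k1 g1] g10 g11] := l1 s' s'ab; have [[k2 g2] g20 g21] := m1 s' s'ab.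
  apply: (hU _ _ _ _ g1 g2); rewrite ?g10 ?g11 //; first exact: hd.
  by move=> u u01; rewrite eqt //; apply: hd'.
have [u u01 nu] : exists2 u, 0 <= u <= 1 & lam t u <> mu t u.
  apply: contrapT => hn; apply: neqt => u u01; apply: contrapT => hu.
  by apply: hn; exists u.
pose r := mdist (lam t u) (mu t u) / 2.
have r0 : 0 < r by rewrite divr_gt0 // mdist_gt0; apply/eqP.
have [d d0 hd] := l2 t tab r r0; have [d' d'0 hd'] := m2 t tab r r0.
exists (Num.min d d'); first by rewrite lt_min d0.
move=> s s' as_ ss' s'b; rewrite lt_min => /andP[sd sd'] _ eqs; exfalso.
have sab : a <= s <= b by rewrite as_ (le_trans ss').
have h1 := hd s sab sd u u01; have h2 := hd' s sab sd' u u01.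
have := metric_triangle (lam t u) (lam s u) (mu t u).
rewrite [X in _ <= _ + X]metric_sym {2}eqs //.
by move: h1 h2; rewrite /r; lra.
Qed.

(** Local monotonicity of the speed, chained along the lift. It supplies the lower bound on speeds
    without which limits of geodesics could degenerate. *)
Lemma lift_mono x c a b lam k1 k2 : a <= b -> geo_lift x c a b lam ->
  (forall s t, a <= s -> s <= t -> t <= b -> ca (c s) (c t)) ->
  geo L k1 (lam a) -> geo L k2 (lam b) -> k1 <= k2.
Proof.
move=> ab [l1 l2] cc.
move: k1 k2; apply: (interval_chain ab (P := fun s t => forall k1 k2,
   geo L k1 (lam s) -> geo L k2 (lam t) -> k1 <= k2)).
  move=> s t r as_ st tr rb h1 h2 k1 k2 g1 g2.
  have [|[k g] _ _] := l1 t; first by rewrite (le_trans as_ st) (le_trans tr).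
  exact: le_trans (h1 _ _ g1 g) (h2 _ _ g g2).
move=> t tab; have [[k lg] _ _] := l1 t tab.
have [e e0 hM] := geo_len_mono H lg.
have [d d0 hd] := l2 t tab e e0; exists d => // s s' as_ ss' s'b sd s'd k1 k2 g1 g2.
have sab : a <= s <= b by rewrite as_ (le_trans ss').
have s'ab : a <= s' <= b by rewrite s'b (le_trans as_).
have [_ s0 s1] := l1 s sab; have [_ s'0 s'1] := l1 s' s'ab.
have := hM _ _ _ _ g1 g2 (hd s sab sd) (hd s' s'ab s'd).
rewrite s0 s'0 s1 s'1 => /(_ erefl (cc s s' as_ ss' s'b)).
by apply: le_trans; rewrite lerDl (tf_ge0 H).
Qed.

Lemma section_lift k g c s t e d (sec : X -> R -> X) : geo L k g ->
  continuous c ->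
  (forall y, mdist (g 1) y < d -> [/\ exists k', geo L k' (sec y), sec y 0 = g 0,
      sec y 1 = y & uclose e (sec y) g]) ->
  (forall y, mdist (g 1) y < d -> forall r, 0 < r -> exists2 r', 0 < r' &
     forall y', mdist (g 1) y' < d -> mdist y y' < r' -> uclose r (sec y') (sec y)) ->
  (forall u, s <= u <= t -> mdist (g 1) (c u) < d) ->
  geo_lift (g 0) c s t (fun u => sec (c u)).
Proof.
move=> gg cc h1 h2 h3; split=> [u ust|u ust r r0].
  by have [? ? ? _] := h1 _ (h3 u ust).
have [r' r'0 hr'] := h2 _ (h3 u ust) r r0.
have [q q0 hq] := proj1 (continuousP_dist c) cc u r' r'0.
by exists q => // v vst uv; apply: hr'; [exact: h3|exact: hq].
Qed.

(** If lifting failed on arbitrarily short intervals near [t], the geodesics to be continued would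
    lie in a compact diamond and converge to a geodesic ending at [c t]; the local section around
    that limit lifts [c] on one of those very intervals. *)
Lemma lift_exists x c a b k0 g0 : a <= b -> continuous c ->
  (forall s t, a <= s -> s <= t -> t <= b -> ca (c s) (c t)) ->
  geo L k0 g0 -> g0 0 = x -> g0 1 = c a ->
  exists lam, geo_lift x c a b lam /\ eq01 (lam a) g0.
Proof.
move=> ab cc cm gg0 g00 g01.
(* The bound [k0 <= k] is carried through the induction, so that all geodesics met on the way
   satisfy the speed hypothesis of [geo_compact]. *)
suff P : forall k g, geo L k g -> k0 <= k -> g 0 = x -> g 1 = c a ->
    exists lam, geo_lift x c a b lam /\ eq01 (lam a) g by exact: (P k0 g0).
apply: (interval_chain ab (P := fun s t => forall k g, geo L k g -> k0 <= k ->
  g 0 = x -> g 1 = c s -> exists lam, geo_lift x c s t lam /\ eq01 (lam s) g)).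
  move=> s t r as_ st tr rb h1 h2 k g gg kk gx gc.
  have [l1 [L1 E1]] := h1 k g gg kk gx gc.
  have stt : s <= t <= t by rewrite st lexx.
  have sst : s <= s <= t by rewrite lexx st.
  have [[k1 G1] p1 p2] := L1.1 t stt.
  have [[ks Gs] _ _] := L1.1 s sst.
  have kk1 : k0 <= k1.
    have k1s : ks <= k1.
      by apply: (lift_mono st L1) => // u v su uv vt; apply: cm => //; lra.
    by apply: le_trans k1s; rewrite (geo_len_eq Gs gg E1).
  have [l2 [L2 E2]] := h2 k1 (l1 t) G1 kk1 p1 p2.
  exists (fun u => if u <= t then l1 u else l2 u); split; last by rewrite st.
  split=> [u /andP[su ur]|u /andP[su ur] e e0].
    case: (leP u t) => ut; first by apply: L1.1; rewrite su.
    by apply: L2.1; rewrite ur ltW.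
  have [ut|tu|ut] := ltgtP u t.
  - have [|d d0 hd] := L1.2 u _ e e0; first by rewrite su ltW.
    exists (Num.min d (t - u)); first by rewrite lt_min d0 subr_gt0.
    move=> v /andP[sv vr]; rewrite lt_min => /andP[vd vt].
    have vt' : v <= t by move: vt; rewrite ltr_norml => /andP[]; lra.
    by rewrite vt'; apply: hd => //; rewrite sv.
  - have [|d d0 hd] := L2.2 u _ e e0; first by rewrite ur ltW.
    exists (Num.min d (u - t)); first by rewrite lt_min d0 subr_gt0.
    move=> v /andP[sv vr]; rewrite lt_min => /andP[vd vt].
    have vt' : t < v by move: vt; rewrite ltr_norml => /andP[]; lra.
    by rewrite leNgt vt' /=; apply: hd => //; rewrite vr ltW.
  - have [|d d0 hd] := L1.2 t _ e e0; first by rewrite st lexx.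
    have [|d' d'0 hd'] := L2.2 t _ e e0; first by rewrite lexx tr.
    rewrite ut; exists (Num.min d d'); first by rewrite lt_min d0.
    move=> v /andP[sv vr]; rewrite lt_min => /andP[vd vd'].
    case: (leP v t) => vt; first by apply: hd => //; rewrite sv.
    move=> w w01; rewrite -E2 //; apply: hd' => //; by rewrite vr ltW.
move=> t tab; apply: contrapT => hn.
have /choice[q hq] : forall n : nat, exists q : (R * R) * (R * (R -> X)),
    [/\ a <= q.1.1, q.1.1 <= q.1.2, q.1.2 <= b,
     `|q.1.1 - t| < n.+1%:R^-1 /\ `|q.1.2 - t| < n.+1%:R^-1 &
     [/\ geo L q.2.1 q.2.2, k0 <= q.2.1, q.2.2 0 = x, q.2.2 1 = c q.1.1 &
       ~ exists lam, geo_lift x c q.1.1 q.1.2 lam /\ eq01 (lam q.1.1) q.2.2]].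
  move=> n; apply: contrapT => hq; apply: hn.
  exists n.+1%:R^-1; first by rewrite invr_gt0.
  move=> s s' as_ ss' s'b sn s'n k g gg kk gx gc; apply: contrapT => hl.
  by apply: hq; exists ((s, s'), (k, g)).
have [F FU sF] := ultra_seq.
have FP : ProperFilter F by exact: ultra_proper.
have FF : Filter F by exact: filter_filter.
have small e : 0 < e -> \forall n \near F, `|(q n).1.1 - t| < e /\ `|(q n).1.2 - t| < e.
  move=> e0; have : \forall n \near F, n.+1%:R^-1 < e.
    by apply: sF; exact: near_infty_natSinv_lt (PosNum e0).
  apply: filterS => n ne; have [_ _ _ [h1 h2] _] := hq n.
  by split; [exact: lt_trans ne|exact: lt_trans ne].
have [_ k00 _] := gg0.
have [|||||k [g [gg lk gp gu]]] := @geo_compact _ _ _ H _ F FU (fun n => (q n).2.1)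
   (fun n => (q n).2.2) k0 (causal_diamond L x (c b)).
- by move=> n; have [_ _ _ _ []] := hq n.
- by [].
- by move=> n; have [_ _ _ _ []] := hq n.
- exact: (cst_diamond H).
- move=> n u /andP[u0 u1]; have [h1 h2 h3 _ [g1 g2 g3 g4 _]] := hq n.
  split; first by rewrite -g3; apply: (geo_ca H g1).
  apply: (ca_trans H (q := (q n).2.2 1)); first by apply: (geo_ca H g1).
  by rewrite g4; apply: cm => //; exact: le_trans h2 h3.
have gx : g 0 = x.
  apply: (@cvg_unique _ (@metric_hausdorff R X) _ _ _ _ (gp 0 _)).
    by rewrite lexx ler01.
  apply: cvg_near_cst; apply: nearW => n; by have [_ _ _ _ []] := hq n.
have gc : g 1 = c t.
  apply: (@cvg_unique _ (@metric_hausdorff R X) _ _ _ _ (gp 1 _)).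
    by rewrite lexx ler01.
  apply/metricType_numDomainType.cvgrPdist_lt => e e0.
  have [d d0 hd] := proj1 (continuousP_dist c) cc t e e0.
  apply: filterS (small d d0) => n [h1 _].
  by have [_ _ _ _ [_ _ _ -> _]] := hq n; apply: hd.
have [e [d [sec [e0 d0 s1 s2 s3]]]] := local_section gg.
have [r r0 hr] := proj1 (continuousP_dist c) cc t d d0.
have [n [nu [n1 n2]]] := filter_ex (filterI (gu e e0) (small r r0)).
have [h1 h2 h3 _ [g1 g2 g3 g4 hl]] := hq n; apply: hl.
have near u : (q n).1.1 <= u <= (q n).1.2 -> mdist (g 1) (c u) < d.
  move=> /andP[u1 u2]; rewrite gc; apply: hr; rewrite ltr_norml.
  by move: n1 n2; rewrite !ltr_norml => /andP[? ?] /andP[? ?]; apply/andP; split; lra.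
exists (fun u => sec (c u)); split.
  rewrite -gx; exact: (section_lift gg cc s1 s3).
move=> u u01; rewrite -(s2 _ _ _ _ g1 _ g4 nu) //; last by rewrite g3 gx.
by apply: near; rewrite lexx.
Qed.

End Lifting.

(** * Lifts along a timelike homotopy *)

Section Monodromy.
Context {R : realType} {X : metricType R} {L : causal_data X}.
Hypothesis H : concave_spacetime L.
Implicit Types (V : set X) (g h c : R -> X) (k m : R) (lam mu : R -> R -> X).

Local Notation ch := (chron L).
Local Notation ca := (caus L).
Local Notation T := (tf L).

Section Homotopy.
Variables (x y : X) (Ho : R -> R -> X) (a : R) (lam : R -> R -> R -> X).
Hypotheses (a0 : 0 < a) (a1 : a <= 1).
Hypothesis Hcont : forall s t, 0 <= s <= 1 -> 0 <= t <= 1 -> forall e, 0 < e ->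
  exists2 d, 0 < d & forall s' t', 0 <= s' <= 1 -> 0 <= t' <= 1 ->
    `|s' - s| < d -> `|t' - t| < d -> mdist (Ho s t) (Ho s' t') < e.
Hypothesis laml : forall s, 0 <= s <= 1 -> geo_lift x (L := L) (Ho s) a 1 (lam s).
Hypothesis lam_init : forall s, 0 <= s <= 1 -> forall e, 0 < e ->
  exists2 d, 0 < d & forall s', 0 <= s' <= 1 -> `|s' - s| < d ->
    uclose e (lam s' a) (lam s a).
Hypothesis Hend : forall s, 0 <= s <= 1 -> Ho s 1 = y.

Let Q s t := forall e, 0 < e -> exists2 d, 0 < d & forall s', 0 <= s' <= 1 ->
  `|s' - s| < d -> uclose e (lam s' t) (lam s t).

(** Continuity in the homotopy parameter propagates along the curve: near [lam s t] all neighbouring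
    lifts are given by one local section applied to [Ho], by uniqueness of lifts. The start is
    [a > 0] because at parameter 0 the geodesic from [x] would be degenerate. *)
Lemma monodromy_cont s : 0 <= s <= 1 -> Q s 1.
Proof.
have a0' := a0; have a1' := a1.
move=> s01; have Qa : Q s a by exact: lam_init.
move: Qa; apply: (interval_chain a1 (P := fun t t' => Q s t -> Q s t')).
  by move=> u v w _ _ _ _ h1 h2 /h1/h2.
move=> t /andP[ta t1].
have at1 : a <= t <= 1 by rewrite ta t1.
have [[k gg] g0 g1] := (laml s01).1 t at1.
have [e [d [sec [e0 d0 S1 S2 S3]]]] := local_section H gg.
have e2 : 0 < e / 2 by rewrite divr_gt0.
have [d1 d10 hd1] := (laml s01).2 t at1 (e / 2) e2.
have t01 : 0 <= t <= 1 by rewrite t1 (le_trans (ltW a0)).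
have [d2 d20 hd2] := Hcont s01 t01 d0.
exists (Num.min d1 d2); first by rewrite lt_min d10.
move=> u v au uv v1; rewrite !lt_min => /andP[ut1 ut2] /andP[vt1 vt2] Qu.
have uin : a <= u <= 1 by rewrite au (le_trans uv).
have vin : a <= v <= 1 by rewrite v1 (le_trans au).
have near (s' w : R) : 0 <= s' <= 1 -> `|s' - s| < d2 -> u <= w <= v ->
    mdist (lam s t 1) (Ho s' w) < d.
  move=> s'1 s's /andP[uw wv]; rewrite g1; apply: hd2 => //.
    by apply/andP; split; lra.
  move: ut2 vt2; rewrite !ltr_norml => /andP[? ?] /andP[? ?].
  by apply/andP; split; lra.
have [d3 d30 hd3] := Qu (e / 2) e2.
have key s' : 0 <= s' <= 1 -> `|s' - s| < Num.min d2 d3 ->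
    eq01 (lam s' v) (sec (Ho s' v)).
  move=> s'1; rewrite lt_min => /andP[s'2 s'3].
  have cl : uclose e (lam s' u) (lam s t).
    by apply: (uclose_trans (hd1 u uin ut1) (hd3 s' s'1 s'3)); lra.
  have nw w : u <= w <= v -> mdist (lam s t 1) (Ho s' w) < d by exact: near.
  have [[ku gu] gu0 gu1] := (laml s'1).1 u uin.
  apply: (@lift_uniq _ _ _ H x (Ho s') u v (lam s') (fun w => sec (Ho s' w)) uv).
  - by apply: (lift_sub (laml s'1)).
  - split=> [w wuv|w wuv r r0].
      by have [? ? ? _] := S1 _ (nw w wuv); rewrite -g0.
    have [r' r'0 hr'] := S3 _ (nw w wuv) r r0.
    have w01 : 0 <= w <= 1 by move: wuv => /andP[? ?]; apply/andP; split; lra.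
    have [q q0 hq] := Hcont s'1 w01 r'0.
    exists q => // w' w'uv ww'; apply: hr'; first exact: nw.
    apply: hq => //; first by move: w'uv => /andP[? ?]; apply/andP; split; lra.
    by rewrite subrr normr0.
  - apply: (S2 _ _ _ _ gu) => //; last by rewrite gu0.
    by apply: nw; rewrite lexx.
move=> r r0.
have s'm : `|s - s| < Num.min d2 d3 by rewrite subrr normr0 lt_min d20.
have sd2 : `|s - s| < d2 by rewrite subrr normr0.
have uvv : u <= v <= v by rewrite uv lexx.
have [r' r'0 hr'] := S3 _ (near s v s01 sd2 uvv) r r0.
have v01 : 0 <= v <= 1 by rewrite v1 andbT; lra.
have [q q0 hq] := Hcont s01 v01 r'0.
exists (Num.min q (Num.min d2 d3)); first by rewrite !lt_min q0 d20.
move=> s' s'1; rewrite lt_min => /andP[s'q s'd] w w01.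
rewrite (key s s01 s'm w w01) (key s' s'1 s'd w w01).
apply: hr' => //; first by apply: near => //; move: s'd; rewrite lt_min => /andP[].
by apply: hq => //; rewrite subrr normr0.
Qed.

(** All final geodesics run from [x] to the fixed point [y], so by continuity and local uniqueness
    the final geodesic is locally constant in [s]. *)
Lemma monodromy : eq01 (lam 0 1) (lam 1 1).
Proof.
have a11 : a <= (1 : R) <= 1 by rewrite a1 lexx.
apply: (interval_chain ler01 (P := fun s s' => eq01 (lam s 1) (lam s' 1))).
  by move=> s t r _ _ _ _ h1 h2 u u01; rewrite h1 // h2.
move=> s s01; have [[k gg] g0 g1] := (laml s01).1 1 a11.
have [e e0 hU] := geo_near_uniq H gg.
have [d d0 hd] := monodromy_cont s01 e0.
have key s' : 0 <= s' <= 1 -> `|s' - s| < d -> eq01 (lam s' 1) (lam s 1).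
  move=> s'1 s's; have [[k' gg'] g0' g1'] := (laml s'1).1 1 a11.
  apply: (hU _ _ _ _ gg' gg); first exact: hd.
  - by move=> t _; rewrite mdistxx.
  - by rewrite g0'.
  - by rewrite g1' g1 !Hend.
exists d => // s1 s2 s10 s12 s21 h1 h2 u u01.
rewrite (key s1) //; last by rewrite s10 (le_trans s12).
by rewrite (key s2) // s21 (le_trans s10).
Qed.

End Homotopy.

Lemma clamp_Hcont (Ho : R -> R -> X) s :
  (forall t, 0 <= t <= 1 -> forall e, 0 < e -> exists2 d, 0 < d &
    forall t', 0 <= t' <= 1 -> `|t' - t| < d -> mdist (Ho s t) (Ho s t') < e) ->
  continuous (Ho s \o clamp).
Proof. by move=> h; apply: continuous_within_clamp. Qed.

Lemma lift_eq x c c' a b lam : geo_lift (L := L) x c a b lam ->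
  (forall t, a <= t <= b -> c t = c' t) -> geo_lift (L := L) x c' a b lam.
Proof.
move=> [h1 h2] cc'; split => // t tab.
by have [? ? ?] := h1 t tab; rewrite -cc'.
Qed.

(** The changes of parameter [p0], [p1] are there because a homotopy is available between Lipschitz
    reparametrizations of the two geodesics, not between the geodesics themselves. *)
Lemma homotopy_geo_uniq (x y : X) (Ho : R -> R -> X) k0 k1 g0 g1 (p0 p1 : R -> R) :
  (forall s t, 0 <= s <= 1 -> 0 <= t <= 1 -> forall e, 0 < e ->
   exists2 d, 0 < d & forall s' t', 0 <= s' <= 1 -> 0 <= t' <= 1 ->
    `|s' - s| < d -> `|t' - t| < d -> mdist (Ho s t) (Ho s' t') < e) ->
  (forall s t t', 0 <= s <= 1 -> 0 <= t -> t < t' -> t' <= 1 ->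
     ch (Ho s t) (Ho s t')) ->
  (forall s, 0 <= s <= 1 -> Ho s 0 = x /\ Ho s 1 = y) ->
  geo L k0 g0 -> geo L k1 g1 ->
  continuous p0 -> continuous p1 ->
  (forall t, 0 < t <= 1 -> 0 < p0 t <= 1 /\ 0 < p1 t <= 1) ->
  p0 1 = 1 -> p1 1 = 1 ->
  g0 0 = x -> g1 0 = x ->
  (forall t, 0 <= t <= 1 -> Ho 0 t = g0 (p0 t) /\ Ho 1 t = g1 (p1 t)) ->
  eq01 g0 g1.
Proof.
move=> Hc Hch Hx gg0 gg1 cp0 cp1 p01 p0e p1e g0x g1x HE.
have z01 : 0 <= (0 : R) <= 1 by rewrite lexx ler01.
have o01 : 0 <= (1 : R) <= 1 by rewrite lexx ler01.
have [V [gV Vx _]] := cst_good H x ltr01.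
have [r r0 hr] := good_nbhs gV Vx.
(* A single [a] works for all [s] by compactness of the homotopy interval. The lifts then start with
   maximizers in one good set [V], where they are unique and vary continuously. *)
have [a [a0 a1 Va]] : exists a, [/\ 0 < a, a <= 1 &
    forall s t, 0 <= s <= 1 -> 0 <= t <= a -> V (Ho s t)].
  suff [a a0 Va] : exists2 a, 0 < a & forall s t, 0 <= s <= 1 ->
      0 <= t <= 1 -> t <= a -> V (Ho s t).
    exists (Num.min a 1); split; rewrite ?lt_min ?a0 //= ?ge_min ?lexx ?orbT //.
    move=> s t s01 /andP[t0]; rewrite le_min => /andP[ta t1].
    by apply: Va => //; rewrite t0.
  apply: (interval_chain ler01 (P := fun s s' => exists2 a, 0 < a & forall u t,
    s <= u <= s' -> 0 <= t <= 1 -> t <= a -> V (Ho u t))).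
    move=> s t q _ st tq _ [b b0 hb] [b' b'0 hb'].
    exists (Num.min b b'); first by rewrite lt_min b0.
    move=> u v /andP[su uq] v01; rewrite le_min => /andP[vb vb'].
    case: (leP u t) => ut; first by apply: hb => //; rewrite su.
    by apply: hb' => //; rewrite uq ltW.
  move=> s s01; have [d d0 hd] := Hc s 0 s01 z01 r r0.
  exists d => // s1 s2 s10 s12 s21 h1 h2.
  exists (d / 2); first by rewrite divr_gt0.
  move=> u t /andP[su us] t01 td; apply: hr; have [<- _] := Hx s s01.
  apply: hd => //; first by apply/andP; split; lra.
    by move: h1 h2; rewrite !ltr_norml => /andP[? ?] /andP[? ?]; apply/andP; split; lra.
  by rewrite subr0 ger0_norm; [lra|case/andP: t01].
have a01 : 0 <= a <= 1 by rewrite ltW.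
have Vs s : 0 <= s <= 1 -> V (Ho s a).
  by move=> s01; apply: Va => //; rewrite lexx ltW.
have /choice[kt ht] : forall s, exists kt : R * (R -> X), 0 <= s <= 1 ->
    [/\ tmax L kt.1 kt.2, kt.2 0 = x & kt.2 1 = Ho s a].
  move=> s; have [s01|s01] := pselect (0 <= s <= 1); last by exists (0, g0).
  have cha : ch x (Ho s a).
    by have [<- _] := Hx s s01; apply: Hch.
  by have [k [f [h1 h2 h3]]] := good_ex gV Vx (Vs s s01) cha; exists (k, f).
have cH s : 0 <= s <= 1 -> continuous (Ho s \o clamp).
  move=> s01; apply: clamp_Hcont => t t01 e e0; have [d d0 hd] := Hc s t s01 t01 e e0.
  exists d => // t' t'1 tt'; apply: hd => //; by rewrite subrr normr0.
have Ec s t : a <= t <= 1 -> (Ho s \o clamp) t = Ho s t.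
  by move=> /andP[ta t1] /=; rewrite clampE // t1 (le_trans (ltW a0)).
have /choice[lam hlam] : forall s, exists lam, 0 <= s <= 1 ->
    geo_lift (L := L) x (Ho s) a 1 lam /\ eq01 (lam a) (kt s).2.
  move=> s; have [s01|s01] := pselect (0 <= s <= 1); last by exists (fun _ => g0).
  have [m0 m1 m2] := ht s s01.
  have [||lam [l1 l2]] := @lift_exists _ _ _ H x (Ho s \o clamp) a 1 (kt s).1
     (kt s).2 a1 (cH s s01) _ (tmax_geo m0) m1.
  - move=> u v au uv v1; rewrite !Ec; last 2 first.
    + by rewrite v1 (le_trans au).
    + by rewrite au (le_trans uv).
    have [->|nuv] := eqVneq u v; first exact: (ca_refl H).
    by apply/(ch_ca H)/Hch => //; [exact: le_trans (ltW a0) au|rewrite lt_def eq_sym nuv].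
  - by rewrite Ec // lexx.
  - by exists lam => _; split=> //; apply: lift_eq l1 _ => t tab; rewrite Ec.
have geo_Va k f s : 0 <= s <= 1 -> geo L k f -> f 0 = x -> f 1 = Ho s a ->
    eq01 f (kt s).2.
  move=> s01 gf f0 f1; have [m0 m1 m2] := ht s s01.
  have fm : tmax L k f by apply: (geo_tmax H gV gf); rewrite ?f0 // f1; exact: Vs.
  by apply: (tmax_uniq H gV fm m0); rewrite ?f0 ?f1 //; exact: Vs.
have mon : eq01 (lam 0 1) (lam 1 1).
  apply: (@monodromy x y Ho a lam a0 a1 Hc).
  - by move=> s /hlam[].
  - move=> s s01 e e0; have [_ E] := hlam s s01; have [m0 m1 m2] := ht s s01.
    have [d d0 hd] := local_existence H (tmax_geo m0) e0.
    have [d' d'0 hd'] := Hc s a s01 a01 d d0.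
    exists d' => // s' s'1 ss' t t01; have [_ E'] := hlam s' s'1.
    have [||k' [f [f1 f2 f3 f4]]] := hd x (Ho s' a).
    + by rewrite m1 mdistxx.
    + by rewrite m2; apply: hd' => //; rewrite subrr normr0.
    rewrite E // E' //; rewrite -(geo_Va _ _ s' s'1 f1 f2 f3 t t01).
    exact: f4.
  - by move=> s /Hx[].
(* When the curve is a reparametrized geodesic [g], the initial segments of [g] form a lift of it,
   and the last of them is [g] itself. *)
have endp (s : R) k g (p : R -> R) : 0 <= s <= 1 -> geo L k g -> continuous p ->
    (forall t, 0 < t <= 1 -> 0 < p t <= 1) -> p 1 = 1 -> g 0 = x ->
    (forall t, 0 <= t <= 1 -> Ho s t = g (p t)) -> eq01 (lam s 1) g.
  move=> s01 gg cp pp pe gx E; have [l1 l2] := hlam s s01.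
  pose mu t u := g (affine 0 (p t) u).
  have -> : g = mu 1 by apply/funext => u; rewrite /mu pe /affine subr0 mulr1 add0r.
  have gmu t : 0 < t -> t <= 1 -> geo L (k * (p t - 0)) (mu t).
    move=> t0 t1; have /andP[h1 h2] : 0 < p t <= 1 by apply: pp; rewrite t0.
    exact: (geo_sub gg).
  apply: (@lift_uniq _ _ _ H x (Ho s) a 1 (lam s) mu a1 l1).
    split=> [t /andP[ta t1]|t /andP[ta t1] e e0].
      have t0 : 0 < t by exact: lt_le_trans ta.
      split; first by exists (k * (p t - 0)); exact: gmu.
        by rewrite /mu affine0.
      by rewrite /mu affine1 E // t1 ltW.
    have [cg _ _] := gg.
    have [w w01|d d0 hd] := @interval_uniform R 0 1 (fun u v => mdist (g u) (g v) < e).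
      have e2 : 0 < e / 2 by rewrite divr_gt0.
      have [d d0 hd] := proj1 (continuousP_dist g) cg w (e / 2) e2.
      exists d => // u v _ _ /hd hu /hd hv.
      have := metric_triangle (g u) (g w) (g v).
      by rewrite [mdist (g u) (g w)]metric_sym; lra.
    have := proj1 (@cvgrPdist_lt _ _ _ _ _ p (p t)) (cp t) d d0.
    case=> q /= q0 hq; exists q => // t' /andP[t'a t'1] tt' u /andP[u0 u1].
    have t0 : 0 < t by exact: lt_le_trans ta.
    have t'0 : 0 < t' by exact: lt_le_trans t'a.
    have /andP[P1 P2] : 0 < p t <= 1 by apply: pp; rewrite t0.
    have /andP[P1' P2'] : 0 < p t' <= 1 by apply: pp; rewrite t'0.
    have dp : `|p t - p t'| < d by apply: hq; rewrite /ball_ /= distrC.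
    rewrite /mu /affine !subr0 !add0r; apply: hd.
    - by apply/andP; split; [apply: mulr_ge0 => //; exact: ltW|apply: mulr_ile1 => //; exact: ltW].
    - by apply/andP; split; [apply: mulr_ge0 => //; exact: ltW|apply: mulr_ile1 => //; exact: ltW].
    - rewrite -mulrBr normrM ger0_norm //.
      by apply: le_lt_trans dp; rewrite ler_piMl.
  move=> u u01; rewrite l2 //.
  have -> : mu a u = (kt s).2 u => //.
  apply: (geo_Va _ _ s s01 (gmu a a0 a1)) => //; first by rewrite /mu affine0.
  by rewrite /mu affine1 E.
have e0 := endp 0 _ _ _ z01 gg0 cp0 (fun t ht => (p01 t ht).1) p0e g0x
  (fun t ht => (HE t ht).1).
have e1 := endp 1 _ _ _ o01 gg1 cp1 (fun t ht => (p01 t ht).2) p1e g1x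
  (fun t ht => (HE t ht).2).
by move=> t t01; rewrite -e0 // -e1 // mon.
Qed.

Lemma timelike_curve_geo x y c : continuous c -> c 0 = x -> c 1 = y ->
  (forall s t, 0 <= s -> s < t -> t <= 1 -> ch (c s) (c t)) ->
  exists k g, [/\ geo L k g, g 0 = x & g 1 = y].
Proof.
move=> cc c0 c1 cm.
have [V [gV Vx _]] := cst_good H x ltr01.
have [r r0 hr] := good_nbhs gV Vx.
have [d d0 hd] := proj1 (continuousP_dist c) cc 0 r r0.
pose a := Num.min (d / 2) 1.
have a0 : 0 < a by rewrite lt_min divr_gt0 //=.
have a1 : a <= 1 by rewrite ge_min lexx orbT.
have ad : a <= d / 2 by rewrite ge_min lexx.
have Va : V (c a).
  by apply: hr; rewrite -c0; apply: hd; rewrite subr0 ger0_norm ?ltW //; lra.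
have cha : ch x (c a) by rewrite -c0; apply: cm.
have [k [f [fm f0 f1]]] := good_ex gV Vx Va cha.
have [|lam [[l1 _] _]] := lift_exists H a1 cc _ (tmax_geo fm) f0 f1.
  move=> s t as_ st t1; have [->|nst] := eqVneq s t; first exact: (ca_refl H).
  apply/(ch_ca H)/cm => //; first exact: le_trans (ltW a0) as_.
  by rewrite lt_def eq_sym nst.
have [|[k' g'] g0 g1] := l1 1; first by rewrite a1 lexx.
by exists k', (lam 1); split; rewrite ?g1.
Qed.

End Monodromy.

(** * Lengths of causal curves and global concavity *)

Section PartitionSums.
Context {R : realType} {X : metricType R}.
Implicit Types (L : causal_data X) (g : R -> X) (a b : R) (s : seq R).

Fixpoint psum L g a s : \bar R :=
  if s is x :: s' then (tau L (g a) (g x) + psum L g x s')%E else 0%E.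

Lemma psumE L g a b s :
  (let p := g \o nth b (a :: s) in
    \sum_(0 <= i < size s) tau L (p i) (p i.+1))%E = psum L g a s.
Proof.
elim: s a => [|x s IH] a /=; first by rewrite big_nil.
by rewrite big_nat_recl //= -IH.
Qed.

Lemma psum_cat L g a s t : psum L g a (s ++ t) = (psum L g a s + psum L g (last a s) t)%E.
Proof. by elim: s a => [|x s IH] a /=; rewrite ?add0e // IH addeA. Qed.

Lemma tau_length_le L a b g s : itv_partition a b s ->
  (tau_length L a b g <= psum L g a s)%E.
Proof. by move=> ps; apply: ereal_inf_lbound; exists s => //; exact: psumE. Qed.

Lemma tau_length_ge L a b g (l : \bar R) :
  (forall s, itv_partition a b s -> (l <= psum L g a s)%E) ->
  (l <= tau_length L a b g)%E.
Proof.
by move=> h; apply: le_ereal_inf_tmp => _ [s ps <-]; rewrite psumE; exact: h.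
Qed.

End PartitionSums.

Section Global.
Context {R : realType} {X : metricType R} {L : causal_data X}.
Hypothesis H : concave_spacetime L.
Implicit Types (V : set X) (g h c : R -> X) (k m : R).

Local Notation ch := (chron L).
Local Notation ca := (caus L).
Local Notation T := (tf L).

Hypothesis hex : forall x y, ch x y -> exists k g, [/\ geo L k g, g 0 = x & g 1 = y].
Hypothesis huniq : forall k m g h, geo L k g -> geo L m h -> g 0 = h 0 ->
  g 1 = h 1 -> eq01 g h.

Lemma geo_vary k g e : geo L k g -> 0 < e -> exists2 d, 0 < d & forall k' g',
  geo L k' g' -> mdist (g 0) (g' 0) < d -> mdist (g 1) (g' 1) < d -> uclose e g' g.
Proof.
move=> gg e0; have [d d0 hd] := local_existence H gg e0.
exists d => // k' g' gg' h0 h1.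
have [k2 [f [f1 f2 f3 f4]]] := hd _ _ h0 h1.
by move=> t t01; rewrite -(huniq f1 gg' f2 f3 t01); exact: f4.
Qed.

(** The speed is read off a short initial piece, whose ends lie in a good set where tau is
    continuous. *)
Lemma len_vary k g e : geo L k g -> 0 < e -> exists2 d, 0 < d & forall k' g',
  geo L k' g' -> mdist (g 0) (g' 0) < d -> mdist (g 1) (g' 1) < d -> `|k - k'| < e.
Proof.
move=> gg e0; have [V [gV V0 _]] := cst_good H (g 0) ltr01.
have [cg _ _] := gg.
have [r r0 hr] := good_nbhs gV V0.
have [d1 d10 hd1] := proj1 (continuousP_dist g) cg 0 r r0.
pose s := Num.min (d1 / 2) 1.
have s0 : 0 < s by rewrite lt_min divr_gt0 //=.
have s1 : s <= 1 by rewrite ge_min lexx orbT.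
have sd : s <= d1 / 2 by rewrite ge_min lexx.
have s01 : 0 <= s <= 1 by rewrite ltW.
have z01 : 0 <= (0 : R) <= 1 by rewrite lexx ler01.
have Vs : V (g s) by apply/hr/hd1; rewrite subr0 ger0_norm ?ltW //; lra.
have es0 : 0 < e * s by rewrite mulr_gt0.
have [q q0 hq] := good_cont gV V0 Vs es0.
have [r2 r20 hr2] := good_nbhs gV Vs.
have m0 : 0 < Num.min q (Num.min r r2) by rewrite !lt_min q0 r0.
have [d d0 hd] := geo_vary gg m0.
exists d => // k' g' gg' h0 h1; have cl := hd k' g' gg' h0 h1.
have := cl 0 z01; have := cl s s01; rewrite !lt_min.
move=> /andP[a1 /andP[a2 a3]] /andP[b1 /andP[b2 b3]].
have V0' : V (g' 0) by exact: hr.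
have Vs' : V (g' s) by exact: hr2.
have e1 := tmax_len (geo_sub_tmax H gV gg (lexx 0) s0 s1 V0 Vs).
have e2 := tmax_len (geo_sub_tmax H gV gg' (lexx 0) s0 s1 V0' Vs').
move: e1 e2; rewrite /= !affine0 !affine1 !subr0 => e1 e2.
have := hq _ _ b1 a1; rewrite e1 e2 -mulrBl normrM (ger0_norm (ltW s0)).
by rewrite ltr_pM2r.
Qed.

Lemma past_near p e : 0 < e -> exists2 q, ch q p & mdist p q < e.
Proof.
move=> e0; have [q qp] := cst_past H p; have [k [g [gg g0 g1]]] := hex qp.
have [cg _ _] := gg; have [d d0 hd] := proj1 (continuousP_dist g) cg 1 e e0.
pose s := Num.max (1 - d / 2) 0.
have s0 : 0 <= s by rewrite le_max lexx orbT.
have s1 : s < 1 by rewrite gt_max ltr01 andbT; lra.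
have sd : 1 - d / 2 <= s by rewrite le_max lexx.
exists (g s); first by rewrite -g1; apply: (geo_ch H gg).
by rewrite -g1; apply: hd; rewrite distrC ger0_norm; lra.
Qed.

(** The speed of the geodesic from the auxiliary vertex [p] to [c t] grows by at least tau of the
    increment of [c], so the partition sum telescopes. One partition suffices because length is an
    infimum. *)
Lemma curve_partition c a b p : a <= b ->
  (forall t, a <= t <= b -> forall e, 0 < e -> exists2 d, 0 < d & forall s,
     a <= s <= b -> `|s - t| < d -> mdist (c t) (c s) < e) ->
  (forall s t, a <= s -> s <= t -> t <= b -> ca (c s) (c t)) ->
  ch p (c a) -> forall k1 k2 g1 g2, geo L k1 g1 -> geo L k2 g2 ->
  g1 0 = p -> g2 0 = p -> g1 1 = c a -> g2 1 = c b ->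
  exists2 s, itv_partition a b s & (psum L c a s <= (k2 - k1)%:E)%E.
Proof.
move=> ab cc cm pa.
have chp t : a <= t <= b -> ch p (c t).
  by move=> /andP[at_ tb]; apply: (ch_ca_trans H pa); apply: cm.
apply: (interval_chain ab (P := fun s t => forall k1 k2 g1 g2, geo L k1 g1 ->
  geo L k2 g2 -> g1 0 = p -> g2 0 = p -> g1 1 = c s -> g2 1 = c t ->
  exists2 q, itv_partition s t q & (psum L c s q <= (k2 - k1)%:E)%E)).
  move=> s t r as_ st tr rb h1 h2 k1 k2 g1 g2 G1 G2 p1 p2 e1 e2.
  have tab : a <= t <= b by rewrite (le_trans as_ st) (le_trans tr).
  have [k [g [gg g0 gt]]] := hex (chp t tab).
  have [q1 P1 S1] := h1 _ _ _ _ G1 gg p1 g0 e1 gt.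
  have [q2 P2 S2] := h2 _ _ _ _ gg G2 g0 p2 gt e2.
  exists (q1 ++ q2); first exact: (itv_partition_cat P1 P2).
  have [_ /eqP lE] := P1; rewrite psum_cat lE.
  have -> : k2 - k1 = (k - k1) + (k2 - k) by ring.
  by rewrite EFinD; apply: leeD.
move=> t tab; have [k [g [gg g0 gt]]] := hex (chp t tab).
have [e e0 hM] := geo_len_mono H gg.
have [d d0 hd] := geo_vary gg e0.
have [V [gV Vt _]] := cst_good H (c t) ltr01; have [r r0 hr] := good_nbhs gV Vt.
have m0 : 0 < Num.min d r by rewrite lt_min d0.
have [q q0 hq] := cc t tab _ m0.
exists q => // s s' as_ ss' s'b hs hs' k1 k2 g1 g2 G1 G2 p1 p2 e1 e2.
have sab : a <= s <= b by rewrite as_ (le_trans ss').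
have s'ab : a <= s' <= b by rewrite s'b (le_trans as_).
have := hq s sab hs; have := hq s' s'ab hs'; rewrite !lt_min.
move=> /andP[a1 a2] /andP[b1 b2].
have [sE|nss] := eqVneq s s'.
  exists [::]; first by rewrite sE; split.
  rewrite /= lee_fin subr_ge0.
  have E : eq01 g1 g2 by apply: (huniq G1 G2); rewrite ?p1 ?e1 ?e2 ?sE.
  by rewrite (geo_len_eq G1 G2 E).
have lt12 : s < s' by rewrite lt_def eq_sym nss.
exists [:: s']; first exact: itv_partition1.
rewrite /= adde0 (tfE gV); [|exact: hr|exact: hr].
have cl1 : uclose e g1 g by apply: (hd _ _ G1); rewrite ?g0 ?p1 ?mdistxx ?gt ?e1.
have cl2 : uclose e g2 g by apply: (hd _ _ G2); rewrite ?g0 ?p2 ?mdistxx ?gt ?e2.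
have := hM _ _ _ _ G1 G2 cl1 cl2; rewrite p1 p2 e1 e2.
move=> /(_ erefl (cm s s' as_ ss' s'b)) h; rewrite lee_fin; lra.
Qed.

(** The vertex is moved slightly to the past of [c a], since geodesics from [c a] itself to nearby
    points of a causal curve need not exist. The difference [k2 - k1] is less than [k2], which tends
    to [k] as the vertex approaches [c a]. *)
Lemma tau_length_le_geo c a b k g : a <= b ->
  (forall t, a <= t <= b -> forall e, 0 < e -> exists2 d, 0 < d & forall s,
     a <= s <= b -> `|s - t| < d -> mdist (c t) (c s) < e) ->
  (forall s t, a <= s -> s <= t -> t <= b -> ca (c s) (c t)) ->
  geo L k g -> g 0 = c a -> g 1 = c b -> (tau_length L a b c <= k%:E)%E.
Proof.
move=> ab cc cm gg g0 g1; apply/lee_addgt0Pr => e e0.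
have [d d0 hd] := len_vary gg e0.
have [q qa qd] := past_near (c a) d0.
have chab : ch (c a) (c b) by rewrite -g0 -g1; apply: (geo_ch H gg).
have [k1 [g1' [G1 p1 e1]]] := hex qa.
have [k2 [g2 [G2 p2 e2]]] := hex (ch_trans H qa chab).
have [s ps hs] := curve_partition ab cc cm qa G1 G2 p1 p2 e1 e2.
apply: le_trans (tau_length_le _ _ ps) _; apply: (le_trans hs).
rewrite -EFinD lee_fin.
have := hd k2 g2 G2; rewrite g0 g1 p2 e2 mdistxx => /(_ qd d0).
have [_ k10 _] := G1; rewrite ltr_norml => /andP[? ?]; lra.
Qed.

Section LengthMetric.
Hypothesis htau : forall k g, geo L k g -> tau L (g 0) (g 1) = k%:E.

Lemma tau_fin x y : tau L x y \is a fin_num.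
Proof.
have [cxy|ncxy] := pselect (ch x y).
  by have [k [g [gg <- <-]]] := hex cxy; rewrite (htau gg).
suff -> : tau L x y = 0%E by [].
apply/eqP; rewrite eq_le (tau_nneg H) andbT leNgt; apply/negP.
by move=> /(tauP H).
Qed.

Lemma geo_tmax_global k g : geo L k g -> tmax L k g.
Proof.
move=> gg; have [cg k0 _] := gg; split=> // s t s0 st t1.
have [<-|nst] := eqVneq s t; first by rewrite (tauxx H) subrr mulr0.
have st' : s < t by rewrite lt_def eq_sym nst.
by have := htau (geo_sub gg s0 st' t1); rewrite /= affine0 affine1.
Qed.

(** The delicate case is a pair not chronologically related. If tau stayed at least [e] at pairs
    converging to it, the joining geodesics would have speeds at least [e] and a limit geodesic
    would join [x] to [y]. *)
Lemma tau_continuous x y e : 0 < e -> exists2 d, 0 < d & forall x' y',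
  mdist x x' < d -> mdist y y' < d -> `|T x y - T x' y'| < e.
Proof.
move=> e0; have [cxy|ncxy] := pselect (ch x y).
  have [k [g [gg g0 g1]]] := hex cxy.
  have [d d0 hd] := len_vary gg e0; have [r r0 hr] := cst_open H cxy.
  exists (Num.min d r); first by rewrite lt_min d0.
  move=> x' y'; rewrite !lt_min => /andP[x1 x2] /andP[y1 y2].
  have [k' [g' [gg' g0' g1']]] := hex (hr _ _ x2 y2).
  rewrite -g0 -g1 -g0' -g1' /tf (htau gg) (htau gg') /=.
  by apply: (hd k' g' gg'); rewrite ?g0 ?g1 ?g0' ?g1'.
have T0 : T x y = 0.
  apply/eqP; rewrite eq_le (tf_ge0 H) andbT leNgt; apply/negP.
  by move=> h; apply/ncxy/(tauP H); rewrite -(fineK (tau_fin x y)) lte_fin.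
apply: contrapT => hn.
have /choice[q hq] : forall n : nat, exists q : (X * X) * (R * (R -> X)),
    [/\ mdist x q.1.1 < n.+1%:R^-1, mdist y q.1.2 < n.+1%:R^-1,
      geo L q.2.1 q.2.2, e <= q.2.1 & q.2.2 0 = q.1.1 /\ q.2.2 1 = q.1.2].
  move=> n; apply: contrapT => hq; apply: hn.
  exists n.+1%:R^-1; first by rewrite invr_gt0.
  move=> x' y' xx' yy'; rewrite T0 sub0r normrN ger0_norm ?(tf_ge0 H) //.
  rewrite ltNge; apply/negP => eT; apply: hq.
  have c' : ch x' y'.
    apply/(tauP H); rewrite -(fineK (tau_fin x' y')) lte_fin.
    exact: lt_le_trans eT.
  have [k [g [gg g0 g1]]] := hex c'.
  exists ((x', y'), (k, g)); split => //=.
  by have := htau gg; rewrite g0 g1 -(fineK (tau_fin x' y')) => -[<-].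
have [F FU sF] := ultra_seq.
have FP : ProperFilter F by exact: ultra_proper.
have FF : Filter F by exact: filter_filter.
have small (f : nat -> X) p : (forall n, mdist p (f n) < n.+1%:R^-1) -> f @ F --> p.
  move=> hf; apply/metricType_numDomainType.cvgrPdist_lt => r r0.
  have : \forall n \near F, n.+1%:R^-1 < r.
    by apply: sF; exact: near_infty_natSinv_lt (PosNum r0).
  by apply: filterS => n; exact: lt_trans.
have cx : (fun n => (q n).1.1) @ F --> x by apply: small => n; case: (hq n).
have cy : (fun n => (q n).1.2) @ F --> y by apply: small => n; case: (hq n).
have [a ax] := cst_past H x; have [b yb] := cst_future H y.
have Fa : \forall n \near F, ch a (q n).1.1.
  by apply: (ch_near H ax _ cx); exact: cvg_cst.
have Fb : \forall n \near F, ch (q n).1.2 b.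
  by apply: (ch_near H yb cy); exact: cvg_cst.
have [n0 [a0 b0]] := filter_ex (filterI Fa Fb).
(* Compactness of geodesics is stated for families confined to a compact set at every index, so the
   indices outside a set of the ultrafilter are overwritten by a fixed one. *)
pose q' n := if pselect (ch a (q n).1.1 /\ ch (q n).1.2 b) then q n else q n0.
have q'E : \forall n \near F, q' n = q n.
  near=> n; rewrite /q'; case: pselect => // -[]; split; near: n.
    exact: Fa.
  exact: Fb.
have q'P n : [/\ geo L (q' n).2.1 (q' n).2.2, e <= (q' n).2.1,
    ch a ((q' n).2.2 0) & ch ((q' n).2.2 1) b].
  rewrite /q'; case: pselect => [[h1 h2]|?].
    by have [? ? g1 g2 [E1 E2]] := hq n; rewrite E1 E2.
  by have [? ? g1 g2 [E1 E2]] := hq n0; rewrite E1 E2.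
have [|||||k [g [gg _ gp _]]] := @geo_compact _ _ _ H _ F FU (fun n => (q' n).2.1)
   (fun n => (q' n).2.2) e (causal_diamond L a b).
- by move=> n; have [] := q'P n.
- by [].
- by move=> n; have [] := q'P n.
- exact: (cst_diamond H).
- move=> n t /andP[t0 t1]; have [g1 _ g2 g3] := q'P n; split.
    by apply: (ca_trans H (ch_ca H g2)); apply: (geo_ca H g1).
  by apply: (ca_trans H _ (ch_ca H g3)); apply: (geo_ca H g1).
apply: ncxy.
have z01 : 0 <= (0 : R) <= 1 by rewrite lexx ler01.
have o01 : 0 <= (1 : R) <= 1 by rewrite lexx ler01.
have -> : x = g 0.
  apply: (@cvg_unique _ (@metric_hausdorff R X) _ _ _ _ cx).
  apply: cvg_trans (gp 0 z01); apply: near_eq_cvg.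
  near=> n; have -> : q' n = q n by near: n; exact: q'E.
  by have [_ _ _ _ []] := hq n.
have -> : y = g 1.
  apply: (@cvg_unique _ (@metric_hausdorff R X) _ _ _ _ cy).
  apply: cvg_trans (gp 1 o01); apply: near_eq_cvg.
  near=> n; have -> : q' n = q n by near: n; exact: q'E.
  by have [_ _ _ _ []] := hq n.
exact: (geo_ch H gg).
Unshelve. all: by end_near. Qed.

Lemma triangle_start k m g h : geo L k g -> geo L m h -> g 0 = h 0 ->
  ch (g 1) (h 1) -> forall t, 0 <= t <= 1 ->
  ca (g t) (h t) /\ (t%:E * tau L (g 1%R) (h 1%R) <= tau L (g t) (h t))%E.
Proof.
move=> gg gh e0 c1 u u01.
have [l [c [gc c0 ce]]] := hex c1.
have x1 : ch (g 0) (g 1) by apply: (geo_ch H gg).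
have chx t : 0 <= t -> t <= 1 -> ch (g 0) (c t).
  by move=> t0 t1; apply: (ch_ca_trans H x1); rewrite -c0; apply: (geo_ca H gc).
have -> : tau L (g 1) (h 1) = l%:E by rewrite -c0 -ce (htau gc).
suff : forall k1 k2 g1 g2, geo L k1 g1 -> geo L k2 g2 -> g1 0 = g 0 ->
    g2 0 = g 0 -> g1 1 = c 0 -> g2 1 = c 1 ->
    ca (g1 u) (g2 u) /\ ((u * (l * (1 - 0)))%:E <= tau L (g1 u) (g2 u))%E.
  move=> /(_ _ _ _ _ gg gh erefl); rewrite -e0 c0 ce subr0 mulr1 -EFinM.
  exact.
apply: (interval_chain ler01 (P := fun s t => forall k1 k2 g1 g2, geo L k1 g1 ->
    geo L k2 g2 -> g1 0 = g 0 -> g2 0 = g 0 -> g1 1 = c s -> g2 1 = c t ->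
    ca (g1 u) (g2 u) /\ ((u * (l * (t - s)))%:E <= tau L (g1 u) (g2 u))%E)).
  move=> s t r s0 st tr r1 h1 h2 k1 k2 g1 g2 G1 G2 p1 p2 e1 e2.
  have t0 : 0 <= t by exact: le_trans st.
  have t1 : t <= 1 by exact: le_trans r1.
  have [k3 [g3 [G3 p3 e3]]] := hex (chx t t0 t1).
  have [C1 S1] := h1 _ _ _ _ G1 G3 p1 p3 e1 e3.
  have [C2 S2] := h2 _ _ _ _ G3 G2 p3 p2 e3 e2.
  split; first exact: (ca_trans H C1).
  apply: le_trans (tau_tri H C1 C2).
  have -> : u * (l * (r - s)) = u * (l * (t - s)) + u * (l * (r - t)) by ring.
  by rewrite EFinD; apply: leeD.
move=> t /andP[t0 t1]; have [k3 [g3 [G3 p3 e3]]] := hex (chx t t0 t1).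
have [e e0' hT] := thin_triangle H G3.
have [d d0 hd] := geo_vary G3 e0'.
have [cc _ _] := gc; have [q q0 hq] := proj1 (continuousP_dist c) cc t d d0.
exists q => // s s' s0 ss' s'1 hs hs' k1 k2 g1 g2 G1 G2 p1 p2 e1 e2.
have cl1 : uclose e g1 g3.
  by apply: (hd _ _ G1); rewrite ?p1 ?p3 ?mdistxx // e3 e1; apply: hq.
have cl2 : uclose e g2 g3.
  by apply: (hd _ _ G2); rewrite ?p2 ?p3 ?mdistxx // e3 e2; apply: hq.
have cs : ca (g1 1) (g2 1) by rewrite e1 e2; apply: (geo_ca H gc).
have e12 : g1 0 = g2 0 by rewrite p1 p2.
have [C1 S1] := hT _ _ _ _ G1 G2 cl1 cl2 e12 cs u u01.
split=> //; rewrite -(fineK (tau_fin _ _)) lee_fin -/(tf L _ _).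
apply: le_trans S1; have /andP[u0 u1] := u01; apply: ler_wpM2l => //.
rewrite e1 e2; have [_ htc] := geo_tau H gc s0 ss' s'1.
by rewrite -lee_fin /tf fineK // tau_fin.
Qed.

End LengthMetric.
End Global.

(** * Triangles with a common end and quadrilaterals *)

Section GlobalConcavity.
Context {R : realType} {X : metricType R} {L : causal_data X}.
Hypothesis H : concave_spacetime L.
Implicit Types (g h c : R -> X) (k m : R).
Hypothesis hex : forall x y, chron L x y ->
  exists k g, [/\ geo L k g, g 0 = x & g 1 = y].
Hypothesis huniq : forall k m g h, geo L k g -> geo L m h -> g 0 = h 0 ->
  g 1 = h 1 -> eq01 g h.
Hypothesis htau : forall k g, geo L k g -> tau L (g 0) (g 1) = k%:E.

Lemma rev_curve0 g : rev_curve g 0 = g 1.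
Proof. by rewrite /rev_curve subr0. Qed.
Lemma rev_curve1 g : rev_curve g 1 = g 0.
Proof. by rewrite /rev_curve subrr. Qed.

Lemma triangle_end k m g h : geo L k g -> geo L m h -> g 1 = h 1 ->
  chron L (g 0) (h 0) -> forall t, 0 <= t <= 1 ->
  caus L (g t) (h t) /\
  ((1 - t)%:E * tau L (g 0%R) (h 0%R) <= tau L (g t) (h t))%E.
Proof.
move=> gg gh e1 c0 t /andP[t0 t1].
have H' := concave_spacetime_dual H.
have back k' g' : geo (time_dual L) k' g' -> geo L k' (rev_curve g').
  by move=> /geo_dual; rewrite time_dualK.
have [||||||||C S] := @triangle_start _ _ _ H' _ _ _ m k (rev_curve h) (rev_curve g)
   _ _ _ _ (1 - t).
- move=> x y /hex[k' [g' [G p q]]]; exists k', (rev_curve g').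
  by split; [exact: geo_dual|rewrite rev_curve0|rewrite rev_curve1].
- move=> k1 k2 g1 g2 /back G1 /back G2 p q s s01.
  have := huniq G1 G2; rewrite !rev_curve0 !rev_curve1 => /(_ q p (1 - s)).
  have -> : rev_curve g1 (1 - s) = g1 s by rewrite /rev_curve; congr g1; ring.
  have -> : rev_curve g2 (1 - s) = g2 s by rewrite /rev_curve; congr g2; ring.
  by apply; case/andP: s01 => ? ?; apply/andP; split; lra.
- move=> k' g' /back/htau; by rewrite rev_curve0 rev_curve1.
- exact: geo_dual.
- exact: geo_dual.
- by rewrite !rev_curve0.
- by rewrite !rev_curve1.
- by apply/andP; split; lra.
have tE : 1 - (1 - t) = t by ring.
by move: C S; rewrite /= !rev_curve1 /rev_curve tE.
Qed.

Lemma global_quad k m g h : geo L k g -> geo L m h ->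
  chron_eq L (g 0) (h 0) -> chron_eq L (g 1) (h 1) -> forall t, 0 <= t <= 1 ->
  (t%:E * tau L (g 1%R) (h 1%R) + (1 - t)%:E * tau L (g 0%R) (h 0%R)
    <= tau L (g t) (h t))%E.
Proof.
move=> gg gh [c0|e0] [c1|e1] t t01.
- have x1 : chron L (g 0) (h 1) by apply: (ch_trans H c0); apply: (geo_ch H gh).
  have [l [d [gd d0 d1]]] := hex x1.
  have [|C1 S1] := triangle_start H hex huniq htau gg gd (esym d0) _ t01.
    by rewrite d1.
  have [|C2 S2] := triangle_end gd gh d1 _ t01; first by rewrite d0.
  rewrite d1 in S1; rewrite d0 in S2.
  by apply: le_trans (tau_tri H C1 C2); apply: leeD.
- have [_ S] := triangle_end gg gh e1 c0 t01.
  by rewrite {1}e1 (tauxx H) mule0 add0e.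
- have [_ S] := triangle_start H hex huniq htau gg gh e0 c1 t01.
  by rewrite {1}e0 (tauxx H) mule0 adde0.
- rewrite {1}e0 {1}e1 !(tauxx H) !mule0 adde0; exact: (tau_nneg H).
Qed.

End GlobalConcavity.

(** * Reparametrization of curves *)

Section EpsilonContinuity.
Context {R : realType}.
Implicit Types (a b c d m t e : R) (phi : R -> R).

(** Continuity relative to [a, b], with the distance as a parameter so that curves in [X] and
    changes of parameter obey the same lemmas. *)
Definition econt (Y : Type) (D : Y -> Y -> R) a b (f : R -> Y) : Prop :=
  forall t, a <= t <= b -> forall e, 0 < e -> exists2 d, 0 < d &
    forall s, a <= s <= b -> `|s - t| < d -> D (f t) (f s) < e.

Definition adist (x y : R) : R := `|x - y|.

Lemma within_econt a b phi :
  {within `[a, b], continuous phi} <-> econt adist a b phi.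
Proof.
rewrite subspace_continuousP; split=> [cf t tab e e0|cf t /= tab].
  have tab' : t \in `[a, b] by rewrite in_itv.
  have := cf t tab' => /cvgrPdist_lt/(_ e e0).
  rewrite near_withinE => -[d /= d0 hd]; exists d => // s sab st.
  by apply: hd; rewrite /= ?in_itv // distrC.
rewrite in_itv /= in tab.
apply/cvgrPdist_lt => e e0; have [d d0 hd] := cf t tab e e0.
rewrite near_withinE; exists d => //= s /= st; rewrite in_itv /= => sab.
by apply: hd => //; rewrite distrC.
Qed.

Lemma econt_comp Y (D : Y -> Y -> R) a b c d f phi :
  econt D c d f -> econt adist a b phi ->
  (forall t, a <= t <= b -> c <= phi t <= d) -> econt D a b (f \o phi).
Proof.
move=> cf cphi ab t tab e e0.
have [r r0 hr] := cf (phi t) (ab t tab) e e0.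
have [q q0 hq] := cphi t tab r r0; exists q => // s sab st.
by apply: hr; [exact: ab|rewrite distrC; exact: hq].
Qed.

Lemma econt_sub Y (D : Y -> Y -> R) a b c d f : a <= c -> d <= b ->
  econt D a b f -> econt D c d f.
Proof.
move=> ac db cf t /andP[ct td] e e0.
have tab : a <= t <= b by rewrite (le_trans ac ct) (le_trans td db).
have [r r0 hr] := cf t tab e e0.
by exists r => // s /andP[cs sd]; apply: hr; rewrite (le_trans ac cs) (le_trans sd db).
Qed.

Lemma econt_glue Y (D : Y -> Y -> R) a m b f g : econt D a m f -> econt D m b g ->
  f m = g m -> econt D a b (fun t => if t <= m then f t else g t).
Proof.
move=> cf cg fg t /andP[at_ tb] e e0.
have [tm|mt|tm] := ltgtP t m.
- have tam : a <= t <= m by rewrite at_ ltW.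
  have [r r0 hr] := cf t tam e e0.
  exists (Num.min r (m - t)); first by rewrite lt_min r0 subr_gt0.
  move=> s /andP[as_ sb]; rewrite lt_min => /andP[sr sm].
  have sm' : s <= m by move: sm; rewrite ltr_norml => /andP[]; lra.
  by rewrite sm'; apply: hr; rewrite // as_.
- have tmb : m <= t <= b by rewrite tb ltW.
  have [r r0 hr] := cg t tmb e e0.
  exists (Num.min r (t - m)); first by rewrite lt_min r0 subr_gt0.
  move=> s /andP[as_ sb]; rewrite lt_min => /andP[sr sm].
  have sm' : m < s by move: sm; rewrite ltr_norml => /andP[]; lra.
  by rewrite leNgt sm' /=; apply: hr; rewrite // sb ltW.
- have t1 : a <= t <= m by rewrite at_ tm lexx.
  have t2 : m <= t <= b by rewrite tb tm lexx.
  have [r r0 hr] := cf t t1 e e0; have [q q0 hq] := cg t t2 e e0.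
  exists (Num.min r q); first by rewrite lt_min r0.
  move=> s /andP[as_ sb]; rewrite lt_min => /andP[sr sq].
  case: (leP s m) => sm; first by apply: hr; rewrite // as_.
  have -> : f t = g t by rewrite tm.
  by apply: hq; rewrite // sb ltW.
Qed.

Lemma econt_affine a b c d : econt adist c d (affine a b).
Proof.
move=> t _ e e0; have := @affine_continuous _ a b t.
move=> /cvgrPdist_lt/(_ e e0)[r /= r0 hr].
by exists r => // s _ st; apply: hr; rewrite /= distrC.
Qed.

Lemma econt_id a b : econt adist a b id.
Proof. by move=> t _ e e0; exists e => // s _; rewrite /adist distrC. Qed.

Lemma econt_onto a b c d phi : a <= b -> c <= d -> econt adist a b phi -> phi a = c ->
  phi b = d -> forall v, c <= v <= d -> exists2 u, a <= u <= b & phi u = v.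
Proof.
move=> ab cd /within_econt cphi pa pb v vcd.
have vb : Num.min (phi a) (phi b) <= v <= Num.max (phi a) (phi b).
  by rewrite pa pb (min_idPl cd) (max_idPr cd).
have [u] := IVT ab cphi vb.
by rewrite in_itv /= => uab ?; exists u.
Qed.

(** Normalizes a strictly increasing potential: [psi] is [F] rescaled to [0, 1] and [kappa] its
    inverse. With [F] the accumulated tau along a curve, [kappa] is the constant-speed
    parametrization. *)
Lemma param_inverse a b (F : R -> R) : a < b ->
  (forall s t, a <= s -> s < t -> t <= b -> F s < F t) -> econt adist a b F ->
  exists kappa psi,
    [/\ econt adist 0 1 kappa, forall t, 0 <= t <= 1 -> a <= kappa t <= b,
        forall s t, 0 <= s -> s <= t -> t <= 1 -> kappa s <= kappa t,
        kappa 0 = a /\ kappa 1 = b &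
        forall t, 0 <= t <= 1 -> F (kappa t) = F a + t * (F b - F a)] /\
    [/\ econt adist a b psi, forall t, a <= t <= b -> 0 <= psi t <= 1,
        forall s t, a <= s -> s <= t -> t <= b -> psi s <= psi t,
        psi a = 0 /\ psi b = 1 &
        forall t, a <= t <= b -> kappa (psi t) = t /\ F t = F a + psi t * (F b - F a)].
Proof.
move=> ab Fm Fc.
have Fw s t : a <= s -> s <= t -> t <= b -> F s <= F t.
  by move=> as_; rewrite le_eqVlt => /orP[/eqP->//|st tb]; apply/ltW/Fm.
have Fr s t : a <= s <= b -> a <= t <= b -> F s <= F t -> s <= t.
  move=> /andP[as_ sb] /andP[at_ tb]; rewrite leNgt => h.
  by rewrite leNgt; apply: contra h => ts; exact: Fm.
have Fab : F a < F b by apply: Fm.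
have FAB : 0 < F b - F a by rewrite subr_gt0.
have /choice[kappa0 hk0] : forall t, exists u, 0 <= t <= 1 ->
    a <= u <= b /\ F u = F a + t * (F b - F a).
  move=> t; have [t01|n] := boolP (0 <= t <= 1); last by exists 0.
  have [u uab Fu] := econt_onto (ltW ab) (ltW Fab) Fc erefl erefl (affine_itv (ltW Fab) t01).
  by exists u.
have hk t (t01 : 0 <= t <= 1) := (hk0 t t01).1.
have hF t (t01 : 0 <= t <= 1) := (hk0 t t01).2.
have km s t : 0 <= s -> s <= t -> t <= 1 -> kappa0 s <= kappa0 t.
  move=> s0 st t1.
  have s01 : 0 <= s <= 1 by rewrite s0 (le_trans st).
  have t01 : 0 <= t <= 1 by rewrite t1 (le_trans s0).
  by apply: Fr; [exact: hk|exact: hk|rewrite !hF // lerD2l ler_pM2r].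
have inj s t : a <= s <= b -> a <= t <= b -> F s = F t -> s = t.
  by move=> hs ht e; apply/eqP; rewrite eq_le; apply/andP; split; apply: Fr => //; rewrite e.
have z01 : 0 <= (0 : R) <= 1 by rewrite lexx ler01.
have o01 : 0 <= (1 : R) <= 1 by rewrite lexx ler01.
have aab : a <= a <= b by rewrite lexx ltW.
have bab : a <= b <= b by rewrite lexx ltW.
pose psi t := (F t - F a) / (F b - F a).
have psi01 t : a <= t <= b -> 0 <= psi t <= 1.
  move=> /andP[at_ tb]; rewrite /psi divr_ge0 ?(ltW FAB) ?subr_ge0 ?Fw //=.
  by rewrite ler_pdivrMr // mul1r lerD2r Fw.
have psiE t : F t = F a + psi t * (F b - F a).
  by rewrite /psi divfK ?gt_eqF // addrC subrK.
exists kappa0, psi; split; split=> //.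
- move=> t t01 e e0; have uab := hk t t01; have /andP[u1 u2] := uab.
  have [d1 d10 h1] : exists2 d, 0 < d & forall s, 0 <= s <= 1 -> `|s - t| < d ->
      kappa0 t - e < kappa0 s.
    have [le|gt] := ltP (kappa0 t - e) a.
      by exists 1 => // s /hk/andP[h _] _; exact: lt_le_trans h.
    have lt : F (kappa0 t - e) < F (kappa0 t) by apply: Fm => //; lra.
    exists ((F (kappa0 t) - F (kappa0 t - e)) / (F b - F a)); first by rewrite divr_gt0 ?subr_gt0.
    move=> s s01; rewrite ltr_pdivlMr // => hs; rewrite ltNge; apply/negP => hle.
    have /andP[a1 a2] := hk s s01.
    have hFle : F (kappa0 s) <= F (kappa0 t - e) by apply: Fw => //; lra.
    move: hFle hs; rewrite (hF _ s01) (hF t t01) => hFle; apply/negP; rewrite -leNgt.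
    have : - (s - t) * (F b - F a) <= `|s - t| * (F b - F a).
      by rewrite ler_pM2r // -normrN ler_norm.
    by move=> ?; lra.
  have [d2 d20 h2] : exists2 d, 0 < d & forall s, 0 <= s <= 1 -> `|s - t| < d ->
      kappa0 s < kappa0 t + e.
    have [le|gt] := ltP b (kappa0 t + e).
      by exists 1 => // s /hk/andP[_ h] _; exact: le_lt_trans h _.
    have lt : F (kappa0 t) < F (kappa0 t + e) by apply: Fm => //; lra.
    exists ((F (kappa0 t + e) - F (kappa0 t)) / (F b - F a)); first by rewrite divr_gt0 ?subr_gt0.
    move=> s s01; rewrite ltr_pdivlMr // => hs; rewrite ltNge; apply/negP => hle.
    have /andP[a1 a2] := hk s s01.
    have hFle : F (kappa0 t + e) <= F (kappa0 s) by apply: Fw => //; lra.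
    move: hFle hs; rewrite (hF _ s01) (hF t t01) => hFle; apply/negP; rewrite -leNgt.
    have : (s - t) * (F b - F a) <= `|s - t| * (F b - F a).
      by rewrite ler_pM2r // ler_norm.
    by move=> ?; lra.
  exists (Num.min d1 d2); first by rewrite lt_min d10.
  move=> s s01; rewrite lt_min => /andP[/h1-/(_ s01) ? /h2-/(_ s01) ?].
  by rewrite /adist ltr_norml; apply/andP; split; lra.
- split; apply: inj; rewrite ?hF ?hk //; first by rewrite mul0r addr0.
  by rewrite mul1r addrC subrK.
- move=> t tab e e0; have [d d0 hd] := Fc t tab (e * (F b - F a)) (mulr_gt0 e0 FAB).
  exists d => // s sab st; have := hd s sab st; rewrite /adist /psi -mulrBl.
  rewrite normrM [`|(_ - _)^-1|]gtr0_norm ?invr_gt0 // ltr_pdivrMr //.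
  by rewrite opprB addrA subrK.
- by move=> s t as_ st tb; rewrite /psi ler_pM2r ?invr_gt0 // lerD2r Fw.
- by rewrite /psi subrr mul0r divff // gt_eqF.
- move=> t tab; split=> //; apply: inj => //; first exact/hk/psi01.
  by rewrite hF ?psi01 // -psiE.
Qed.

End EpsilonContinuity.

(** * Lipschitz timelike curves up to reparametrization, and potentials for tau along a curve *)

Section Chronological.
Context {R : realType} {X : metricType R}.
Implicit Types (L : causal_data X) (g h : R -> X) (f : R -> R) (a b c d m s t k : R).

Definition lipschitz_itv k a b g : Prop := 0 <= k /\
  forall s t, a <= s -> s <= t -> t <= b -> mdist (g s) (g t) <= k * (t - s).

Lemma locally_lipschitz_itv a b g : a <= b -> locally_lipschitz `[a, b] g ->
  exists k, lipschitz_itv k a b g.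
Proof.
move=> ab lg; apply: (interval_chain ab (P := fun a b => exists k, lipschitz_itv k a b g)).
  move=> s t r _ st tr _ [k [k0 hk]] [m [m0 hm]]; exists (k + m); split; first lra.
  move=> u v su uv vr.
  have [ut|tu] := leP u t; last by have := hm u v (ltW tu) uv vr; nra.
  have [vt|tv] := leP v t; first by have := hk u v su uv vt; nra.
  have := hk u t su ut (lexx t); have := hm t v (lexx t) (ltW tv) vr.
  by have := metric_triangle (g u) (g t) (g v); nra.
move=> t tab; have [|e [k [e0 hk]]] := lg t; first by rewrite /= in_itv.
exists e => // s s' as_ ss' s'b se s'e; exists `|k|; split=> // u v su uv vs'.
have inb w : s <= w -> w <= s' -> [set` `[a, b]] w /\ ball t e w.
  move=> sw ws'; split; first by rewrite /= in_itv /=; apply/andP; split; lra.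
  rewrite /ball /= distrC ltr_norml.
  by move: se s'e; rewrite !ltr_norml => /andP[? ?] /andP[? ?]; apply/andP; split; lra.
have [u1 u2] := inb u su (le_trans uv vs'); have [v1 v2] := inb v (le_trans su uv) vs'.
apply: le_trans (hk u v u1 v1 u2 v2) _; rewrite distrC ger0_norm ?subr_ge0 //.
by rewrite ler_wpM2r ?subr_ge0 // ler_norm.
Qed.

Lemma lipschitz_itv_locally k a b g : lipschitz_itv k a b g ->
  locally_lipschitz `[a, b] g.
Proof.
move=> [k0 hk] t _; exists 1, k; split=> // s u; rewrite /= !in_itv /=.
move=> /andP[as_ sb] /andP[au ub] _ _.
have [su|us] := leP s u; first by rewrite (distrC s) ger0_norm ?subr_ge0 //; exact: hk.
by rewrite metric_sym ger0_norm ?subr_ge0 ?(ltW us) //; apply: hk => //; exact: ltW.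
Qed.

Lemma lipschitz_itv_econt k a b g : lipschitz_itv k a b g -> econt (@mdist R X) a b g.
Proof.
move=> [k0 hk] t /andP[at_ tb] e e0; exists (e / (k + 1)); first by rewrite divr_gt0 //; lra.
move=> s /andP[as_ sb]; rewrite ltr_pdivlMr; last lra.
have [st|ts] := leP s t.
  rewrite distrC ger0_norm ?subr_ge0 // metric_sym => h.
  by apply: le_lt_trans (hk s t as_ st tb) _; nra.
rewrite ger0_norm ?subr_ge0 ?ltW // => h.
by apply: le_lt_trans (hk t s at_ (ltW ts) sb) _; nra.
Qed.

Lemma directed_curve_lt (r : X -> X -> Prop) a b g : directed_curve r `[a, b] g -> a < b.
Proof.
move=> [_ [s [t [/=]]]]; rewrite !in_itv /= => /andP[as_ sb] /andP[at_ tb] gst _ _.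
rewrite lt_neqAle (le_trans as_ sb) andbT; apply/eqP => ab; apply: gst.
by have -> : s = t by apply/eqP; rewrite eq_le; apply/andP; split; lra.
Qed.

Lemma directed_curve_econt (r : X -> X -> Prop) a b g :
  directed_curve r `[a, b] g -> econt (@mdist R X) a b g.
Proof.
move=> dg; have ab := directed_curve_lt dg; have [_ _ lg _] := dg.
have [k hk] := locally_lipschitz_itv (ltW ab) lg; exact: lipschitz_itv_econt hk.
Qed.

Lemma directed_curveP (r : X -> X -> Prop) a b g s t :
  directed_curve r `[a, b] g -> a <= s -> s < t -> t <= b -> r (g s) (g t).
Proof.
move=> [_ _ _ h] as_ st tb; apply: h => //=; rewrite in_itv /=.
  by rewrite as_ ltW // (lt_le_trans st).
by rewrite tb ltW // (le_lt_trans as_).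
Qed.

Lemma directed_curve_itv (r : X -> X -> Prop) k a b g : a < b -> g a <> g b ->
  lipschitz_itv k a b g ->
  (forall s t, a <= s -> s < t -> t <= b -> r (g s) (g t)) ->
  directed_curve r `[a, b] g.
Proof.
move=> ab gab lg rg; split.
- exact: interval_is_interval.
- by exists a, b; rewrite /= !in_itv /= !lexx ltW.
- exact: lipschitz_itv_locally lg.
- move=> s t; rewrite /= !in_itv /= => /andP[as_ sb] /andP[at_ tb] st; exact: rg.
Qed.

(* [g] is a reparametrization of a Lipschitz timelike curve [h] with the same
   parameter interval, so that pieces can be glued without shifting parameters. *)
Definition ltl L a b g : Prop := exists h phi k,
  [/\ lipschitz_itv k a b h,
      forall s t, a <= s -> s < t -> t <= b -> chron L (h s) (h t),
      econt adist a b phi,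
      forall s t, a <= s -> s <= t -> t <= b -> phi s <= phi t &
      [/\ phi a = a, phi b = b & forall t, a <= t <= b -> g t = h (phi t)]].

Lemma ltl_refl L a g : ltl L a a g.
Proof.
have E (s : R) : a <= s -> s <= a -> s = a by move=> *; apply/eqP; rewrite eq_le; apply/andP.
exists g, id, 0; split=> //; last exact: econt_id.
  split=> // s t as_ st ta.
  have -> := E s as_ (le_trans st ta); have -> := E t (le_trans as_ st) ta.
  by rewrite mdistxx subrr mulr0.
by move=> s t as_ st ta; have := lt_le_trans st ta; rewrite ltNge as_.
Qed.

Lemma ltl_cat L a m b g : causal_spacetime L -> a <= m -> m <= b ->
  ltl L a m g -> ltl L m b g -> ltl L a b g.
Proof.
move=> C am mb [h1 [p1 [k1 [[k10 l1] c1 e1 m1 [pa pm g1]]]]].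
move=> [h2 [p2 [k2 [[k20 l2] c2 e2 m2 [qm qb g2]]]]].
have mam : a <= m <= m by rewrite am lexx.
have mmb : m <= m <= b by rewrite lexx.
have hm : h1 m = h2 m by rewrite -[in LHS]pm -(g1 _ mam) (g2 _ mmb) qm.
pose h u := if u <= m then h1 u else h2 u.
pose p u := if u <= m then p1 u else p2 u.
have p1m t : a <= t -> t <= m -> p1 t <= m by move=> at_ tm; rewrite -pm; apply: m1.
have p2m t : m <= t -> t <= b -> m <= p2 t by move=> mt tb; rewrite -{1}qm; apply: m2.
exists h, p, (k1 + k2); split.
- split; first by rewrite addr_ge0.
  move=> s t as_ st tb; rewrite /h; case: (leP s m) => sm; case: (leP t m) => tm.
  + by have := l1 s t as_ st tm; nra.
  + have := l1 s m as_ sm (lexx m); have := l2 m t (lexx m) (ltW tm) tb.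
    by rewrite -hm => ? ?; have := metric_triangle (h1 s) (h1 m) (h2 t); nra.
  + by have := le_lt_trans st (le_lt_trans tm sm); rewrite ltxx.
  + by have := l2 s t (ltW sm) st tb; nra.
- move=> s t as_ st tb; rewrite /h; case: (leP s m) => sm; case: (leP t m) => tm.
  + exact: c1.
  + have h2' : chron L (h1 m) (h2 t) by rewrite hm; apply: c2.
    have [->//|ns] := eqVneq s m.
    by apply: (ch_trans C _ h2'); apply: c1 => //; rewrite lt_neqAle ns.
  + by have := lt_trans st (le_lt_trans tm sm); rewrite ltxx.
  + by apply: c2 => //; exact: ltW.
- by apply: econt_glue => //; rewrite pm qm.
- move=> s t as_ st tb; rewrite /p; case: (leP s m) => sm; case: (leP t m) => tm.
  + exact: m1.
  + by apply: le_trans (p1m s as_ sm) _; apply: p2m => //; exact: ltW.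
  + by have := le_lt_trans st (le_lt_trans tm sm); rewrite ltxx.
  + by apply: m2 => //; exact: ltW.
- split.
  + by rewrite /p am.
  + by rewrite /p; case: (leP b m) => // bm; have -> : b = m by apply/eqP; rewrite eq_le bm.
  + move=> t /andP[at_ tb]; rewrite /h /p; case: (leP t m) => tm.
      by rewrite p1m // g1 // at_.
    have mp := p2m t (ltW tm) tb; rewrite g2; last by rewrite tb ltW.
    case: (leP (p2 t) m) => // pm'.
    by have -> : p2 t = m by apply/eqP; rewrite eq_le pm'.
Qed.

Lemma ltl_reparam L a b c d g h : c < d -> future_timelike L `[a, b] h ->
  reparametrization c d g a b h -> ltl L c d g.
Proof.
move=> cd th [phi [/within_econt cp pm pc pd gE]].
have ab := directed_curve_lt th; have [_ _ lh _] := th.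
have [k [k0 hk]] := locally_lipschitz_itv (ltW ab) lh.
have cd' : 0 < d - c by rewrite subr_gt0.
have ab' : 0 < b - a by rewrite subr_gt0.
pose r u := a + (u - c) / (d - c) * (b - a).
pose q u := c + (phi u - a) / (b - a) * (d - c).
have rm s t : s < t -> r s < r t.
  by move=> st; rewrite /r ltrD2l ltr_pM2r // ltr_pM2r ?invr_gt0 // ltrD2r.
have rw s t : s <= t -> r s <= r t.
  by rewrite le_eqVlt => /orP[/eqP->//|/rm/ltW].
have rc : r c = a by rewrite /r subrr !mul0r addr0.
have rd : r d = b by rewrite /r divff ?gt_eqF // mul1r addrC subrK.
have rq u : r (q u) = phi u.
  by rewrite /r /q [c + _]addrC addrK mulfK ?gt_eqF // divfK ?gt_eqF // addrC subrK.
have pm' s t : c <= s -> s <= t -> t <= d -> phi s <= phi t.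
  move=> cs st td; apply: pm => //; rewrite in_itv /=; first by rewrite cs (le_trans st).
  by rewrite td (le_trans cs).
exists (h \o r), q, (k * ((b - a) / (d - c))); split.
- split; first by rewrite mulr_ge0 // divr_ge0 // ltW.
  move=> s t cs st td /=.
  apply: le_trans (hk (r s) (r t) _ (rw _ _ st) _) _.
  + by rewrite -rc rw.
  + by rewrite -rd rw.
  + by rewrite -mulrA ler_wpM2l // /r le_eqVlt; apply/orP; left; apply/eqP; field; rewrite gt_eqF.
- move=> s t cs st td /=; apply: (directed_curveP th); last 1 first.
  + by rewrite -rd rw.
  + by rewrite -rc rw.
  + exact: rm.
- move=> t tcd e e0.
  have [|r0 r00 hr] := cp t tcd (e * ((b - a) / (d - c))).
    by rewrite mulr_gt0 // divr_gt0.
  exists r0 => // s scd st; have := hr s scd st; rewrite /adist /q.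
  have -> : c + (phi t - a) / (b - a) * (d - c) - (c + (phi s - a) / (b - a) * (d - c))
     = (phi t - phi s) / ((b - a) / (d - c)) by field; rewrite !gt_eqF.
  by rewrite normrM normfV (gtr0_norm (divr_gt0 ab' cd')) ltr_pdivrMr ?divr_gt0.
- move=> s t cs st td; rewrite /q lerD2l ler_pM2r // ler_pM2r ?invr_gt0 // lerD2r.
  exact: pm'.
- split.
  + by rewrite /q pc subrr !mul0r addr0.
  + by rewrite /q pd divff ?gt_eqF // mul1r addrC subrK.
  + by move=> t tcd /=; rewrite rq gE // in_itv.
Qed.

Lemma ltl_curve L a b g : causal_spacetime L -> a < b -> ltl L a b g ->
  exists2 h, future_timelike L `[a, b] h & reparametrization a b g a b h.
Proof.
move=> C ab [h [phi [k [lh ch_ cp pm [pa pb gE]]]]]; exists h.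
  apply: (directed_curve_itv ab _ lh ch_) => e.
  by have := ch_ a b (lexx _) ab (lexx _); rewrite e => /(cst_irr C).
exists phi; split=> //; first exact/within_econt.
by move=> s t; rewrite !in_itv /= => /andP[? ?] /andP[? ?] st; exact: pm.
Qed.

(* Adding up the local identity along a fine partition gives [<=]; the reverse
   triangle inequality makes every other partition sum at least as large. *)
Lemma tau_sum_potential L a b g f : causal_spacetime L -> a <= b ->
  (forall s t, a <= s -> s <= t -> t <= b -> caus L (g s) (g t)) ->
  (forall t, a <= t <= b -> exists2 e, 0 < e & forall s s', a <= s -> s <= s' ->
     s' <= b -> `|s - t| < e -> `|s' - t| < e ->
     tau L (g s) (g s') = (f s' - f s)%:E) ->
  tau_length L a b g = (f b - f a)%:E.
Proof.
move=> C ab cg loc; apply/eqP; rewrite eq_le; apply/andP; split.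
  have [s ps <-] : exists2 s, itv_partition a b s & psum L g a s = (f b - f a)%:E.
    apply: (interval_chain ab (P := fun a b => exists2 s, itv_partition a b s &
      psum L g a s = (f b - f a)%:E)).
      move=> s t r _ st tr _ [q1 P1 S1] [q2 P2 S2]; exists (q1 ++ q2).
        exact: (itv_partition_cat P1 P2).
      have [_ /eqP lE] := P1; rewrite psum_cat lE S1 S2 -EFinD; congr (_%:E); ring.
    move=> t /loc[e e0 he]; exists e => // s s' as_ ss' s'b hs hs'.
    have [sE|nss] := eqVneq s s'; first by exists [::]; rewrite ?sE /= ?subrr.
    have lt : s < s' by rewrite lt_neqAle nss.
    exists [:: s']; first exact: itv_partition1.
    by rewrite /= adde0 he.
  exact: tau_length_le.
apply: tau_length_ge => s ps.
have tauge u v : a <= u -> u <= v -> v <= b -> ((f v - f u)%:E <= tau L (g u) (g v))%E.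
  move=> au uv vb; apply: (interval_chain uv (P := fun u v =>
      ((f v - f u)%:E <= tau L (g u) (g v))%E)).
    move=> x y z ux xy yz zv h1 h2.
    apply: le_trans (cst_tri C (q := g y) _ _); last 2 first.
    - by apply: cg; lra.
    - by apply: cg; lra.
    - have -> : f z - f x = (f y - f x) + (f z - f y) by ring.
      by rewrite EFinD; apply: leeD.
  move=> t /andP[ut tv]; have [|e e0 he] := loc t; first by apply/andP; split; lra.
  by exists e => // x y ux xy yv hx hy; rewrite he //; lra.
have [ps1 /eqP ps2] := ps.
suff main : forall c, a <= c -> path <%R c s -> last c s = b ->
    ((f b - f c)%:E <= psum L g c s)%E by exact: main.
elim: s {ps ps1 ps2} => [|x s IH] c ac /=; first by move=> _ ->; rewrite subrr.
move=> /andP[cx px] lb.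
have xb : x <= b.
  have := order_path_min lt_trans px; case: (s) lb => [/= ->//|y s' <-] /allP hall.
  by apply/ltW/hall => /=; exact: mem_last.
have -> : f b - f c = (f x - f c) + (f b - f x) by ring.
rewrite EFinD; apply: leeD; first by apply: tauge => //; exact: ltW.
by apply: IH => //; rewrite (le_trans ac) // ltW.
Qed.

(** Length is an infimum over partitions, so every partition sum is at least tau between the ends;
    the reverse triangle inequality makes it equal. Hence tau from [g a] is a potential, finiteness
    allowing subtraction. *)
Lemma maximizer_additive L a b g : causal_spacetime L -> maximizer L a b g ->
  tau L (g a) (g b) \is a fin_num -> exists f, forall s t, a <= s -> s <= t ->
  t <= b -> tau L (g s) (g t) = (f t - f s)%:E.
Proof.
move=> C [fg len] fin; have ab := directed_curve_lt fg.
have cg s t : a <= s -> s <= t -> t <= b -> caus L (g s) (g t).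
  move=> as_; rewrite le_eqVlt => /orP[/eqP-> _|st tb]; first exact: (cst_refl C).
  exact: (directed_curveP fg).
have txx := tauxx C.
(* Partitions are strictly increasing, so coinciding parameters among [a], [s], [t], [b] call for
   partitions of different lengths. *)
have split3 s t : a <= s -> s <= t -> t <= b ->
    (tau L (g a) (g s) + (tau L (g s) (g t) + tau L (g t) (g b)) = tau L (g a) (g b))%E.
  move=> as_ st tb; apply/eqP; rewrite eq_le; apply/andP; split.
    apply: (le_trans (leeD2l _ (cst_tri C (cg _ _ as_ st tb) (cg _ _ (le_trans as_ st) tb (lexx b))))).
    by apply: (cst_tri C); apply: cg => //; lra.
  rewrite -len.
  have [tlb|tb'] := ltP t b; last first.
    have -> : t = b by apply/eqP; rewrite eq_le tb.
    rewrite txx adde0; have [slb|sb'] := ltP s b; last first.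
      have -> : s = b by apply/eqP; rewrite eq_le sb' (le_trans st).
      rewrite txx adde0; apply: le_trans (tau_length_le _ _ (itv_partition1 ab)) _.
      by rewrite /= adde0.
    have [sa|nsa] := eqVneq a s.
      rewrite -sa txx add0e; apply: le_trans (tau_length_le _ _ (itv_partition1 ab)) _.
      by rewrite /= adde0.
    have asl : a < s by rewrite lt_neqAle nsa.
    have P : itv_partition a b [:: s; b] by split; rewrite /= ?asl ?slb.
    by apply: le_trans (tau_length_le _ _ P) _; rewrite /= adde0.
  have [<-|nst] := eqVneq s t.
    rewrite txx add0e; have slb := le_lt_trans st tlb.
    have [sa|nsa] := eqVneq a s.
      rewrite -sa txx add0e; apply: le_trans (tau_length_le _ _ (itv_partition1 ab)) _.
      by rewrite /= adde0.
    have asl : a < s by rewrite lt_neqAle nsa.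
    have P : itv_partition a b [:: s; b] by split; rewrite /= ?asl ?slb.
    by apply: le_trans (tau_length_le _ _ P) _; rewrite /= adde0.
  have stl : s < t by rewrite lt_neqAle nst.
  have [sa|nsa] := eqVneq a s.
    rewrite -sa txx add0e.
    have P : itv_partition a b [:: t; b] by split; rewrite /= ?tlb ?andbT //; lra.
    by apply: le_trans (tau_length_le _ _ P) _; rewrite /= adde0.
  have asl : a < s by rewrite lt_neqAle nsa.
  have P : itv_partition a b [:: s; t; b] by split; rewrite /= ?asl ?stl ?tlb.
  by apply: le_trans (tau_length_le _ _ P) _; rewrite /= adde0.
have finite s t : a <= s -> s <= t -> t <= b ->
    [/\ tau L (g a) (g s) \is a fin_num, tau L (g s) (g t) \is a fin_num &
     tau L (g t) (g b) \is a fin_num].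
  move=> as_ st tb; have := split3 s t as_ st tb.
  have := cst_ge0 C (g a) (g s); have := cst_ge0 C (g s) (g t).
  have := cst_ge0 C (g t) (g b); move: fin.
  by case: (tau L (g a) (g b)) => // z _; case: (tau L (g a) (g s)) => // x;
    case: (tau L (g s) (g t)) => // y; case: (tau L (g t) (g b)).
exists (fun s => fine (tau L (g a) (g s))) => s t as_ st tb.
have [f1 f2 f3] := finite s t as_ st tb.
have [f4 _ _] := finite t t (le_trans as_ st) (lexx t) tb.
have := split3 s t as_ st tb; rewrite -(split3 t t (le_trans as_ st) (lexx t) tb) txx add0e.
rewrite -(fineK f1) -(fineK f2) -(fineK f3) -(fineK f4) /= -!EFinD => -[e].
by congr (_%:E); lra.
Qed.

End Chronological.

(** * Causality of the given space *)

Section Setup.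
Context {R : realType} {X : metricType R} {L : causal_data X}.
Implicit Types (p q u v x y z : X) (N : set X).
Hypothesis hL : lorentzian_pre_length_space L.
Hypothesis hsc : strongly_causal L.
Hypothesis hone : future_one_connected L.

Local Notation ch := (chron L).
Local Notation ca := (caus L).

Lemma pl_refl p : ca p p.
Proof. exact: (caus_refl hL). Qed.

Lemma pl_trans q p r : ca p q -> ca q r -> ca p r.
Proof. exact: (caus_trans hL). Qed.

Lemma pl_chca p q : ch p q -> ca p q.
Proof. exact: (chron_caus hL). Qed.

Lemma pl_tri p q r : ca p q -> ca q r -> (tau L p q + tau L q r <= tau L p r)%E.
Proof. exact: (tau_triangle hL). Qed.

Lemma pl_gt0 p q : (0 < tau L p q)%E <-> ch p q.
Proof. exact: (Defs.tau_gt0 hL). Qed.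

Lemma pl_ge0 p q : (0 <= tau L p q)%E.
Proof. exact: (Defs.tau_ge0 hL). Qed.

Lemma pl_ch_ca q p r : ch p q -> ca q r -> ch p r.
Proof.
move=> pq qr; apply/pl_gt0; apply: (lt_le_trans (proj2 (pl_gt0 p q) pq)).
apply: le_trans (pl_tri (pl_chca pq) qr); apply: leeDl; exact: pl_ge0.
Qed.

Lemma pl_ca_ch q p r : ca p q -> ch q r -> ch p r.
Proof.
move=> pq qr; apply/pl_gt0; apply: (lt_le_trans (proj2 (pl_gt0 q r) qr)).
apply: le_trans (pl_tri pq (pl_chca qr)); apply: leeDr; exact: pl_ge0.
Qed.

(** A basic set is a finite intersection of diamonds, which are causally convex. The intersection
    over no diamond is the whole space; it has to be kept as a separate case. *)
Lemma strongly_causal_nbhs p N : nbhs p N -> exists B : set X,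
  [/\ open B, B p, B `<=` N, causally_convex L B &
   (forall q, (forall u v, ch u p -> ch p v -> ch u q /\ ch q v) -> B q) /\
   (B = setT \/ exists u v, ch u p /\ ch p v)].
Proof.
move=> Np; have [oB /(_ p N Np)[B [BB Bp] BN]] := hsc.
exists B; split=> //; first exact: oB.
  case: BB => D _ <- a b z /= Ba Bb az zb i Di.
  have [h1 _] := Ba i Di; have [_ h2] := Bb i Di.
  by split; [exact: (pl_ch_ca h1)|exact: (pl_ca_ch zb)].
case: BB Bp => D _ <-; set S := (X in \bigcap_(i in X) _) => Bp; split.
  by move=> q hq i Di; have [h1 h2] := Bp i Di; exact: hq.
have [DE|/set0P[i Di]] := eqVneq S set0; last first.
  by right; have [h1 h2] := Bp i Di; exists i.1, i.2.
by left; rewrite DE bigcap_set0.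
Qed.

Lemma indistinguishable_eq p q :
  (forall u v, ch u p -> ch p v -> ch u q /\ ch q v) -> p = q.
Proof.
move=> hq; apply: metric_hausdorff => A B Ap Bq.
have [C [_ _ CA _ [Cq _]]] := strongly_causal_nbhs Ap.
by exists q; split; [exact/CA/Cq|exact: nbhs_singleton].
Qed.

Lemma pl_anti p q : ca p q -> ca q p -> p = q.
Proof.
move=> pq qp; apply: indistinguishable_eq => u v up pv.
by split; [exact: (pl_ch_ca up)|exact: (pl_ca_ch qp)].
Qed.

(* Strong causality does not separate the points of a timelike loop, which would
   therefore be constant. *)
Lemma pl_irr p : ~ ch p p.
Proof.
move=> pp; have [a [b [g [tg ga gb]]]] := hone.1 p p pp.
have ab := directed_curve_lt tg; have [_ [s [t [Ds Dt gst]]] _ _] := tg.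
have gp (u : R) : [set` `[a, b]] u -> g u = p.
  rewrite /= in_itv /= => /andP[au ub].
  have h1 : ca p (g u).
    rewrite -ga; move: au; rewrite le_eqVlt => /orP[/eqP->|au]; first exact: pl_refl.
    exact/pl_chca/(directed_curveP tg).
  have h2 : ca (g u) p.
    rewrite -gb; move: ub; rewrite le_eqVlt => /orP[/eqP->|ub]; first exact: pl_refl.
    exact/pl_chca/(directed_curveP tg).
  exact: pl_anti.
by apply: gst; rewrite (gp s) ?(gp t).
Qed.

Lemma pl_open p q : ch p q -> exists2 e, 0 < e & forall p' q',
  mdist p p' < e -> mdist q q' < e -> ch p' q'.
Proof.
move=> /pl_gt0 h; have [V Vpq hV] := tau_lsc hL (x := (p, q)) h.
have T : (setT `*` setT : set (X * X)) (p, q) by [].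
have [[A B] /= [Ap Bq] AB] : within (setT `*` setT) (nbhs (p, q)) V.
  by rewrite (nbhs_subspace_in T).
move: Ap => /metricType_numDomainType.nbhs_mdistP[r /= r0 hr].
move: Bq => /metricType_numDomainType.nbhs_mdistP[s /= s0 hs].
exists (Num.min r s); first by rewrite lt_min r0.
move=> p' q'; rewrite !lt_min => /andP[pr _] /andP[_ qs].
apply/pl_gt0; apply: (hV (p', q')); apply: (AB (p', q')) => //; split=> /=; [exact: hr|exact: hs].
Qed.

Section Nontrivial.
Hypothesis hne : exists x y, ch x y.

(** A point in no diamond has the whole space as its only basic neighbourhood. By the Hausdorff
    property the space is then a single point, and a chronological pair would be a loop. *)
Lemma pl_in_diamond p : exists u v, ch u p /\ ch p v.
Proof.
apply: contrapT => hn; have [x [y xy]] := hne.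
have E q : p = q.
  apply: metric_hausdorff => A B Ap Bq.
  have [C [_ _ CA _ [_ [CT|//]]]] := strongly_causal_nbhs Ap.
  by exists q; split; [apply: CA; rewrite CT|exact: nbhs_singleton].
by apply: (@pl_irr p); rewrite {1}(E x) (E y).
Qed.

Hypothesis hgh : globally_hyperbolic L.

Lemma diamond_closed a b : closed (causal_diamond L a b).
Proof. by apply: compact_closed; [exact: metric_hausdorff|exact: hgh.1]. Qed.

Lemma approx_past p : exists f : nat -> X, (forall n, ch (f n) p) /\ f @ \oo --> p.
Proof.
have [a [_ [ap _]]] := pl_in_diamond p.
have [s [t [g [tg _ gb]]]] := hone.1 a p ap.
have st := directed_curve_lt tg; have cg := directed_curve_econt tg.
have ttt : s <= t <= t by rewrite lexx ltW.
have /choice[f hf] : forall n : nat, exists q, ch q p /\ mdist p q < n.+1%:R^-1.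
  move=> n; have [|d d0 hd] := cg t ttt n.+1%:R^-1; first by rewrite invr_gt0.
  pose u := Num.max s (t - d / 2).
  have us : s <= u by rewrite le_max lexx.
  have ud : t - d / 2 <= u by rewrite le_max lexx orbT.
  have ut : u < t by rewrite gt_max st /=; lra.
  exists (g u); split; first by rewrite -gb; apply: (directed_curveP tg).
  rewrite -gb; apply: hd; first by rewrite us ltW.
  by rewrite distrC ger0_norm; lra.
exists f; split; first by move=> n; have [] := hf n.
apply/metricType_numDomainType.cvgrPdist_lt => r r0.
apply: filterS (near_infty_natSinv_lt (PosNum r0)) => n /=.
by apply: lt_trans; have [] := hf n.
Qed.

(** Compact diamonds are closed. If [a << p], the points [g i] eventually lie in the diamond of [a]
    and some [b >> q], which gives [a <= q]. Then [a] approaches [p] inside the closed diamond of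
    some [c << p] and [q]. *)
Lemma pl_closed (T : Type) (F : set_system T) (f g : T -> X) p q :
  ProperFilter F -> f @ F --> p -> g @ F --> q ->
  (\forall i \near F, ca (f i) (g i)) -> ca p q.
Proof.
move=> FP fp gq hfg; have FF : Filter F by exact: filter_filter.
have nearch (w : T -> X) z z' : w @ F --> z' -> ch z z' -> \forall i \near F, ch z (w i).
  move=> wz' zz'; have [e e0 he] := pl_open zz'.
  move/metricType_numDomainType.cvgrPdist_lt : wz' => /(_ e e0).
  by apply: filterS => i; apply: he; rewrite mdistxx.
have nearch' (w : T -> X) z z' : w @ F --> z' -> ch z' z -> \forall i \near F, ch (w i) z.
  move=> wz' zz'; have [e e0 he] := pl_open zz'.
  move/metricType_numDomainType.cvgrPdist_lt : wz' => /(_ e e0).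
  by apply: filterS => i h; apply: he; rewrite ?mdistxx.
have [_ [b [_ qb]]] := pl_in_diamond q.
have past a : ch a p -> ca a q.
  move=> ap; suff : causal_diamond L a b q by case.
  apply: (closed_cvg _ (@diamond_closed a b) _ q gq).
  near=> i; split.
    apply: (@pl_trans (f i)); last by near: i.
    by apply: pl_chca; near: i; exact: nearch fp ap.
  by apply: pl_chca; near: i; exact: nearch' gq qb.
have [a [an ap]] := approx_past p.
suff : causal_diamond L (a 0%N) q p by case.
have [c [_ [cp _]]] := pl_in_diamond p.
suff [] : causal_diamond L c q p by move=> h1 h2; split=> //; exact/pl_chca/an.
have [e e0 he] := pl_open cp.
apply: (closed_cvg _ (@diamond_closed c q) _ p ap).
move/metricType_numDomainType.cvgrPdist_lt : ap => /(_ e e0).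
apply: filterS => n hn; split; last exact: past.
by apply: pl_chca; apply: he; rewrite ?mdistxx.
Unshelve. all: by end_near. Qed.

Lemma pl_causal_spacetime : causal_spacetime L.
Proof.
split.
- exact: pl_refl.
- exact: pl_trans.
- exact: pl_chca.
- exact: pl_ge0.
- exact: pl_tri.
- exact: pl_gt0.
- exact: pl_irr.
- exact: pl_open.
- exact: pl_closed.
- exact: pl_anti.
- by move=> p; have [u [_ [? _]]] := pl_in_diamond p; exists u.
- by move=> p; have [_ [v [_ ?]]] := pl_in_diamond p; exists v.
- exact: hgh.1.
Qed.

End Nontrivial.
End Setup.

(** * From constant-speed curves to Lipschitz timelike geodesics and maximizers *)

Section TimelikeReparametrization.
Context {R : realType} {X : metricType R} {L : causal_data X}.
Implicit Types (g h : R -> X) (a b c d s t k : R) (phi : R -> R).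
Hypothesis C : causal_spacetime L.

Lemma reparametrization_trans a b c d p q (g1 g2 g3 : R -> X) : a <= b ->
  reparametrization a b g1 c d g2 -> reparametrization c d g2 p q g3 ->
  reparametrization a b g1 p q g3.
Proof.
move=> ab [phi [/within_econt c1 m1 a1 b1 E1]] [psi [/within_econt c2 m2 a2 b2 E2]].
have rg t : a <= t <= b -> c <= phi t <= d.
  move=> /andP[at_ tb]; rewrite -a1 -b1; apply/andP; split; apply: m1 => //;
    by rewrite in_itv /= ?lexx ?ab ?at_ ?tb.
exists (psi \o phi); split.
- exact/within_econt/(econt_comp c2 c1 rg).
- move=> s t sab tab st /=; apply: m2; first by move: sab; rewrite !in_itv /=; exact: rg.
    by move: tab; rewrite !in_itv /=; exact: rg.
  exact: m1.
- by rewrite /= a1.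
- by rewrite /= b1.
- move=> t tab; rewrite E1 // E2 //; move: tab; rewrite !in_itv /=; exact: rg.
Qed.

Lemma ltl_comp a b c d g h : a < b -> c < d -> ltl L a b g ->
  reparametrization c d h a b g -> ltl L c d h.
Proof.
move=> ab cd lg rh; have [f tf rf] := ltl_curve C ab lg.
exact: ltl_reparam cd tf (reparametrization_trans (ltW cd) rh rf).
Qed.

Lemma reparametrization_affine a b g : a < b ->
  reparametrization 0 1 (g \o affine a b) a b g.
Proof.
move=> ab; exists (affine a b); split=> //.
- exact/within_econt/econt_affine.
- by move=> s t _ _ st; apply: affine_le => //; exact: ltW.
- exact: affine0.
- exact: affine1.
Qed.

Lemma reparametrization_affine_inv a b g : a < b ->
  reparametrization a b g 0 1 (g \o affine a b).
Proof.
move=> ab; have ab' : b - a != 0 by rewrite subr_eq0 gt_eqF.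
exists (fun t => (t - a) / (b - a)); split.
- apply/within_econt => t _ e e0; exists (e * (b - a)).
    by rewrite mulr_gt0 // subr_gt0.
  move=> s _ st; rewrite /adist -mulrBl normrM normfV (gtr0_norm (x := b - a)) ?subr_gt0 //.
  rewrite ltr_pdivrMr ?subr_gt0 //; have -> : t - a - (s - a) = t - s by ring.
  by rewrite distrC.
- by move=> s t _ _ st; rewrite ler_pM2r ?invr_gt0 ?subr_gt0 // lerD2r.
- by rewrite subrr mul0r.
- by rewrite divff.
- by move=> t _ /=; rewrite /affine divfK // addrC subrK.
Qed.

Lemma ltl_affine a b g : a < b -> ltl L a b g <-> ltl L 0 1 (g \o affine a b).
Proof.
move=> ab; split=> l; first exact: (ltl_comp ab ltr01 l (reparametrization_affine g ab)).
exact: (ltl_comp ltr01 ab l (reparametrization_affine_inv g ab)).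
Qed.

Lemma ltl_sub a b s t g : a <= s -> s < t -> t <= b -> ltl L a b g ->
  chron L (g s) (g t) -> ltl L s t g.
Proof.
move=> as_ st tb lg gst; have ab : a < b by lra.
have [h th [phi [/within_econt cp pm pa pb gE]]] := ltl_curve C ab lg.
have sab : a <= s <= b by apply/andP; split; lra.
have tab : a <= t <= b by apply/andP; split; lra.
have pm' u v : a <= u -> u <= v -> v <= b -> phi u <= phi v.
  by move=> au uv vb; apply: pm => //; rewrite in_itv /=; apply/andP; split; lra.
have gs : g s = h (phi s) by apply: gE; rewrite in_itv.
have gt : g t = h (phi t) by apply: gE; rewrite in_itv.
have pst : phi s < phi t.
  rewrite lt_neqAle (pm' s t as_ (ltW st) tb) andbT; apply/eqP => e; move: gst.
  by rewrite gs gt e; exact: cst_irr C _.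
have ps : a <= phi s by rewrite -{1}pa; apply: pm' => //; lra.
have pt : phi t <= b by rewrite -pb; apply: pm' => //; lra.
apply: (ltl_reparam st (a := phi s) (b := phi t) (h := h)).
  have [k hk] := locally_lipschitz_itv (ltW ab) (let: And4 _ _ l _ := th in l).
  apply: (directed_curve_itv (k := k) pst).
  - by rewrite -gs -gt => e; move: gst; rewrite e; exact: cst_irr C _.
  - by case: hk => k0 hk; split=> // u v su uv vt; apply: hk => //; lra.
  - by move=> u v su uv vt; apply: (directed_curveP th) => //; lra.
exists phi; split=> //.
- apply/within_econt; apply: econt_sub cp => //; lra.
- move=> u v; rewrite !in_itv /= => /andP[? ?] /andP[? ?] uv; apply: pm' => //; lra.
- move=> u; rewrite in_itv /= => /andP[? ?]; apply: gE; rewrite in_itv /=; apply/andP; split; lra.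
Qed.

(** Since [g] is itself chronological, its change of parameter cannot be constant anywhere, hence is
    invertible, and the Lipschitz curve is recovered from [g]. *)
Lemma ltl_inverse g : ltl L 0 1 g ->
  (forall s t, 0 <= s -> s < t -> t <= 1 -> chron L (g s) (g t)) ->
  exists h omega,
    [/\ future_timelike L `[0, 1] h, reparametrization 0 1 g 0 1 h &
     [/\ econt adist 0 1 omega, forall t, 0 <= t <= 1 -> 0 <= omega t <= 1,
        forall s t, 0 <= s -> s <= t -> t <= 1 -> omega s <= omega t,
        omega 0 = 0 /\ omega 1 = 1 &
        forall t, 0 <= t <= 1 -> h t = g (omega t)]].
Proof.
move=> lg gch; have [h th rh] := ltl_curve C ltr01 lg.
have [phi [/within_econt cp pm p0 p1 gE]] := rh.
have pm' s t : 0 <= s -> s < t -> t <= 1 -> phi s < phi t.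
  move=> s0 st t1.
  have s01 : s \in `[0, 1] by rewrite in_itv /=; apply/andP; split; lra.
  have t01 : t \in `[0, 1] by rewrite in_itv /=; apply/andP; split; lra.
  rewrite lt_neqAle (pm s t s01 t01 (ltW st)) andbT; apply/eqP => e.
  have := gch s t s0 st t1; rewrite gE // (gE t t01) e; exact: cst_irr C _.
have [om [psi [hom _]]] := param_inverse ltr01 pm' cp.
have [w1 w2 w3 [w4 w5] w6] := hom.
exists h, om; split=> //; split=> // t t01.
rewrite gE ?in_itv ?w2 //; congr h.
by have := w6 t t01; rewrite p0 p1 subr0 mulr1 add0r.
Qed.

Lemma timelike_causal (D : set R) h : future_timelike L D h -> future_causal L D h.
Proof.
move=> [h1 h2 h3 h4]; split=> // s t Ds Dt st; exact/(cst_chca C)/h4.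
Qed.

Lemma timelike_sub a b s t h : future_timelike L `[a, b] h -> a <= s -> s < t ->
  t <= b -> future_timelike L `[s, t] h.
Proof.
move=> th as_ st tb; have ab := directed_curve_lt th.
have [k hk] := locally_lipschitz_itv (ltW ab) (let: And4 _ _ l _ := th in l).
apply: (directed_curve_itv (k := k) st).
- by have := directed_curveP th as_ st tb; move=> c e; move: c; rewrite e; exact: cst_irr C _.
- by case: hk => k0 hk; split=> // u v su uv vt; apply: hk => //; lra.
- by move=> u v su uv vt; apply: (directed_curveP th) => //; lra.
Qed.

(** Obtained from [causal_spacetime] alone, because it is used in constructing the good
    neighbourhoods. *)
Lemma geo_chron k g s t : geo L k g -> 0 <= s -> s < t -> t <= 1 ->
  chron L (g s) (g t) /\ forall u v, s <= u -> u <= v -> v <= t -> caus L (g u) (g v).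
Proof.
move=> [cg k0 [d d0 gE]] s0 st t1.
have mono u v : s <= u -> u <= v -> v <= t -> caus L (g u) (g v).
  move=> su uv vt; apply: (interval_chain uv (P := fun u v => caus L (g u) (g v))).
    by move=> x y z _ _ _ _; exact: cst_trans C _ _ _.
  move=> w /andP[uw wv]; exists (d / 2); first lra.
  move=> x y ux xy yv; rewrite !ltr_norml => /andP[? ?] /andP[? ?].
  move: xy; rewrite le_eqVlt => /orP[/eqP->|xy]; first exact: cst_refl C _.
  apply/(cst_chca C)/(cst_gt0 C); rewrite gE ?(ltW xy) //; [|lra..].
  by rewrite lte_fin mulr_gt0 // subr_gt0.
split=> //; pose u := Num.min t (s + d / 2).
have ut : u <= t by rewrite ge_min lexx.
have us : u <= s + d / 2 by rewrite ge_min lexx orbT.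
have su : s < u by rewrite lt_min st /=; lra.
apply: (ch_ca_trans C (q := g u)); last by apply: mono => //; exact: ltW.
apply/(cst_gt0 C); rewrite gE ?(ltW su) //; [|lra..].
by rewrite lte_fin mulr_gt0 // subr_gt0.
Qed.

Lemma geo_constant_speed k g : geo L k g -> constant_speed L g.
Proof.
move=> gg; exists k => t /andP[t0 t1].
rewrite (tau_sum_potential (f := fun s => k * s) C t0); first by rewrite mulr0 subr0.
  move=> u v u0; rewrite le_eqVlt => /orP[/eqP-> _|uv vt]; first exact: cst_refl C _.
  by apply/(cst_chca C); apply: (proj1 (geo_chron gg u0 uv (le_trans vt t1))).
have [_ _ [d d0 gE]] := gg.
move=> w _; exists (d / 2); first lra.
move=> x y ux xy yv; rewrite !ltr_norml => /andP[? ?] /andP[? ?].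
rewrite gE ?mulrBr //; lra.
Qed.

(** Along the Lipschitz curve [h], tau has the local potential [k * om], so each short piece is a
    maximizer. *)
Lemma geo_timelike_geodesic k g : geo L k g -> ltl L 0 1 g -> exists h,
  timelike_geodesic L 0 1 h /\ reparametrization 0 1 g 0 1 h.
Proof.
move=> gg lg; have gch s t : 0 <= s -> s < t -> t <= 1 -> chron L (g s) (g t).
  by move=> s0 st t1; exact: (proj1 (geo_chron gg s0 st t1)).
have [h [om [th rh [oc o01 om_mono _ hE]]]] := ltl_inverse lg gch.
exists h; split=> //; split=> //; split; first exact: timelike_causal.
have [_ _ [d d0 gE]] := gg.
move=> t; rewrite /= in_itv /= => t01.
have d20 : 0 < d / 2 by lra.
have [r r0 hr] := oc t t01 (d / 2) d20.
(* On this relative neighbourhood [om] varies by less than [d], the scale at which [g] maximizes. *)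
pose c := Num.max 0 (t - r / 2); pose e := Num.min 1 (t + r / 2).
have /andP[t0 t1] := t01.
have c0 : 0 <= c by rewrite le_max lexx.
have ct : c <= t by rewrite ge_max t0 /=; lra.
have cr : t - r / 2 <= c by rewrite le_max lexx orbT.
have e1 : e <= 1 by rewrite ge_min lexx.
have te : t <= e by rewrite le_min t1 /=; lra.
have er : e <= t + r / 2 by rewrite ge_min lexx orbT.
have ce : c < e.
  by rewrite lt_min !gt_max ltr01 /=; apply/andP; split; [lra|apply/andP; split; lra].
have tce := timelike_sub th c0 ce e1.
have hpot u v : c <= u -> u <= v -> v <= e -> tau L (h u) (h v) = (k * om v - k * om u)%:E.
  move=> cu uv ve.
  have u01 : 0 <= u <= 1 by apply/andP; split; lra.
  have v01 : 0 <= v <= 1 by apply/andP; split; lra.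
  have ut : `|u - t| < r by rewrite ltr_norml; apply/andP; split; lra.
  have vt : `|v - t| < r by rewrite ltr_norml; apply/andP; split; lra.
  have := hr u u01 ut; have := hr v v01 vt; rewrite /adist !ltr_norml => /andP[? ?] /andP[? ?].
  rewrite !hE // gE ?mulrBr //; [by have /andP[] := o01 u u01| |by have /andP[] := o01 v v01|lra].
  by apply: om_mono => //; lra.
exists c, e; split.
- move=> u; rewrite /= !in_itv /= => /andP[? ?]; apply/andP; split; lra.
- exists (r / 2) => /=; first lra.
  move=> u /=; rewrite !in_itv /= ltr_norml => /andP[? ?] /andP[? ?].
  by rewrite /c /e ge_max le_min; apply/andP; split; apply/andP; split; lra.
- split; first exact: timelike_causal.
  rewrite (tau_sum_potential (f := fun s => k * om s) C (ltW ce)).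
  + by rewrite hpot // ltW.
  + move=> u v cu; rewrite le_eqVlt => /orP[/eqP-> _|uv ve]; first exact: cst_refl C _.
    exact/(cst_chca C)/(directed_curveP tce).
  + move=> u _; exists 1 => // x y cx xy ye _ _; exact: hpot.
Qed.

Lemma tmax_timelike_maximizer k g : tmax L k g -> ltl L 0 1 g -> exists h,
  timelike_maximizer L 0 1 h /\ reparametrization 0 1 g 0 1 h.
Proof.
move=> gm lg; have gch s t : 0 <= s -> s < t -> t <= 1 -> chron L (g s) (g t).
  by move=> s0 st t1; exact: (tmax_ch C gm).
have [h [om [th rh [oc o01 om_mono _ hE]]]] := ltl_inverse lg gch.
exists h; split=> //; split=> //; split; first exact: timelike_causal.
have hpot u v : 0 <= u -> u <= v -> v <= 1 -> tau L (h u) (h v) = (k * om v - k * om u)%:E.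
  move=> u0 uv v1; have [_ _ gE] := gm.
  have u01 : 0 <= u <= 1 by apply/andP; split; lra.
  have v01 : 0 <= v <= 1 by apply/andP; split; lra.
  rewrite !hE // gE ?mulrBr //; [by have /andP[] := o01 u u01| |by have /andP[] := o01 v v01].
  exact: om_mono.
rewrite (tau_sum_potential (f := fun s => k * om s) C ler01).
+ by rewrite hpot.
+ move=> u v cu; rewrite le_eqVlt => /orP[/eqP-> _|uv ve]; first exact: cst_refl C _.
  exact/(cst_chca C)/(directed_curveP th).
+ by move=> u _; exists 1 => // x y cx xy ye _ _; exact: hpot.
Qed.

Lemma tmax_cs k g : tmax L k g -> ltl L 0 1 g -> cs_timelike_maximizer L g.
Proof.
move=> gm lg; have [h [th rh]] := tmax_timelike_maximizer gm lg.
split; last by exists 0, 1, h.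
have [cg k0 gE] := gm; apply: (@geo_constant_speed k); split=> //.
by exists 1 => // s t s0 st t1 _; exact: gE.
Qed.

Lemma geo_cs k g : geo L k g -> ltl L 0 1 g -> cs_timelike_geodesic L g.
Proof.
move=> gg lg; have [h [th rh]] := geo_timelike_geodesic gg lg.
by split; [exact: geo_constant_speed gg|exists 0, 1, h].
Qed.

End TimelikeReparametrization.

(** * Good neighbourhoods from comparison neighbourhoods *)

Section ConcreteMaximizers.
Context {R : realType} {X : metricType R} {L : causal_data X}.
Implicit Types (p q : X) (U V : set X) (g h : R -> X) (k m : R).
Hypothesis C : causal_spacetime L.
Hypothesis hreg : regular L.

Lemma within_tau_cont U p q r : {within U `*` U, continuous (fun z => tau L z.1 z.2)} ->
  nbhs p U -> nbhs q U -> tau L p q = r%:E -> forall e, 0 < e ->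
  exists2 d, 0 < d & forall p' q', mdist p p' < d -> mdist q q' < d ->
    [/\ U p', U q' & `|tf L p q - tf L p' q'| < e /\ tau L p' q' \is a fin_num].
Proof.
move=> /subspace_continuousP cU Up Uq taur e e0.
have Upq : (U `*` U) (p, q) by split; exact: nbhs_singleton.
have cpq : (fun z : X * X => tau L z.1 z.2) @ within (U `*` U) (nbhs (p, q)) --> r%:E.
  by rewrite -taur; exact: (cU (p, q) Upq).
have [fin cf] := (fine_cvgP _ _).1 cpq.
move/cvgrPdist_lt : cf => /(_ e e0) cf.
have : \forall z \near within (U `*` U) (nbhs (p, q)),
    (`|r - tf L z.1 z.2| < e)%R /\ tau L z.1 z.2 \is a fin_num by apply: filterI.
case=> -[A B] /= [Ap Bq] AB.
have /metricType_numDomainType.nbhs_mdistP[d1 /= d10 hd1] : nbhs p (A `&` U) by exact: filterI.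
have /metricType_numDomainType.nbhs_mdistP[d2 /= d20 hd2] : nbhs q (B `&` U) by exact: filterI.
exists (Num.min d1 d2); first by rewrite lt_min d10.
move=> p' q'; rewrite !lt_min => /andP[/hd1[Ap' Up'] _] /andP[_ /hd2[Bq' Uq']].
by split=> //; have := AB (p', q') (conj Ap' Bq') (conj Up' Uq'); rewrite /tf taur.
Qed.

(** The comparison property provides a maximizing causal curve, and regularity a timelike
    reparametrization [h]. Tau from its start is then a strictly increasing continuous function of
    the parameter of [h], and inverting it gives constant speed. *)
Lemma maximizer_exists U V p q : comparison_set L U -> V `<=` U -> causally_convex L V ->
  (forall p q, V p -> V q -> tau L p q \is a fin_num) ->
  (forall p q, V p -> V q -> forall e, 0 < e -> exists2 d, 0 < d &
    forall p' q', mdist p p' < d -> mdist q q' < d -> `|tf L p q - tf L p' q'| < e) ->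
  V p -> V q -> chron L p q ->
  exists k g, [/\ tmax L k g, ltl L 0 1 g, g 0 = p & g 1 = q].
Proof.
move=> [_ hex _ _] VU Vconv Vfin Vcont Vp Vq pq.
have [a [b [g [[fg ga gb _] len]]]] := hex _ _ (VU _ Vp) (VU _ Vq) pq.
have mg : maximizer L a b g by split=> //; rewrite ga gb.
have [|c [d [h [th rgh]]]] := hreg mg; first by rewrite ga gb.
have fin : tau L (g a) (g b) \is a fin_num by rewrite ga gb; exact: Vfin.
have [f hf] := maximizer_additive C mg fin.
have [phi [/within_econt cphi pm pa pb gE]] := rgh.
have ab := directed_curve_lt fg; have cd := directed_curve_lt th.
have gE' t : a <= t <= b -> g t = h (phi t) by move=> tab; apply: gE; rewrite in_itv.
have hc : h c = p by rewrite -pa -gE' ?lexx ?ltW.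
have hd : h d = q by rewrite -pb -gE' ?lexx ?ltW.
have pm' s t : a <= s <= b -> a <= t <= b -> s <= t -> phi s <= phi t.
  by move=> sab tab st; apply: pm => //; rewrite in_itv.
pose F u := tf L (h c) (h u).
have onto u : c <= u <= d -> exists2 s, a <= s <= b & phi s = u.
  move=> ucd; exact: (econt_onto (ltW ab) (ltW cd) cphi pa pb ucd).
have FE s w : a <= s <= b -> phi s = w -> F w = f s - f a.
  move=> sab <-; have /andP[as_ sb] := sab.
  by rewrite /F /tf hc -ga -gE' // hf.
have tauF u v : c <= u -> u <= v -> v <= d -> tau L (h u) (h v) = (F v - F u)%:E.
  move=> cu uv vd.
  have [<-|nuv] := eqVneq u v; first by rewrite (tauxx C) subrr.
  have [s sab su] : exists2 s, a <= s <= b & phi s = u by apply: onto; apply/andP; split; lra.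
  have [t tab tv] : exists2 t, a <= t <= b & phi t = v by apply: onto; apply/andP; split; lra.
  have st : s <= t.
    rewrite leNgt; apply/negP => /ltW ts; have := pm' _ _ tab sab ts; rewrite su tv => vu.
    by move: nuv; rewrite eq_le uv vu.
  have /andP[as_ sb] := sab; have /andP[at_ tb] := tab.
  rewrite (FE _ _ sab su) (FE _ _ tab tv) -su -tv -!gE' // hf //.
  by congr (_%:E); ring.
have tca u v : c <= u -> u <= v -> v <= d -> caus L (h u) (h v).
  move=> cu; rewrite le_eqVlt => /orP[/eqP-> _|uv vd]; first exact: cst_refl C _.
  exact/(cst_chca C)/(directed_curveP th).
have hV u : c <= u <= d -> V (h u).
  move=> /andP[cu ud]; apply: (Vconv p q) => //; first by rewrite -hc; exact: tca.
  by rewrite -hd; exact: tca.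
have Fm u v : c <= u -> u < v -> v <= d -> F u < F v.
  move=> cu uv vd; have := (cst_gt0 C _ _).2 (directed_curveP th cu uv vd).
  by rewrite tauF ?(ltW uv) // lte_fin subr_gt0.
have hcont := directed_curve_econt th.
have ccd : c <= c <= d by rewrite lexx ltW.
have Fc : econt adist c d F.
  move=> t tcd e e0; have [r r0 hr] := Vcont _ _ (hV c ccd) (hV t tcd) e e0.
  have [s s0 hs] := hcont t tcd r r0; exists s => // u ucd ut.
  by rewrite /adist /F; apply: hr; rewrite ?mdistxx //; exact: hs.
have [ka [psi [hka _]]] := param_inverse cd Fm Fc.
have [k1 k2 k3 [k4 k5] k6] := hka.
pose ga' := (h \o ka) \o clamp.
have gE2 t : 0 <= t <= 1 -> ga' t = h (ka t) by move=> t01; rewrite /ga' /= clampE.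
have z01 : 0 <= (0 : R) <= 1 by rewrite lexx ler01.
have o01 : 0 <= (1 : R) <= 1 by rewrite lexx ler01.
have Fcd : 0 < F d - F c by rewrite subr_gt0; apply: Fm.
exists (F d - F c), ga'; split.
- split=> //; first by apply: continuous_within_clamp; exact: (econt_comp hcont k1 k2).
  move=> s t s0 st t1.
  have s01 : 0 <= s <= 1 by rewrite s0 (le_trans st).
  have t01 : 0 <= t <= 1 by rewrite t1 (le_trans s0).
  have /andP[? ?] := k2 s s01; have /andP[? ?] := k2 t t01.
  rewrite !gE2 // tauF //; last exact: k3.
  by rewrite !k6 //; congr (_%:E); ring.
- apply: (ltl_reparam ltr01 th); exists ka; split=> //.
  + exact/within_econt.
  + by move=> s t; rewrite !in_itv /= => /andP[? ?] /andP[? ?] st; exact: k3.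
- by rewrite gE2 // k4.
- by rewrite gE2 // k5.
Qed.

Section InComparison.
Variables (U V : set X).
Hypothesis cU : comparison_set L U.
Hypothesis VU : V `<=` U.
Hypothesis pV : pregood L V.

Lemma concrete_concave k m g h : tmax L k g -> tmax L m h -> ltl L 0 1 g ->
  ltl L 0 1 h -> V (g 0) -> V (g 1) -> V (h 0) -> V (h 1) ->
  chron_eq L (g 0) (h 0) -> chron_eq L (g 1) (h 1) -> concave_pair L g h.
Proof.
move=> gm hm lg lh g0 g1 h0 h1 c0 c1 t t01; have [_ _ conc _] := cU.
have inU k' g' : tmax L k' g' -> V (g' 0) -> V (g' 1) -> g' @` `[0, 1] `<=` U.
  move=> gm' Va Vb _ [u /= u01 <-]; apply: VU; exact: (tmax_in C pV gm').
have := conc g h (tmax_cs C gm lg) (tmax_cs C hm lh) (inU _ _ gm g0 g1)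
  (inU _ _ hm h0 h1) c0 c1 t t01.
have Vg := tmax_in C pV gm g0 g1 t01; have Vh := tmax_in C pV hm h0 h1 t01.
by rewrite !(tfE pV) // -!EFinM -EFinD lee_fin.
Qed.

Lemma ltl_scale k g s : tmax L k g -> ltl L 0 1 g -> 0 < s < 1 ->
  ltl L 0 1 (g \o affine 0 s).
Proof.
move=> gm lg /andP[s0 s1]; apply/(ltl_affine C g s0); apply: (ltl_sub C (lexx 0) s0 (ltW s1) lg).
by apply: (tmax_ch C gm) => //; exact: ltW.
Qed.

Lemma concrete_le k m g h : tmax L k g -> tmax L m h -> ltl L 0 1 g ->
  ltl L 0 1 h -> V (g 0) -> V (g 1) -> g 0 = h 0 -> g 1 = h 1 ->
  forall t, 0 <= t <= 1 -> caus L (g t) (h t).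
Proof.
move=> gm hm lg lh V0 V1 e0 e1; apply: (tmax_le_of_concave C pV gm hm) => // s s01.
have /andP[s0 s1] := s01.
have gs := tmax_sub gm (lexx 0) s0 (ltW s1).
have Vs : V (g s) by apply: (tmax_in C pV gm) => //; rewrite !ltW.
apply: (concrete_concave gs hm (ltl_scale gm lg s01) lh);
  rewrite /= ?affine0 ?affine1 -?e0 -?e1 //.
  by right.
by left; apply: (tmax_ch C gm); rewrite // ltW.
Qed.

Lemma concrete_uniq k m g h : tmax L k g -> tmax L m h -> ltl L 0 1 g ->
  ltl L 0 1 h -> V (g 0) -> V (g 1) -> g 0 = h 0 -> g 1 = h 1 -> eq01 g h.
Proof.
move=> gm hm lg lh V0 V1 e0 e1 t t01; apply: (cst_anti C).
  exact: (concrete_le gm hm).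
by apply: (concrete_le hm gm) => //; rewrite -?e0 -?e1.
Qed.

Hypothesis Vmax : forall p q, V p -> V q -> chron L p q ->
  exists k g, [/\ tmax L k g, ltl L 0 1 g, g 0 = p & g 1 = q].

Lemma ltl_eq01 g h : eq01 g h -> ltl L 0 1 g -> ltl L 0 1 h.
Proof.
move=> e [f [phi [k [h1 h2 h3 h4 [h5 h6 h7]]]]].
by exists f, phi, k; split=> //; split=> // t t01; rewrite -e // h7.
Qed.

Lemma ltl_glue g1 g2 (u : R) : 0 < u -> u < 1 -> ltl L 0 1 g1 -> ltl L 0 1 g2 ->
  g1 1 = g2 0 ->
  ltl L 0 1 (fun t => if t <= u then g1 (t / u) else g2 ((t - u) / (1 - u))).
Proof.
move=> u0 u1 l1 l2 e.
set c := fun t => _.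
have u1' : 0 < 1 - u by rewrite subr_gt0.
apply: (ltl_cat C (ltW u0) (ltW u1)).
  apply/(ltl_affine C c u0); apply: ltl_eq01 l1 => t /andP[t0 t1].
  rewrite /c /= /affine add0r subr0 mulfK ?gt_eqF //.
  by have -> : t * u <= u by nra.
apply/(ltl_affine C c u1); apply: ltl_eq01 l2 => t /andP[t0 t1].
rewrite /c /= /affine.
have -> : (u + t * (1 - u) - u) / (1 - u) = t by field; rewrite gt_eqF.
case: ifP => // h; have t00 : t = 0 by apply/eqP; rewrite eq_le t0 andbT; nra.
by rewrite t00 mul0r addr0 divff ?gt_eqF.
Qed.

(* For each [u], [g u] lies on a concatenation of two reparametrized Lipschitz
   maximizers, which by uniqueness is the one joining the end points of [g]. *)
Lemma tmax_ltl k g : tmax L k g -> V (g 0) -> V (g 1) -> ltl L 0 1 g.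
Proof.
move=> gm V0 V1.
have [m [h [hm lh h0 h1]]] := Vmax V0 V1 (tmax_ch C gm (lexx 0) ltr01 (lexx 1)).
apply: (ltl_eq01 _ lh) => u /andP[u0 u1].
move: u0; rewrite le_eqVlt => /orP[/eqP<-//|u0].
move: u1; rewrite le_eqVlt => /orP[/eqP->//|u1].
have Vu : V (g u) by apply: (tmax_in C pV gm) => //; rewrite !ltW.
have [k1 [g1 [m1 l1 g10 g11]]] := Vmax V0 Vu (tmax_ch C gm (lexx 0) u0 (ltW u1)).
have [k2 [g2 [m2 l2 g20 g21]]] := Vmax Vu V1 (tmax_ch C gm (ltW u0) u1 (lexx 1)).
have e12 : g1 1 = g2 0 by rewrite g11.
have k1E : k1 = k * u by rewrite -(tmax_len m1) g10 g11 (tmaxE gm) ?subr0 // ltW.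
have k2E : k2 = k * (1 - u) by rewrite -(tmax_len m2) g20 g21 (tmaxE gm) // ltW.
have [_ k0 _] := gm.
have uE : k1 / (k1 + k2) = u by rewrite k1E k2E; field; rewrite gt_eqF //; lra.
have := tmax_glue C pV m1 m2; rewrite uE g10 g21 => /(_ V0 V1 e12).
have -> : k1 + k2 = k by rewrite k1E k2E; ring.
rewrite (tmax_len gm) => /(_ erefl) cm.
have := concrete_uniq hm cm lh (ltl_glue u0 u1 l1 l2 e12).
rewrite h0 h1 ltW // mul0r g10 leNgt u1 /= divff ?subr_eq0 ?gt_eqF // g21.
have u01 : 0 <= u <= 1 by rewrite !ltW.
move=> /(_ V0 V1 erefl erefl u u01); rewrite lexx divff ?gt_eqF // g11.
by [].
Qed.

End InComparison.
End ConcreteMaximizers.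

(** * Construction of small good neighbourhoods *)

Section GoodNeighbourhoods.
Context {R : realType} {X : metricType R} {L : causal_data X}.
Hypothesis hL : lorentzian_pre_length_space L.
Hypothesis hsc : strongly_causal L.
Hypothesis C : causal_spacetime L.
Hypothesis hreg : regular L.
Hypothesis hconc : locally_concave L.

Lemma good_neighbourhood (p : X) (e : R) : 0 < e -> exists V : set X,
  [/\ good L V, V p, forall q, V q -> mdist p q < e &
   forall k g, tmax L k g -> V (g 0) -> V (g 1) -> ltl L 0 1 g].
Proof.
move=> e0; have [U Up cU] := hconc p; have [cont _ _ _] := cU.
(* Continuity of tau at the diagonal, where it vanishes, makes it finite on a neighbourhood of
   [p]. *)
have [d d0 hd] := within_tau_cont cont Up Up (tauxx C p) ltr01.
have m0 : 0 < Num.min d e by rewrite lt_min d0.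
have Np : nbhs p [set q | mdist p q < Num.min d e].
  by apply/metricType_numDomainType.nbhs_mdistP; exists (Num.min d e).
have [V [oV Vp VN Vc _]] := strongly_causal_nbhs hL hsc Np.
have VU q : V q -> U q.
  move=> /VN /=; rewrite lt_min => /andP[qd _].
  by have [] := hd q q qd qd.
have Vfin q q' : V q -> V q' -> tau L q q' \is a fin_num.
  move=> /VN /=; rewrite lt_min => /andP[qd _] /VN /=; rewrite lt_min => /andP[q'd _].
  by have [_ _ []] := hd q q' qd q'd.
have Vcont q q' : V q -> V q' -> forall r, 0 < r -> exists2 s, 0 < s &
    forall z z', mdist q z < s -> mdist q' z' < s -> `|tf L q q' - tf L z z'| < r.
  move=> Vq Vq' r r0.
  have Uq : nbhs q U by apply: filterS VU _; exact: open_nbhs_nbhs.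
  have Uq' : nbhs q' U by apply: filterS VU _; exact: open_nbhs_nbhs.
  have tE : tau L q q' = (tf L q q')%:E by rewrite /tf fineK // Vfin.
  have [s s0 hs] := within_tau_cont cont Uq Uq' tE r0.
  by exists s => // z z' qz qz'; have [_ _ []] := hs z z' qz qz'.
have Vmax q q' : V q -> V q' -> chron L q q' ->
    exists k g, [/\ tmax L k g, ltl L 0 1 g, g 0 = q & g 1 = q'].
  exact: (maximizer_exists C hreg cU VU Vc Vfin Vcont).
have pV : pregood L V.
  split=> // q q' Vq Vq' /(Vmax _ _ Vq Vq')[k [g [gm _ g0 g1]]].
  by exists k, g.
have Vltl k g := @tmax_ltl _ _ _ C U V cU VU pV Vmax k g.
exists V; split=> //.
  split=> // k m g h gm hm g0 g1 h0 h1 c0 c1.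
  by apply: (concrete_concave C cU VU pV gm hm) => //; [exact: Vltl gm g0 g1|exact: Vltl hm h0 h1].
by move=> q /VN /=; rewrite lt_min => /andP[].
Qed.

Lemma concave_spacetime_of_good : concave_spacetime L.
Proof.
split=> // p e e0; have [V [gV Vp dV _]] := good_neighbourhood p e0.
by exists V.
Qed.

End GoodNeighbourhoods.

(** * Equivalence of the two notions of geodesic *)

Section Geodesics.
Context {R : realType} {X : metricType R}.
Implicit Types (L : causal_data X) (g h : R -> X) (a b c d s t : R).

Lemma geo_ltl L k g : concave_spacetime L ->
  (forall p, exists V, [/\ good L V, V p &
    forall k g, tmax L k g -> V (g 0) -> V (g 1) -> ltl L 0 1 g]) ->
  geo L k g -> ltl L 0 1 g.
Proof.
move=> H hgood gg; have [cg _ _] := gg.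
apply: (interval_chain ler01 (P := fun s t => ltl L s t g)).
  by move=> s t r _ st tr _; exact: (ltl_cat H st tr).
move=> t /andP[t0 t1]; have [V [gV Vt hV]] := hgood (g t).
have [r r0 hr] := good_nbhs gV Vt.
have [d d0 hd] := proj1 (continuousP_dist g) cg t r r0.
exists d => // s s' s0 ss' s'1 hs hs'.
have [<-|nss] := eqVneq s s'; first exact: ltl_refl.
have lt : s < s' by rewrite lt_neqAle nss.
have Vs : V (g s) by exact/hr/hd.
have Vs' : V (g s') by exact/hr/hd.
apply/(ltl_affine H g lt); apply: (hV _ _ (geo_sub_tmax H gV gg s0 lt s'1 Vs Vs')).
  by rewrite /= affine0.
by rewrite /= affine1.
Qed.

(** A partition with each cell in a good set has a finite sum, which bounds the length and hence tau
    between the ends of a maximizer. *)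
Lemma maximizer_fin L c d g : concave_spacetime L -> maximizer L c d g ->
  tau L (g c) (g d) \is a fin_num.
Proof.
move=> H [fg <-]; have cd := directed_curve_lt fg.
have gcont := directed_curve_econt fg.
have [s ps fs] : exists2 s, itv_partition c d s & (psum L g c s \is a fin_num)%E.
  apply: (interval_chain (ltW cd) (P := fun c d => exists2 s, itv_partition c d s &
      psum L g c s \is a fin_num)).
    move=> s t r _ st tr _ [q1 P1 S1] [q2 P2 S2]; exists (q1 ++ q2).
      exact: (itv_partition_cat P1 P2).
    by have [_ /eqP lE] := P1; rewrite psum_cat lE fin_numD S1.
  move=> t tcd; have [V [gV Vt _]] := cst_good H (g t) ltr01.
  have [r r0 hr] := good_nbhs gV Vt; have [e e0 he] := gcont t tcd r r0.
  exists e => // s s' cs ss' s'd hs hs'.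
  have [sE|nss] := eqVneq s s'; first by rewrite sE; exists [::] => //; split.
  have lt : s < s' by rewrite lt_neqAle nss.
  exists [:: s']; first exact: itv_partition1.
  rewrite /= adde0; apply: (good_fin gV); apply/hr/he => //; apply/andP; split; lra.
have le := tau_length_le L g ps.
have ge : (0 <= tau_length L c d g)%E.
  apply: tau_length_ge => q _; elim: q {ps fs le s} (c) => [|x q IH] z //=.
  by apply: adde_ge0 => //; exact: cst_ge0 H _ _.
by rewrite ge0_fin_numE //; apply: (le_lt_trans le); rewrite ltey_eq fs.
Qed.

(* The local potentials are glued along the interval: at a gluing point
   additivity holds because the curve maximizes near it. *)
Lemma local_potential L a b h : concave_spacetime L -> timelike_geodesic L a b h ->
  exists F, forall t, a <= t <= b -> exists2 e, 0 < e & forall v w, a <= v -> v <= w ->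
    w <= b -> `|v - t| < e -> `|w - t| < e -> tau L (h v) (h w) = (F w - F v)%:E.
Proof.
move=> H [th [_ hg]]; have ab := directed_curve_lt th.
have loc t : a <= t <= b -> exists e f, 0 < e /\ forall v w, a <= v -> v <= w ->
    w <= b -> `|v - t| < e -> `|w - t| < e -> tau L (h v) (h w) = (f w - f v)%:E.
  move=> tab; have [|c [d [cdab [e /= e0 he] mh]]] := hg t; first by rewrite /= in_itv.
  have [f hf] := maximizer_additive H mh (maximizer_fin H mh).
  have incd v : a <= v <= b -> `|v - t| < e -> c <= v <= d.
    move=> vab vt; have := he v; rewrite /= distrC !in_itv /=.
    by move=> /(_ vt vab).
  exists e, f; split=> // v w av vw wb hv hw.
  have /andP[? ?] : c <= v <= d by apply: incd => //; apply/andP; split; lra.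
  have /andP[? ?] : c <= w <= d by apply: incd => //; apply/andP; split; lra.
  exact: hf.
apply: (interval_chain (ltW ab) (P := fun a b => exists F, forall t, a <= t <= b ->
   exists2 e, 0 < e & forall v w, a <= v -> v <= w ->
    w <= b -> `|v - t| < e -> `|w - t| < e -> tau L (h v) (h w) = (F w - F v)%:E)).
  move=> s t r as_ st tr rb [F1 h1] [F2 h2].
  pose F u := if u <= t then F1 u else F2 u - F2 t + F1 t.
  exists F => u /andP[su ur].
  have [ut|tu|uE] := ltgtP u t.
  - have [|e e0 he] := h1 u; first by rewrite su ltW.
    exists (Num.min e (t - u)); first by rewrite lt_min e0 subr_gt0.
    move=> v w sv vw wr; rewrite !lt_min => /andP[v1 v2] /andP[w1 w2].
    have wt : w <= t by move: w2; rewrite ltr_norml => /andP[? ?]; lra.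
    by rewrite /F wt (le_trans vw wt) he.
  - have [|e e0 he] := h2 u; first by rewrite ur ltW.
    exists (Num.min e (u - t)); first by rewrite lt_min e0 subr_gt0.
    move=> v w sv vw wr; rewrite !lt_min => /andP[v1 v2] /andP[w1 w2].
    have vt : t < v by move: v2; rewrite ltr_norml => /andP[? ?]; lra.
    rewrite /F !leNgt vt (lt_le_trans vt vw) /= he //; last exact: ltW.
    by congr (_%:E); ring.
  - have [|e1 e10 he1] := h1 t; first by rewrite st lexx.
    have [|e2 e20 he2] := h2 t; first by rewrite tr lexx.
    have [|e3 [f [e30 he3]]] := loc t; first by apply/andP; split; lra.
    exists (Num.min e1 (Num.min e2 e3)); first by rewrite !lt_min e10 e20.
    rewrite uE => v w sv vw wr; rewrite !lt_min => /and3P[v1 v2 v3] /and3P[w1 w2 w3].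
    have tt e : 0 < e -> `|t - t| < e by rewrite subrr normr0.
    rewrite /F; case: (leP v t) => vt; case: (leP w t) => wt.
    + by rewrite he1.
    + have av : a <= v by lra.
      have wb : w <= b by lra.
      have ta : a <= t by lra.
      have E1 := he1 v t sv vt (lexx t) v1 (tt _ e10).
      have E2 := he2 t w (lexx t) (ltW wt) wr (tt _ e20) w2.
      rewrite (he3 v t av vt (le_trans (ltW wt) wb) v3 (tt _ e30)) in E1.
      rewrite (he3 t w ta (ltW wt) wb (tt _ e30) w3) in E2.
      rewrite (he3 v w av vw wb v3 w3); move: E1 E2 => [E1] [E2].
      by congr (_%:E); lra.
    + by have := le_lt_trans vw (le_lt_trans wt vt); rewrite ltxx.
    + by rewrite he2 //; [congr (_%:E); ring|exact: ltW].
move=> t tab; have [e [f [e0 he]]] := loc t tab; exists e => // s s' as_ ss' s'b hs hs'.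
exists f => u /andP[su us']; exists 1 => // v w sv vw ws' _ _.
move: hs hs'; rewrite !ltr_norml => /andP[? ?] /andP[? ?].
apply: he; rewrite ?ltr_norml; try lra; apply/andP; split; lra.
Qed.

(** The local potential [F] is strictly increasing because [h] is timelike, and continuous because
    tau is continuous and zero on the diagonal. It serves as the new parameter. *)
Lemma timelike_geodesic_geo L a b h : concave_spacetime L -> timelike_geodesic L a b h ->
  exists k g psi,
    [/\ geo L k g, econt adist a b psi,
     forall s t, a <= s -> s <= t -> t <= b -> psi s <= psi t,
     psi a = 0 /\ psi b = 1 & forall t, a <= t <= b -> h t = g (psi t)].
Proof.
move=> H gh; have [F hF] := local_potential H gh; have [th _] := gh.
have ab := directed_curve_lt th; have hcont := directed_curve_econt th.
have Fle s t : a <= s -> s <= t -> t <= b -> F s <= F t.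
  move=> as_ st tb; apply: (interval_chain st (P := fun s t => F s <= F t)).
    by move=> x y z _ _ _ _; exact: le_trans.
  move=> u /andP[su ut]; have [|e e0 he] := hF u; first by apply/andP; split; lra.
  exists e => // v w sv vw wt hv hw; rewrite -subr_ge0 -lee_fin -he //; [|lra..].
  exact: cst_ge0 H _ _.
have Fm s t : a <= s -> s < t -> t <= b -> F s < F t.
  move=> as_ st tb; have [|e e0 he] := hF s; first by apply/andP; split; lra.
  pose u := Num.min t (s + e / 2).
  have ut : u <= t by rewrite ge_min lexx.
  have us : u <= s + e / 2 by rewrite ge_min lexx orbT.
  have su : s < u by rewrite lt_min st /=; lra.
  apply: (lt_le_trans _ (Fle u t _ ut tb)); last lra.
  have ss : `|s - s| < e by rewrite subrr normr0.
  have us' : `|u - s| < e by rewrite ltr_norml; apply/andP; split; lra.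
  rewrite -subr_gt0 -lte_fin -(he s u) ?(ltW su) ?(le_trans ut tb) //.
  by apply/(cst_gt0 H); apply: (directed_curveP th) => //; lra.
have Fc : econt adist a b F.
  move=> t tab e e0; have [d d0 hd] := hF t tab.
  have [V [gV Vt _]] := cst_good H (h t) ltr01.
  have [q q0 hq] := good_cont gV Vt Vt e0.
  have [r r0 hr] := hcont t tab q q0.
  exists (Num.min d r); first by rewrite lt_min d0.
  move=> s sab; rewrite lt_min => /andP[sd sr].
  have hts := hr s sab sr; have /andP[as_ sb] := sab; have /andP[at_ tb] := tab.
  have tt0 : `|t - t| < d by rewrite subrr normr0.
  have [st|ts] := leP s t.
    have := hq (h s) (h t) hts; rewrite mdistxx => /(_ q0).
    by rewrite (tfxx H) sub0r normrN /tf (hd s t as_ st tb sd tt0).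
  have := hq (h t) (h s); rewrite mdistxx => /(_ q0 hts).
  rewrite (tfxx H) sub0r normrN /tf (hd t s at_ (ltW ts) sb tt0 sd) /=.
  by rewrite /adist distrC.
have [ka [psi [hka hpsi]]] := param_inverse ab Fm Fc.
have [k1 k2 k3 [k4 k5] k6] := hka; have [p1 p2 p3 [p4 p5] p6] := hpsi.
pose g := (h \o ka) \o clamp.
have gE t : 0 <= t <= 1 -> g t = h (ka t) by move=> t01; rewrite /g /= clampE.
exists (F b - F a), g, psi; split=> //; last first.
  by move=> t tab; rewrite gE ?p2 // (proj1 (p6 t tab)).
split; first by apply: continuous_within_clamp; exact: (econt_comp hcont k1 k2).
  by rewrite subr_gt0; apply: Fm.
have [|d d0 hd] := @interval_uniform R 0 1 (fun s t => s <= t ->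
    tau L (g s) (g t) = ((F b - F a) * (t - s))%:E).
  move=> t t01; have [e e0 he] := hF _ (k2 t t01); have [r r0 hr] := k1 t t01 e e0.
  exists r => // s s' s01 s'01 hs hs' ss'.
  have /andP[? ?] := k2 s s01; have /andP[? ?] := k2 s' s'01.
  have /andP[? ?] := s01; have /andP[? ?] := s'01.
  rewrite !gE // he //; [|exact: k3|by rewrite distrC; exact: hr|by rewrite distrC; exact: hr].
  by rewrite !k6 //; congr (_%:E); ring.
exists d => // s t s0 st t1 std; apply: hd => //.
- by rewrite s0 (le_trans st).
- by rewrite t1 (le_trans s0).
- by rewrite distrC ger0_norm // subr_ge0.
Qed.

(** The curve is a geodesic [f] in the parameter [chi], so its length up to [t] is [k * chi t];
    constant speed forces [chi] to be the identity on [0, 1]. *)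
Lemma cs_geodesic_geo L g : concave_spacetime L -> cs_timelike_geodesic L g ->
  exists k, geo L k (g \o clamp).
Proof.
move=> H [[c cE] [a [b [h [gh [phi [/within_econt cp pm pa pb gE]]]]]]].
have [k [f [psi [gf cpsi psim [psia psib] hE]]]] := timelike_geodesic_geo H gh.
have [th _] := gh; have ab := directed_curve_lt th.
have z01 : 0 <= (0 : R) <= 1 by rewrite lexx ler01.
have o01 : 0 <= (1 : R) <= 1 by rewrite lexx ler01.
have pm' s t : 0 <= s -> s <= t -> t <= 1 -> phi s <= phi t.
  by move=> s0 st t1; apply: pm => //; rewrite in_itv /=; apply/andP; split; lra.
have pr t : 0 <= t <= 1 -> a <= phi t <= b.
  by move=> /andP[t0 t1]; rewrite -{1}pa -pb !pm'.
pose chi := psi \o phi.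
have gchi t : 0 <= t <= 1 -> g t = f (chi t).
  by move=> t01; rewrite gE ?in_itv // hE // pr.
have chi0 : chi 0 = 0 by rewrite /chi /= pa.
have chi1 : chi 1 = 1 by rewrite /chi /= pb.
have chim s t : 0 <= s -> s <= t -> t <= 1 -> chi s <= chi t.
  move=> s0 st t1; rewrite /chi /=.
  have s01 : 0 <= s <= 1 by apply/andP; split; lra.
  have t01 : 0 <= t <= 1 by apply/andP; split; lra.
  have /andP[? ?] := pr s s01; have /andP[? ?] := pr t t01.
  by apply: psim => //; exact: pm'.
have chir t : 0 <= t <= 1 -> 0 <= chi t <= 1.
  by move=> /andP[t0 t1]; rewrite -{1}chi0 -chi1 !chim.
have cchi : econt adist 0 1 chi := econt_comp cpsi cp pr.
have [_ k0 [d d0 fE]] := gf.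
have len t : 0 <= t <= 1 -> tau_length L 0 t g = (k * chi t)%:E.
  move=> /andP[t0 t1].
  rewrite (tau_sum_potential (f := fun s => k * chi s) H t0); first by rewrite chi0 mulr0 subr0.
    move=> u v u0 uv vt.
    have u01 : 0 <= u <= 1 by apply/andP; split; lra.
    have v01 : 0 <= v <= 1 by apply/andP; split; lra.
    have /andP[? ?] := chir u u01; have /andP[? ?] := chir v v01.
    by rewrite !gchi //; apply: (geo_ca H gf) => //; apply: chim => //; lra.
  move=> w /andP[w0 wt].
  have w01 : 0 <= w <= 1 by apply/andP; split; lra.
  have d20 : 0 < d / 2 by lra.
  have [r r0 hr] := cchi w w01 (d / 2) d20.
  exists r => // u v u0 uv vt uw vw.
  have u01 : 0 <= u <= 1 by apply/andP; split; lra.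
  have v01 : 0 <= v <= 1 by apply/andP; split; lra.
  have := hr u u01 uw; have := hr v v01 vw; rewrite /adist !ltr_norml => /andP[? ?] /andP[? ?].
  have /andP[? ?] := chir u u01; have /andP[? ?] := chir v v01.
  rewrite !gchi // fE ?mulrBr //; [|lra].
  by apply: chim => //; lra.
have ck : c = k by have := cE 1 o01; rewrite len // chi1 !mulr1 => -[].
have chiE t : 0 <= t <= 1 -> chi t = t.
  move=> t01; have := cE t t01; rewrite len // ck => -[].
  by move=> /(mulfI (lt0r_neq0 k0)).
have gf' t : 0 <= t <= 1 -> g t = f t by move=> t01; rewrite gchi // chiE.
have [cf _ _] := gf.
exists k; split=> //.
  apply: continuous_within_clamp => t t01 e e0.
  have [r r0 hr] := proj1 (continuousP_dist f) cf t e e0.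
  by exists r => // s s01 st; rewrite !gf' //; exact: hr.
exists d => // s t s0 st t1 std /=.
have s01 : 0 <= s <= 1 by apply/andP; split; lra.
have t01 : 0 <= t <= 1 by apply/andP; split; lra.
by rewrite !clampE // !gf' // fE.
Qed.

Lemma cs_maximizer_geodesic L g : cs_timelike_maximizer L g -> cs_timelike_geodesic L g.
Proof.
move=> [cg [a [b [h [[th mh] rh]]]]]; split=> //; exists a, b, h; split=> //.
split=> //; split; first by case: mh.
move=> t tab; exists a, b; split=> //; exact: withinT.
Qed.

End Geodesics.

(** * Existence, uniqueness, continuous dependence and global concavity *)

Section MainResults.
Context {R : realType} {X : metricType R} {L : causal_data X}.
Implicit Types (x y p : X) (g h : R -> X) (k m : R).
Hypothesis H : concave_spacetime L.
Hypothesis hgood : forall p, exists V, [/\ good L V, V p &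
  forall k g, tmax L k g -> V (g 0) -> V (g 1) -> ltl L 0 1 g].
Hypothesis hone : future_one_connected L.

Lemma future_connected_geo x y : chron L x y ->
  exists k g, [/\ geo L k g, g 0 = x & g 1 = y].
Proof.
move=> xy; have [a [b [c [tc ca cb]]]] := hone.1 x y xy.
have ab := directed_curve_lt tc; have cc := directed_curve_econt tc.
have z01 : 0 <= (0 : R) <= 1 by rewrite lexx ler01.
have o01 : 0 <= (1 : R) <= 1 by rewrite lexx ler01.
apply: (@timelike_curve_geo _ _ _ H _ _ ((c \o affine a b) \o clamp)).
- apply: continuous_within_clamp; apply: (econt_comp cc (@econt_affine _ a b 0 1)).
  by move=> t t01; apply: affine_itv => //; exact: ltW.
- by rewrite /= clampE // affine0.
- by rewrite /= clampE // affine1.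
- move=> s t s0 st t1 /=; rewrite !clampE; [|apply/andP; split; lra..].
  by apply: (directed_curveP tc); rewrite /affine; nra.
Qed.

(** Future one-connectedness speaks of locally Lipschitz curves; this puts a geodesic in that form.
    Positivity of [p] for [t > 0] ensures that the initial segments of [g] used as a lift are
    nondegenerate. *)
Lemma geo_lipschitz_curve k g : geo L k g -> exists h (p : R -> R),
  [/\ future_timelike L `[0, 1] h, continuous p, forall t, 0 < t <= 1 -> 0 < p t <= 1,
      p 0 = 0 /\ p 1 = 1 & forall t, 0 <= t <= 1 -> h t = g (p t)].
Proof.
move=> gg; have gch s t : 0 <= s -> s < t -> t <= 1 -> chron L (g s) (g t).
  by move=> s0 st t1; exact: (geo_ch H gg).
have [h [om [th _ [oc o01 om_mono [om0 om1] hE]]]] :=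
  ltl_inverse H (geo_ltl H hgood gg) gch.
have z01 : 0 <= (0 : R) <= 1 by rewrite lexx ler01.
have i01 : 0 <= (1 : R) <= 1 by rewrite lexx ler01.
exists h, (om \o clamp); split=> //.
- move=> t; apply/cvgrPdist_lt => e e0; have [d d0 hd] := oc _ (clamp_itv t) e e0.
  exists d => //= s st; apply: hd; first exact: clamp_itv.
  by apply: le_lt_trans (clamp_dist s t) _; rewrite distrC.
- move=> t /andP[t0 t1]; have t01 : 0 <= t <= 1 by rewrite ltW.
  rewrite /= clampE //; have /andP[u0 ->] := o01 t t01; rewrite andbT.
  rewrite lt_neqAle u0 andbT; apply/eqP => e.
  have := directed_curveP th (lexx 0) t0 t1.
  by rewrite !hE // om0 -e; exact: ch_irr H _.
- by rewrite /= !clampE.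
- by move=> t t01; rewrite /= clampE // hE.
Qed.

Lemma geo_unique k m g h : geo L k g -> geo L m h -> g 0 = h 0 -> g 1 = h 1 ->
  eq01 g h.
Proof.
move=> gg gh e0 e1.
have [c0 [p0 [t0 cp0 pos0 [p00 p01] E0]]] := geo_lipschitz_curve gg.
have [c1 [p1 [t1 cp1 pos1 [p10 p11] E1]]] := geo_lipschitz_curve gh.
have z01 : 0 <= (0 : R) <= 1 by rewrite lexx ler01.
have o01 : 0 <= (1 : R) <= 1 by rewrite lexx ler01.
have [||||Ho [/subspace_continuousP cH HE Ht Hx]] :=
  hone.2 (g 0) (g 1) c0 c1 t0 _ _ t1.
- by rewrite E0 // p00.
- by rewrite E0 // p01.
- by rewrite E1 // p10.
- by rewrite E1 // p11.
apply: (@homotopy_geo_uniq _ _ _ H (g 0) (g 1) (fun s t => Ho (s, t)) k m g h p0 p1) => //.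
- move=> s t s01 t01 e e0'.
  have st : (`[0, 1] `*` `[0, 1]) (s, t) by split; rewrite /= in_itv.
  have := cH (s, t) st => /metricType_numDomainType.cvgrPdist_lt/(_ e e0').
  case=> -[A B] /= [[d1 /= d10 hA] [d2 /= d20 hB]] AB.
  exists (Num.min d1 d2); first by rewrite lt_min d10.
  move=> s' t' s'01 t'01; rewrite !lt_min => /andP[h1 _] /andP[_ h2].
  apply: (AB (s', t')).
    by split; [apply: hA|apply: hB]; rewrite /= distrC.
  by split; rewrite /= in_itv.
- move=> s t t' s01 t_ge0 tt' t'1.
  have s01' : s \in `[0, 1] by rewrite in_itv.
  exact: (directed_curveP (Ht s s01')).
- by move=> t t01; split; [exact: pos0|exact: pos1].
- move=> t t01; have [|-> ->] := HE t; first by rewrite in_itv.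
  by rewrite E0 ?E1.
Qed.

Lemma unique_geodesic x y : chron L x y -> unique_timelike_geodesic L x y.
Proof.
move=> xy; have [k [g [gg g0 g1]]] := future_connected_geo xy.
exists g; split=> //; first exact: (geo_cs H gg (geo_ltl H hgood gg)).
move=> a b h gh ha hb.
have [m [f [psi [gf cpsi psim [psia psib] hE]]]] := timelike_geodesic_geo H gh.
have [th _] := gh; have ab := directed_curve_lt th.
have E : eq01 f g.
  apply: (geo_unique gf gg).
    by rewrite g0 -ha hE ?psia // lexx ltW.
  by rewrite g1 -hb hE ?psib // lexx ltW.
exists psi; split=> //.
- exact/within_econt.
- by move=> s t; rewrite !in_itv /= => /andP[? ?] /andP[? ?] st; exact: psim.
- move=> t; rewrite in_itv /= => /andP[at_ tb]; rewrite hE ?at_ // E //.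
  by rewrite -{1}psia -psib !psim.
Qed.

Lemma vary_continuously : geodesics_vary_continuously L.
Proof.
move=> G hG; apply/subspace_continuousP => -[[x y] t] /= [xy t01].
have [cg g0 g1] := hG x y xy; have [k gk] := cs_geodesic_geo H cg.
apply/metricType_numDomainType.cvgrPdist_lt => e e0.
have e20 : 0 < e / 2 by rewrite divr_gt0.
have [d d0 hd] := geo_vary H geo_unique gk e20.
have [cc _ _] := gk.
have [r r0 hr] := proj1 (continuousP_dist _) cc t _ e20.
rewrite near_withinE.
exists ([set p : X * X | mdist x p.1 < d /\ mdist y p.2 < d], [set s : R | `|s - t| < r]).
  split=> /=.
    exists ([set p | mdist x p < d], [set p | mdist y p < d]); last by move=> p /=.
    by split; apply/metricType_numDomainType.nbhs_mdistP; exists d.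
  by exists r => //= s; rewrite /= distrC.
move=> [[x' y'] s] /= [[xd yd] sr] [xy' s01].
have [cg' g0' g1'] := hG x' y' xy'; have [k' gk'] := cs_geodesic_geo H cg'.
have z01 : 0 <= (0 : R) <= 1 by rewrite lexx ler01.
have o01 : 0 <= (1 : R) <= 1 by rewrite lexx ler01.
have cl : uclose (e / 2) (G x' y' \o clamp) (G x y \o clamp).
  by apply: (hd _ _ gk'); rewrite /= !clampE // ?g0 ?g1 ?g0' ?g1'.
have := cl s s01; have := hr s sr; rewrite /= !clampE // => h1 h2.
by have := metric_triangle (G x y t) (G x y s) (G x' y' s); lra.
Qed.

Lemma length_space_concave : lorentzian_length_space L -> globally_concave L.
Proof.
move=> [_ _ _ _ tauE].
have hex := future_connected_geo; have huniq := geo_unique.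
(* Here the length structure enters: tau is a supremum of lengths of causal curves, each at most
   [k]. *)
have htau k g : geo L k g -> tau L (g 0) (g 1) = k%:E.
  move=> gg; apply/eqP; rewrite eq_le; apply/andP; split; last first.
    by have [_] := geo_tau H gg (lexx 0) ler01 (lexx 1); rewrite subr0 mulr1.
  have [_ k0 _] := gg.
  rewrite tauE ge_max lee_fin ltW //=; apply: ge_ereal_sup => _ [a [b [c [[fc ca cb _] ->]]]].
  have ab := directed_curve_lt fc.
  apply: (tau_length_le_geo H hex huniq (ltW ab)) (esym ca) (esym cb) => //.
    exact: directed_curve_econt fc.
  move=> s t as_; rewrite le_eqVlt => /orP[/eqP-> _|st tb]; first exact: ca_refl H _.
  exact: (directed_curveP fc).
have fin p q := tau_fin H hex htau p q.
split.
- apply/subspace_continuousP => -[x y] _ /=.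
  suff : (fun z : X * X => tau L z.1 z.2) @ within (setT `*` setT) (nbhs (x, y))
      --> (tf L x y)%:E by rewrite /tf (fineK (fin x y)).
  apply/fine_cvgP; split.
    by apply: nearW => -[x' y']; exact: fin.
  apply/cvgrPdist_lt => e e0; have [d d0 hd] := tau_continuous H hex huniq htau x y e0.
  rewrite near_withinE; exists ([set p | mdist x p < d], [set p | mdist y p < d]).
    by split; apply/metricType_numDomainType.nbhs_mdistP; exists d.
  by move=> [x' y'] /= [xd yd] _; exact: hd.
- move=> x y _ _ xy; have [k [g [gg g0 g1]]] := hex x y xy.
  have gm := geo_tmax_global H htau gg.
  have [h [[th [fh len]] [phi [_ _ p0 p1 gE]]]] :=
    tmax_timelike_maximizer H gm (geo_ltl H hgood gg).
  have h0 : h 0 = x by rewrite -g0 gE ?p0 // in_itv /= lexx ler01.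
  have h1 : h 1 = y by rewrite -g1 gE ?p1 // in_itv /= lexx ler01.
  by exists 0, 1, h; split; [split|rewrite len h0 h1].
- move=> al be mal mbe _ _ c0 c1 t t01.
  have [k gal] := cs_geodesic_geo H (cs_maximizer_geodesic mal).
  have [m gbe] := cs_geodesic_geo H (cs_maximizer_geodesic mbe).
  have z01 : 0 <= (0 : R) <= 1 by rewrite lexx ler01.
  have o01 : 0 <= (1 : R) <= 1 by rewrite lexx ler01.
  have := global_quad H hex huniq htau gal gbe; rewrite /= !clampE // => q.
  by have := q c0 c1 t t01; rewrite !clampE.
- move=> al be mal mbe _ _ c0 c1 t t01.
  have H' := concave_spacetime_dual H.
  have [k gal] := cs_geodesic_geo H' (cs_maximizer_geodesic mal).
  have [m gbe] := cs_geodesic_geo H' (cs_maximizer_geodesic mbe).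
  (* Reversed, the past-directed curves are future-directed geodesics of [L]; the two end conditions
     trade places and [t] becomes [1 - t]. *)
  have {}gal := geo_dual gal; have {}gbe := geo_dual gbe.
  rewrite time_dualK in gal; rewrite time_dualK in gbe.
  have z01 : 0 <= (0 : R) <= 1 by rewrite lexx ler01.
  have o01 : 0 <= (1 : R) <= 1 by rewrite lexx ler01.
  have := global_quad H hex huniq htau gal gbe.
  rewrite !rev_curve0 !rev_curve1 /= !clampE // => q.
  have t01' : 0 <= 1 - t <= 1 by move: t01 => /andP[? ?]; apply/andP; split; lra.
  have tE : 1 - (1 - t) = t by ring.
  have := q c1 c0 (1 - t) t01'; rewrite /rev_curve /= !tE clampE //.
  by rewrite addeC.
Qed.

End MainResults.

Theorem theorem4p8 (R : realType) (X : metricType R) (L : causal_data X)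
  (hL : lorentzian_pre_length_space L)
  (hgh : globally_hyperbolic L)
  (hsc : strongly_causal L)
  (hlcc : locally_causally_closed L)
  (hreg : regular L)
  (hconc : locally_concave L)
  (hone : future_one_connected L) :
  (forall x y : X, chron L x y -> unique_timelike_geodesic L x y) /\
  geodesics_vary_continuously L /\
  (lorentzian_length_space L -> globally_concave L).
Proof.
(* One chronological pair is what puts every point into a diamond. With no such pair, the assertions
   on existence and continuity are vacuous. *)
have hcst : (exists x y, chron L x y) -> concave_spacetime L /\
    forall p, exists V, [/\ good L V, V p &
      forall k g, tmax L k g -> V (g 0) -> V (g 1) -> ltl L 0 1 g].
  move=> hne; have C := pl_causal_spacetime hL hsc hone hne hgh.
  split; first exact: (concave_spacetime_of_good hL hsc C hreg hconc).
  move=> p; have [V [gV Vp _ hV]] := good_neighbourhood hL hsc C hreg hconc p ltr01.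
  by exists V.
split; last split.
- move=> x y xy; have [|H hgood] := hcst; first by exists x, y.
  exact: (unique_geodesic H hgood hone).
- have [/hcst[H hgood]|n] := pselect (exists x y, chron L x y).
    exact: (vary_continuously H hgood hone).
  move=> G _; apply/subspace_continuousP => -[[x y] t] [xy _].
  by case: n; exists x, y.
(* In a nonempty length space, localizability provides a point in the future of [p], hence a
   chronological pair. *)
- move=> hls; have [[p _]|n] := pselect (exists p : X, True).
    have [|H hgood] := hcst; last exact: (length_space_concave H hgood hone hls).
    have [_ _ _ loc _] := hls; have [Om [_ Op _ [om [_ _ hI _]]]] := loc p.
    by have [[z _ pz] _] := hI p Op; exists p, z.
  split.
  + by apply/subspace_continuousP => -[x y]; case: n; exists x.
  + by move=> x; case: n; exists x.
  + by move=> al; case: n; exists (al 0).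
  + by move=> al; case: n; exists (al 0).
Qed.
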